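(* Let $n\in\mathbb N$ and let $\nu$ be a strongly connected multi-type Galton--Watson measure whose types are ordered pairs of elements of $[n]$. Then there exists a probability measure $\mu$ on $\mathbf T_n$ such that $\mu$ is reversible for simple random walk and $\mu\sim\nu$ if and only if the following two conditions hold. (i) For all $i,j,k\in[n]$ and $\mathbf c\in\mathbf S_n$ with $c_j>0$, $\nu_{j,i}(\mathbf c-\mathbf e_j)>0$ and $c_k>0$, we have $\nu_{k,i}(\mathbf c-\mathbf e_k)>0$. (ii) For all $k\ge 2$, all $i_1,\dots,i_k\in[n]$ with $i_k=i_1$, and all $\mathbf c(1),\dots,\mathbf c(k)\in\mathbf S_n$ with $\mathbf c(k)=\mathbf c(1)$ such that, for every $p\in\{1,\dots,k-1\}$, $c(p)_{i_{p+1}}>0$, $c(p+1)_{i_p}>0$ and $\nu_{i_p,i_{p+1}}\big(\mathbf c(p+1)-\mathbf e_{i_p}\big)>0$, and such that for all distinct $s,t\in\{1,\dots,k-1\}$ with $i_s=i_t$ we have $\mathbf c(s)\ne\mathbf c(t)$, the following equality holds: $$\prod_{p=1}^{k-1}\frac{\nu_{i_p,i_{p+1}}\big(\mathbf c(p+1)-\mathbf e_{i_p}\big)}{\nu_{i_{p+1},i_p}\big(\mathbf c(p)-\mathbf e_{i_{p+1}}\big)}\cdot\frac{c(p)_{i_{p+1}}}{c(p+1)_{i_p}}=1 .$$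
   Context: Notation. $[n]=\{1,\dots,n\}$; $\mathbf S_n=\{(c_1,\dots,c_n): c_i\in\mathbb N\cup\{0\}\}$; $\mathbf e_j$ is the $j$-th standard basis vector; for vectors $\mathbf c(1),\mathbf c(2),\dots$ in $\mathbf S_n$, $c(p)_q$ denotes the $q$-th coordinate of $\mathbf c(p)$. $\mathbf T_n$ is the set of isomorphism classes (root-, adjacency- and label-preserving) of locally finite rooted trees $(T,o)$ whose vertices are labeled by elements of $[n]$, with the $\sigma$-field generated by the events ''the restriction of $(T,o)$ to vertices at distance at most $h$ from $o$ is isomorphic to a given finite labeled rooted tree of height $h$''. Children of the root are its neighbors; the parent of $x\ne o$ is its neighbor on the path to $o$, its other neighbors are its children. A vertex ''has $\mathbf c$ neighbors (children)'' if for every $j\in[n]$ it has exactly $c_j$ neighbors (children) with label $j$. Galton--Watson measure with pair types. The set of types of $\nu$ is a set $\Theta$ of ordered pairs of elements of $[n]$, every element of $[n]$ being the second coordinate of some type. A vertex of type $(i,j)$ (to be thought of as a vertex with label $j$ whose parent has label $i$) only has children of types $(j,k)$, $k\in[n]$; $\nu_{i,j}(\mathbf c)$ is the probability that a vertex of type $(i,j)$ has exactly $c_k$ children of type $(j,k)$ for every $k\in[n]$. Put $\nu_{i,j}(\mathbf c)=0$ if $(i,j)\notin\Theta$. Given their types, vertices reproduce independently. $\nu$ is strongly connected if for any two types $s,t\in\Theta$, the root has type $s$ with positive probability and, given that the root has type $s$, the tree contains a vertex of type $t$ with positive probability. The relation $\mu\sim\nu$: for a probability measure $\mu$ on $\mathbf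 T_n$, $\mu\sim\nu$ means that under $\mu$, conditionally on the labels of the root and of its neighbors, the descendant subtrees rooted at the neighbors of the root are independent, and the one at a neighbor with label $j$ of a root with label $i$ is a Galton--Watson tree with the offspring distributions of $\nu$ started from a vertex of type $(i,j)$ (so $(i,j)\in\Theta$), where each non-root vertex with label $b$ whose parent has label $a$ is given type $(a,b)$. Simple random walk on $\mathbf T_n$ moves from $(T,o)$ to $(T,o')$ with $o'$ a uniformly chosen neighbor of $o$; $\mathbf P((T,o)\to A)$ is the probability that one step leads into $A$. $\mu$ is reversible if $\int_A\mathbf P((T,o)\to B)\,d\mu=\int_B\mathbf P((T,o)\to A)\,d\mu$ for all measurable $A,B\subset\mathbf T_n$. Standing assumptions on $\mu$: the root has label $i$ with positive $\mu$-probability for every $i\in[n]$, and the root has at least one neighbor $\mu$-a.s. (so that simple random walk is defined). *)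

(* Defs.v *)
From HB Require Import structures.
From mathcomp Require Import all_boot all_order all_algebra finmap.
From mathcomp Require Import generic_quotient.
From mathcomp Require Import all_classical all_reals all_analysis.

Set Implicit Arguments.
Unset Strict Implicit.
Unset Printing Implicit Defensive.

Import Order.TTheory GRing.Theory Num.Theory.

Local Open Scope quotient_scope.
Local Open Scope classical_set_scope.
Local Open Scope ring_scope.

(* The set of labels is 'I_n.+1: the parameter [n] is everywhere the number of
   labels minus one, so that there is at least one label. *)

Definition Sn (n : nat) := {ffun 'I_n.+1 -> nat}.

(* c - e_j; the subtraction is truncated, so it is meaningful when 0 < c j. *)
Definition sub_e (n : nat) (c : Sn n) (j : 'I_n.+1) : Sn n :=
  [ffun k => (c k - (k == j))%N].

Record rgraph (n : nat) (V : choiceType) := RGraph {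
  vtx : set V;
  adj : rel V;
  lab : V -> 'I_n.+1;
  root : V }.

Definition nbrs n V (g : rgraph n V) (x : V) : set V := [set y | adj g x y].

Record is_tree n V (g : rgraph n V) : Prop := IsTree {
  tree_root : vtx g (root g);
  tree_adj : forall x y, adj g x y -> vtx g x /\ vtx g y;
  tree_sym : symmetric (adj g);
  tree_irr : irreflexive (adj g);
  tree_connected : forall x y, vtx g x -> vtx g y ->
    exists2 p, path (adj g) x p & last x p = y;
  tree_acyclic : forall p, cycle (adj g) p -> uniq p -> (size p <= 2)%N;
  tree_locally_finite : forall x, finite_set (nbrs g x) }.

Definition iso n V W (g : rgraph n V) (h : rgraph n W) : Prop :=
  exists f : V -> W, [/\ set_bij (vtx g) (vtx h) f,
    forall x y, vtx g x -> vtx g y -> adj h (f x) (f y) = adj g x y,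
    forall x, vtx g x -> lab h (f x) = lab g x
  & f (root g) = root h].

Definition reroot n V (g : rgraph n V) (x : V) : rgraph n V :=
  RGraph (vtx g) (adj g) (lab g) x.

Definition induced n V (g : rgraph n V) (S : set V) (x : V) : rgraph n V :=
  RGraph (vtx g `&` S) (fun y z => [&& adj g y z, `[< S y >] & `[< S z >]])
    (lab g) x.

Definition ball n V (h : nat) (g : rgraph n V) : rgraph n V :=
  induced g [set y | exists p, [/\ path (adj g) (root g) p,
    last (root g) p = y & (size p <= h)%N]] (root g).

(* the descendant subtree at a vertex [x] adjacent to the root: the component
   of [x] in [g] minus its root *)
Definition descendants n V (g : rgraph n V) (x : V) : rgraph n V :=
  induced g [set y | exists p, [/\ path (adj g) x p,
    last x p = y & root g \notin x :: p]] x.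

Definition parent n V (g : rgraph n V) (u v : V) : Prop :=
  exists p, [/\ path (adj g) v (u :: p), uniq [:: v, u & p]
    & last u p = root g].

Definition nb n V (g : rgraph n V) (x : V) (j : 'I_n.+1) : nat :=
  #|` fset_set (nbrs g x `&` [set y | lab g y = j])|.

(* A connected locally finite graph is countable, so every isomorphism class has
   a representative whose vertices are natural numbers. *)

Definition rtree (n : nat) := {g : rgraph n nat | is_tree g}.

HB.instance Definition _ n := gen_eqMixin (rtree n).
HB.instance Definition _ n := gen_choiceMixin (rtree n).

Definition rtree_graph n (t : rtree n) : rgraph n nat := proj1_sig t.
Coercion rtree_graph : rtree >-> rgraph.

Lemma iso_refl n V (g : rgraph n V) : iso g g.
Proof. by exists id; split=> //; split=> // x gx; exists x. Qed.

Lemma iso_sym n V W (g : rgraph n V) (h : rgraph n W) :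
  vtx g (root g) -> iso g h -> iso h g.
Proof.
move=> gr [f [[fS fI fJ] fa fl fr]].
have ex y : exists x, vtx h y -> vtx g x /\ f x = y.
  have [hy|nhy] := pselect (vtx h y); last by exists (root g).
  by have [x gx fx] := fJ _ hy; exists x.
have [k kP] := boolp.choice ex.
have fK x : vtx g x -> k (f x) = x.
  move=> gx; have [gk fk] := kP _ (fS _ gx).
  by apply: fI; rewrite ?inE.
exists k; split=> [|x y hx hy|x hx|].
- split=> [y hy|x y|x gx]; first by have [] := kP _ hy.
    rewrite !inE => hx hy kxy.
    by have [_ <-] := kP _ hx; have [_ <-] := kP _ hy; rewrite kxy.
  by exists (f x); [exact: fS | exact: fK].
- have [gx fx] := kP _ hx; have [gy fy] := kP _ hy.
  by rewrite -fa // fx fy.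
- by have [gx fx] := kP _ hx; rewrite -fl // fx.
- by rewrite -fr fK.
Qed.

Lemma iso_trans n U V W (g : rgraph n U) (h : rgraph n V) (k : rgraph n W) :
  iso g h -> iso h k -> iso g k.
Proof.
move=> [f [fb fa fl fr]] [f' [fb' fa' fl' fr']].
have fS x : vtx g x -> vtx h (f x) by case: fb => fS _ _; exact: fS.
exists (f' \o f); split=> [|x y gx gy|x gx|] /=.
- exact: set_bij_comp fb fb'.
- by rewrite fa' ?fa //; exact: fS.
- by rewrite fl' ?fl //; exact: fS.
- by rewrite fr.
Qed.

Definition iso_rel n : rel (rtree n) := fun s t => `[< iso s t >].

Lemma iso_rel_equiv n : equiv_class_of (@iso_rel n).
Proof.
split=> [t|s t|t s u].
- by apply/asboolP; exact: iso_refl.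
- by apply/asboolP/asboolP; apply: iso_sym;
    [case: s | case: t] => ? H; exact: tree_root H.
- by move=> /asboolP st /asboolP tu; apply/asboolP; exact: iso_trans st tu.
Qed.

Canonical iso_equiv n := EquivRelPack (@iso_rel_equiv n).

Definition Tn (n : nat) := {eq_quot (@iso_equiv n)}.

HB.instance Definition _ n := Choice.on (Tn n).
HB.instance Definition _ n := EqQuotient.on (Tn n).

Definition rep n (T : Tn n) : rgraph n nat := rtree_graph (repr T).

(* [T] is the isomorphism class of [g] *)
Definition class_of n V (T : Tn n) (g : rgraph n V) : Prop := iso (rep T) g.

Definition point_graph n : rgraph n nat :=
  RGraph [set 0%N] (fun _ _ => false) (fun _ => ord0) 0%N.

Lemma point_graph_tree n : is_tree (point_graph n).
Proof.
split=> //= [x y -> ->|[|x []] //|x]; first by exists [::].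
rewrite (_ : nbrs _ _ = set0); first exact: finite_set0.
by apply/seteqP; split.
Qed.

HB.instance Definition _ n :=
  isPointed.Build (Tn n) (\pi_(Tn n) (exist _ _ (point_graph_tree n))).

(* Trees [t] that are infinite or of height larger than [h] only contribute
   the empty set. *)
Definition ball_events n : set (set (Tn n)) :=
  [set A | exists (h : nat) (t : rtree n), A = [set T | iso (ball h (rep T)) t]].

Definition Tspace n := g_sigma_algebraType (@ball_events n).

Definition root_label n (i : 'I_n.+1) : set (Tspace n) :=
  [set T | lab (rep T) (root (rep T)) = i].

Definition root_nbrs n (i : 'I_n.+1) (c : Sn n) : set (Tspace n) :=
  [set T | root_label i T /\ forall j, nb (rep T) (root (rep T)) j = c j].

(* the probability that one step of simple random walk from [T] leads into [A]
   (0 if the root has no neighbor) *)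
Definition step (R : realType) n (T : Tspace n) (A : set (Tspace n)) : R :=
  let g := rep T in
  let N := nbrs g (root g) in
  #|` fset_set (N `&` [set x | exists2 T', A T' & class_of T' (reroot g x)])|%:R
  / #|` fset_set N|%:R.

Definition reversible (R : realType) n (mu : probability (Tspace n) R) : Prop :=
  forall A B : set (Tspace n), measurable A -> measurable B ->
  (\int[mu]_(T in A) (step R T B)%:E = \int[mu]_(T in B) (step R T A)%:E)%E.

Definition standing (R : realType) n (mu : probability (Tspace n) R) : Prop :=
  (forall i, (0 < mu (root_label i))%E) /\
  {ae mu, forall T, nbrs (rep T) (root (rep T)) !=set0}.

Definition mutually_independent (R : realType) d (Om : measurableType d)
    (Q : probability Om R) (I : choiceType) (K : set I)
    (E : I -> set (set Om)) : Prop :=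
  forall (J : {fset I}) (A : I -> set Om),
    (forall i, i \in J -> K i /\ E i (A i)) ->
    (Q (\bigcap_(i in [set` J]) A i) = \prod_(i <- J) Q (A i))%E.

Record gw_measure (R : realType) (n : nat) := GWMeasure {
  types : {set 'I_n.+1 * 'I_n.+1};
  (* distribution of the type of the root *)
  init : 'I_n.+1 * 'I_n.+1 -> R;
  offspring :> 'I_n.+1 -> 'I_n.+1 -> Sn n -> R;
  types_snd : forall j, exists i, (i, j) \in types;
  init_ge0 : forall s, 0 <= init s;
  init_sum : \sum_(s in types) init s = 1;
  offspring_ge0 : forall i j c, 0 <= offspring i j c;
  offspring_sum : forall i j, (i, j) \in types ->
    (\esum_(c in [set: Sn n]) (offspring i j c)%:E = 1)%E;
  offspring_notin : forall i j c, (i, j) \notin types -> offspring i j c = 0;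
  offspring_types : forall i j k c,
    0 < offspring i j c -> (0 < c k)%N -> (j, k) \in types }.

(* Vertices of a Galton-Watson tree are words: the children with label [k] of
   the vertex [v] are [rcons v (k, m)], where [m] is less than their number. *)
Definition word (n : nat) := seq ('I_n.+1 * nat).

(* the type of the vertex [v] when the root has type [s] *)
Fixpoint word_type n (s : 'I_n.+1 * 'I_n.+1) (v : word n) :=
  if v is x :: v' then word_type (s.2, x.1) v' else s.

(* [xi (v, s)] is the offspring vector of the vertex [v] if it has type [s] *)
Fixpoint gw_vertex n (xi : word n * ('I_n.+1 * 'I_n.+1) -> Sn n)
    (s : 'I_n.+1 * 'I_n.+1) (v : word n) : bool :=
  if v is x :: v' then
    (x.2 < xi ([::], s) x.1)%N &&
    gw_vertex (fun a => xi (x :: a.1, a.2)) (s.2, x.1) v'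
  else true.

Definition is_child n (u v : word n) : bool :=
  (size v == (size u).+1) && prefix u v.

Definition gw_graph n (xi : word n * ('I_n.+1 * 'I_n.+1) -> Sn n)
    (s : 'I_n.+1 * 'I_n.+1) : rgraph n (word n) :=
  RGraph [set v | gw_vertex xi s v]
    (fun u v => [&& gw_vertex xi s u, gw_vertex xi s v
      & is_child u v || is_child v u])
    (fun v => (word_type s v).2) [::].

(* [P] is the distribution of the Galton-Watson tree started from a vertex of
   type [s] *)
Definition gw_law (R : realType) n (nu : gw_measure R n)
    (s : 'I_n.+1 * 'I_n.+1) (P : set (Tspace n) -> \bar R) : Prop :=
  exists d (Om : measurableType d) (Q : probability Om R)
    (xi : word n * ('I_n.+1 * 'I_n.+1) -> Om -> Sn n)
    (X : {mfun Om >-> Tspace n}),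
  [/\ forall a c, measurable [set w | xi a w = c],
      forall a c, a.2 \in types nu ->
        Q [set w | xi a w = c] = (nu a.2.1 a.2.2 c)%:E,
      mutually_independent Q [set a | a.2 \in types nu]
        (fun a => [set [set w | B (xi a w)] | B in [set: set (Sn n)]]),
      forall w, class_of (X w) (gw_graph (xi^~ w) s)
    & forall A, measurable A -> P A = Q (X @^-1` A)].

(* The type of a non-root vertex is the pair of the labels of its parent and of
   itself; the root is given the type [s]. *)
Definition contains_type n (s t : 'I_n.+1 * 'I_n.+1) : set (Tspace n) :=
  [set T | s = t \/ exists u v, [/\ parent (rep T) u v,
     lab (rep T) u = t.1 & lab (rep T) v = t.2]].

Definition strongly_connected (R : realType) n (nu : gw_measure R n) : Prop :=
  forall s t, s \in types nu -> t \in types nu ->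
  0 < init nu s /\
  exists2 P : probability (Tspace n) R, gw_law nu s P
    & (0 < P (contains_type s t))%E.

(* [X] enumerates the classes of the descendant subtrees of [T] at the
   neighbors of the root, the one at index [l] being rooted at a vertex with
   label [k l] *)
Definition root_subtrees n (T : Tspace n) m (k : 'I_m -> 'I_n.+1)
    (X : 'I_m -> Tspace n) : Prop :=
  exists x : 'I_m -> nat,
  [/\ set_bij [set: 'I_m] (nbrs (rep T) (root (rep T))) x,
      forall l, lab (rep T) (x l) = k l
    & forall l, class_of (X l) (descendants (rep T) (x l))].

(* Conditionally on the event [root_nbrs i c], [mu] is the distribution of a
   random tree whose descendant subtrees at the neighbors of the root are
   independent Galton-Watson trees; isomorphism classes do not order these
   neighbors, which is why the subtrees are listed on an auxiliary space. *)
Definition sim (R : realType) n (mu : probability (Tspace n) R)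
    (nu : gw_measure R n) : Prop :=
  forall i c, (0 < mu (root_nbrs i c))%E ->
  (forall j, (0 < c j)%N -> (i, j) \in types nu) /\
  exists d (Om : measurableType d) (Q : probability Om R)
    (T : {mfun Om >-> Tspace n}) (m : nat) (k : 'I_m -> 'I_n.+1)
    (X : 'I_m -> {mfun Om >-> Tspace n}),
  [/\ forall A, measurable A ->
        (mu (A `&` root_nbrs i c) = mu (root_nbrs i c) * Q (T @^-1` A))%E,
      forall w, root_subtrees (T w) k (X^~ w),
      mutually_independent Q setT
        (fun l => [set X l @^-1` A | A in measurable])
    & forall l, gw_law nu (i, k l) (distribution Q (X l))].

(* Main.v *)
(* Let W(i,c) be the probability that the root has label i and c neighbors,
   divided by the number |c| of neighbors. Testing reversibility of mu on the
   events that the root has label i and c neighbors gives detailed balance: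
     W(i,c) c_j nu_{i,j}(d - e_i) = W(j,d) d_i nu_{j,i}(c - e_j).
   Strong connectivity propagates the positivity of W, and then (i) and (ii) can
   be read off this equation.

   Conversely, (ii) says that the ratios prescribed by detailed balance multiply
   to 1 along simple cycles, so that they have a potential W, and by (i) detailed
   balance takes the form W(i,c) c_j = K_{i,j} nu_{j,i}(c - e_j) with K symmetric.
   Join two independent Galton-Watson trees with roots of types (j,i) and (i,j) by
   an edge between their roots, and root the result J_{i,j} at the first one. The
   reversible measure is the normalization of the finite mixture
   sum_{i,j} K_{i,j} Law(J_{i,j}). Conditionally on its label i and its neighbors
   c, the root of the mixture carries independent Galton-Watson trees, and the
   pair formed by the tree before and after one step of the walk has the law of
   J_{i,j} rooted at the first and at the second end of the joining edge. This law
   is symmetric because K is. *)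

Require Import Defs.
From HB Require Import structures.
From mathcomp Require Import all_boot all_order all_algebra finmap.
From mathcomp Require Import generic_quotient zify.
From mathcomp Require Import all_classical all_reals all_analysis.
From mathcomp Require Import measurable_realfun.
(* [root] and [rgraph] are also names of MathComp. *)
Import Defs.

Set Implicit Arguments.
Unset Strict Implicit.
Unset Printing Implicit Defensive.

Import Order.TTheory GRing.Theory Num.Theory.

Local Open Scope quotient_scope.
Local Open Scope classical_set_scope.
Local Open Scope ring_scope.

(** * Isomorphisms of labeled rooted graphs *)

(** A class in [Tspace n] has only an arbitrarily chosen representative, so nothing random can be
    built from the vertices of [rep T]. Random trees are instead built on words, from one field [xi]
    of independent offspring vectors indexed by words and types. No product measure is constructed:
    strong connectivity provides a [gw_law], whose witness already carries such a field. Every other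
    field is an injective reindexing of this one, and reindexings with the same one-coordinate laws
    are interchangeable. So the second tree of J_{i,j} may sit at any child [(j, r)] of the first
    root. For each [r], on the event that the root has label i and neighbors c, the joint law of the
    trees at the two ends of the edge is nu_{j,i}(c - e_j) times the law of a tree with that root
    and of the same tree after a step to [(j, r)]. Sharing K_{i,j} nu_{j,i}(c - e_j) = W(i,c) c_j
    among the c_j values of [r] gives weight W(i,c) to every neighbor, hence mass proportional to
    W(i,c)|c| to the event and a uniform choice of the neighbor, which is one step of the walk. *)

Definition iso_by n (V W : choiceType) (f : V -> W) (g : rgraph n V)
    (h : rgraph n W) : Prop :=
  [/\ set_bij (vtx g) (vtx h) f,
    forall x y, vtx g x -> vtx g y -> adj h (f x) (f y) = adj g x y,
    forall x, vtx g x -> lab h (f x) = lab g x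
  & f (root g) = root h].

(** The part of [is_tree] that lets paths be transported: edges stay inside the vertex set, outside
    of which an isomorphism says nothing. *)
Definition wf_graph n (V : choiceType) (g : rgraph n V) : Prop :=
  vtx g (root g) /\ forall x y, adj g x y -> vtx g x /\ vtx g y.

Lemma is_tree_wf n (V : choiceType) (g : rgraph n V) : is_tree g -> wf_graph g.
Proof. by case=> ? ? *; split. Qed.

Lemma rep_tree n (T : Tn n) : is_tree (rep T).
Proof. by rewrite /rep /rtree_graph; case: (repr T). Qed.

Lemma rep_wf n (T : Tn n) : wf_graph (rep T).
Proof. exact/is_tree_wf/rep_tree. Qed.

Section iso_by_theory.
Variables (n : nat) (V W : choiceType) (f : V -> W).
Variables (g : rgraph n V) (h : rgraph n W).
Hypotheses (fgh : iso_by f g h).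

Lemma iso_by_vtx x : vtx g x -> vtx h (f x).
Proof. by case: fgh => -[fS _ _] _ _ _; exact: fS. Qed.

Lemma iso_by_inj x y : vtx g x -> vtx g y -> f x = f y -> x = y.
Proof. by case: fgh => -[_ fI _] _ _ _ gx gy; apply: fI; rewrite inE. Qed.

Lemma iso_by_surj y : vtx h y -> exists2 x, vtx g x & f x = y.
Proof. by case: fgh => -[_ _ fJ] _ _ _ /fJ [x gx <-]; exists x. Qed.

Lemma iso_by_adj x y : vtx g x -> vtx g y -> adj h (f x) (f y) = adj g x y.
Proof. by case: fgh => _ + _ _; apply. Qed.

Lemma iso_by_lab x : vtx g x -> lab h (f x) = lab g x.
Proof. by case: fgh => _ _ + _; apply. Qed.

Lemma iso_by_root : f (root g) = root h.
Proof. by case: fgh. Qed.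

Lemma iso_by_reroot x : iso_by f (reroot g x) (reroot h (f x)).
Proof. by case: fgh => fb fa fl _; split. Qed.

Hypotheses (wg : wf_graph g) (wh : wf_graph h).

Lemma wf_path x p y : vtx g x -> path (adj g) x p -> y \in x :: p -> vtx g y.
Proof.
elim: p x => [|z p IH] x gx /=; first by move=> _ /[!inE] /eqP ->.
move=> /andP[xz pz]; rewrite inE => /orP[/eqP -> //|].
by apply: IH => //; have [] := wg.2 _ _ xz.
Qed.

Lemma iso_by_path x p : vtx g x -> path (adj g) x p ->
  path (adj h) (f x) (map f p).
Proof.
elim: p x => //= z p IH x gx /andP[xz pz].
by have [_ gz] := wg.2 _ _ xz; rewrite iso_by_adj // xz IH.
Qed.

Lemma iso_by_lift x q : vtx g x -> path (adj h) (f x) q ->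
  exists2 p, path (adj g) x p & map f p = q.
Proof.
elim: q x => [|z q IH] x gx /=; first by exists [::].
move=> /andP[xz pz]; have [_ /iso_by_surj[y gy fy]] := wh.2 _ _ xz.
rewrite -fy in xz pz *; have [p pp <-] := IH _ gy pz.
by exists (y :: p) => //=; rewrite pp andbT -iso_by_adj.
Qed.

Lemma iso_by_nbrs x : vtx g x -> set_bij (nbrs g x) (nbrs h (f x)) f.
Proof.
move=> gx; split=> [y /= xy|y z|y /= fxy].
- by rewrite /nbrs /= iso_by_adj //; have [] := wg.2 _ _ xy.
- rewrite !inE /nbrs /= => xy xz.
  by apply: iso_by_inj; [have [] := wg.2 _ _ xy | have [] := wg.2 _ _ xz].
- have [_ /iso_by_surj[z gz fz]] := wh.2 _ _ fxy; exists z => //.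
  by rewrite /nbrs /= -iso_by_adj // fz.
Qed.

Lemma iso_by_induced (S : set V) (S' : set W) x :
  (forall y, vtx g y -> S' (f y) <-> S y) ->
  iso_by f (induced g S x) (induced h S' (f x)).
Proof.
move=> SS'; split=> //=.
- split=> [y [gy Sy]|y z|y [hy Sy]] /=.
  + by split; [exact: iso_by_vtx | exact/SS'].
  + by rewrite !inE /= => -[gy _] [gz _]; exact: iso_by_inj.
  + have [z gz fz] := iso_by_surj hy; exists z => //; split=> //.
    by apply/SS'; rewrite ?fz.
- move=> y z [gy Sy] [gz Sz]; rewrite iso_by_adj //.
  by rewrite (asbool_equiv_eq (SS' _ gy)) (asbool_equiv_eq (SS' _ gz)).
- by move=> y [gy _]; exact: iso_by_lab.
Qed.

Lemma iso_by_ball k : iso_by f (ball k g) (ball k h).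
Proof.
rewrite /ball -iso_by_root; apply: iso_by_induced => y gy /=.
split=> [[q [+ ql qs]]|[p [pp pl ps]]].
  move=> /(iso_by_lift wg.1)[p pp pq]; exists p; split=> //; last first.
    by rewrite -(size_map f) pq.
  apply: iso_by_inj => //; first by apply: wf_path pp _ => //; [exact: wg.1|exact: mem_last].
  by rewrite -last_map pq.
exists (map f p); split; first exact: iso_by_path wg.1 _.
  by rewrite last_map pl.
by rewrite size_map.
Qed.

Lemma iso_by_descendants x : vtx g x ->
  iso_by f (descendants g x) (descendants h (f x)).
Proof.
move=> gx; apply: iso_by_induced => y gy /=.
split=> [[q [+ ql qs]]|[p [pp pl ps]]].
  move=> /(iso_by_lift gx)[p pp pq]; exists p; split=> //.
    apply: iso_by_inj => //; first by apply: wf_path pp _ => //; exact: mem_last.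
    by rewrite -last_map pq.
  by apply: contra qs => rp; rewrite -pq -map_cons -iso_by_root map_f.
exists (map f p); split; first exact: iso_by_path gx _.
  by rewrite last_map pl.
apply: contra ps; rewrite -iso_by_root -map_cons => /mapP[z zp /iso_by_inj ->] //.
  exact: wg.1.
exact: wf_path pp zp.
Qed.

Lemma iso_by_nb x j : vtx g x -> nb h (f x) j = nb g x j.
Proof.
move=> gx; have [fS fI fJ] := iso_by_nbrs gx; rewrite /nb.
set A := _ `&` _; set B := _ `&` _.
have BA : A = f @` B.
  apply/seteqP; split=> [y [/= xy yl]|_ [y [/= xy yl] <-]] /=.
    have [z /= xz zy] := fJ _ xy; exists z => //; split=> //=.
    by rewrite -iso_by_lab ?zy //; have [] := wg.2 _ _ xz.
  split; first exact: fS.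
  by rewrite /= iso_by_lab //; have [] := wg.2 _ _ xy.
have Bf : {in B &, injective f}.
  by move=> y z; rewrite !inE => -[xy _] [xz _]; apply: fI; rewrite inE.
(* [fset_set] is empty on an infinite set, so both counts are then 0. *)
have [Bfin|Binf] := pselect (finite_set B); last first.
  have Ainf : ~ finite_set A.
    by apply: contra_not Binf; rewrite BA (eq_finite_set (inj_card_eq Bf)).
  rewrite /fset_set; case: pselect => // _; by case: pselect.
rewrite BA fset_set_image // card_in_imfset //= => y z.
by rewrite !in_fset_set //; exact: Bf.
Qed.

End iso_by_theory.

Lemma wf_induced n (V : choiceType) (g : rgraph n V) (S : set V) x :
  wf_graph g -> vtx g x -> S x -> wf_graph (induced g S x).
Proof.
move=> wg gx Sx; split=> // y z /= /and3P[yz /asboolP Sy /asboolP Sz].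
by have [] := wg.2 _ _ yz.
Qed.

Lemma wf_ball n (V : choiceType) (g : rgraph n V) k : wf_graph g -> wf_graph (ball k g).
Proof. by move=> wg; apply: wf_induced => //; [exact: wg.1 | exists [::]]. Qed.

Lemma wf_reroot n (V : choiceType) (g : rgraph n V) x :
  wf_graph g -> vtx g x -> wf_graph (reroot g x).
Proof. by case=> gr ga gx; split. Qed.

Lemma wf_vtx_nbrs n (V : choiceType) (g : rgraph n V) x y :
  wf_graph g -> nbrs g x y -> vtx g y.
Proof. by move=> wg /wg.2[]. Qed.

Lemma iso_byW n (V W : choiceType) (f : V -> W) (g : rgraph n V) (h : rgraph n W) :
  iso_by f g h -> iso g h.
Proof. by exists f. Qed.

Lemma iso_by_comp n (U V W : choiceType) (g : rgraph n U) (h : rgraph n V)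
    (k : rgraph n W) f f' :
  iso_by f g h -> iso_by f' h k -> iso_by (f' \o f) g k.
Proof.
move=> fgh [fb' fa' fl' fr']; have [fb fa fl fr] := fgh.
have fS x : vtx g x -> vtx h (f x) by exact: (iso_by_vtx fgh).
split=> [|x y gx gy|x gx|] /=.
- exact: set_bij_comp fb fb'.
- by rewrite fa' ?fa //; exact: fS.
- by rewrite fl' ?fl //; exact: fS.
- by rewrite fr.
Qed.

Lemma ball_step n (V : choiceType) (g : rgraph n V) m k x p :
  (exists q, [/\ path (adj g) (root g) q, last (root g) q = x & (size q <= k)%N]) ->
  path (adj g) x p -> (k + size p <= m)%N -> path (adj (ball m g)) x p.
Proof.
elim: p k x => //= y p IH k x [q [qp ql qs]] /andP[xy yp]; rewrite addnS => km.
have B : exists q, [/\ path (adj g) (root g) q, last (root g) q = y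
    & (size q <= k.+1)%N].
  exists (rcons q y); split; first by rewrite rcons_path qp ql.
    by rewrite last_rcons.
  by rewrite size_rcons.
rewrite (IH k.+1) ?addSn // andbT xy /=; apply/andP; split; apply/asboolP.
  by exists q; split=> //; apply: leq_trans qs (leq_trans (leq_addr _ _) (ltnW km)).
have [q' [q'p q'l q's]] := B; exists q'; split=> //.
by apply: leq_trans q's (leq_trans _ km); rewrite ltnS leq_addr.
Qed.

Lemma sub_path_ball n (V : choiceType) (g : rgraph n V) m x p :
  path (adj (ball m g)) x p -> path (adj g) x p.
Proof. by apply: sub_path => y z /= /and3P[]. Qed.

(** A vertex within [m] of a neighbor of the root is within [m.+1] of the root. Hence what the walk
    sees after a step is a local function of the tree before it. *)
Lemma ball_reroot n (V : choiceType) (g : rgraph n V) m x :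
  wf_graph g -> nbrs g (root g) x ->
  iso_by id (ball m (reroot g x)) (ball m (reroot (ball m.+1 g) x)).
Proof.
move=> wg gx.
have B1 : exists q, [/\ path (adj g) (root g) q, last (root g) q = x
    & (size q <= 1)%N] by exists [:: x] => /=; split=> //; rewrite andbT; exact: gx.
have PP p : (size p <= m)%N -> path (adj g) x p -> path (adj (ball m.+1 g)) x p.
  by move=> ps pp; apply: (ball_step B1 pp).
have E y : (exists p, [/\ path (adj g) x p, last x p = y & (size p <= m)%N]) <->
    (exists p, [/\ path (adj (ball m.+1 g)) x p, last x p = y & (size p <= m)%N]).
  split=> -[p [pp pl ps]]; exists p; split=> //; first exact: PP.
  exact: sub_path_ball pp.
have F y : (exists p, [/\ path (adj g) x p, last x p = y & (size p <= m)%N]) ->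
    exists p, [/\ path (adj g) (root g) p, last (root g) p = y & (size p <= m.+1)%N].
  move=> [p [pp pl ps]]; exists (x :: p); split=> //=.
  by rewrite pp andbT; exact: gx.
split=> //=.
- split=> [y [gy By]|//|y [[gy _] By]] /=.
    by split; [split=> //; exact: F | exact/E].
  by exists y => //; split=> //; exact/E.
- move=> y z [gy By] [gz Bz].
  rewrite (asbool_equiv_eq (E y)) (asbool_equiv_eq (E z)).
  by rewrite (asboolT (F _ By)) (asboolT (F _ Bz)) /= !andbT.
Qed.

(** * Trees under isomorphism, rerooting and restriction to balls *)

Lemma iso_by_tree n (V W : choiceType) (f : V -> W) (g : rgraph n V)
    (h : rgraph n W) :
  iso_by f g h -> wf_graph h -> is_tree g -> is_tree h.
Proof.
move=> fgh wh tg; have wg := is_tree_wf tg.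
have hS := iso_by_vtx fgh; have hJ := iso_by_surj fgh; have hA := iso_by_adj fgh.
split; first exact: wh.1; first exact: wh.2.
- have sub x y : adj h x y -> adj h y x.
    move=> xy; have [/hJ[a ga ax] /hJ[b gb bY]] := wh.2 _ _ xy.
    by move: xy; rewrite -ax -bY !hA // (tree_sym tg).
  by move=> x y; apply/idP/idP; exact: sub.
- move=> x; apply/negP => xx; have [/hJ[a ga ax] _] := wh.2 _ _ xx.
  by move: xx; rewrite -ax hA // (tree_irr tg).
- move=> x y /hJ[a ga <-] /hJ[b gb <-].
  have [p pp pl] := tree_connected tg ga gb.
  exists (map f p); first exact: (iso_by_path fgh).
  by rewrite last_map pl.
- case=> // x p xp up.
  have [|hx _] := @wh.2 x (head x (rcons p x)).
    by move: xp; case: (p) => [|y q] /= /andP[].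
  have [a ga ax] := hJ _ hx; rewrite -ax in xp up *.
  have [q qp qe] := iso_by_lift fgh wh ga xp.
  move: qp qe; case: (lastP q) => [|q' b] qp; first by case: (p).
  rewrite map_rcons => /rcons_inj[qe fb].
  (* The lifted path ends over the vertex where it started, hence at that vertex by injectivity: a
     cycle lifts to a cycle. *)
  have ba : b = a.
    apply: (iso_by_inj fgh) fb => //.
    by apply: (wf_path wg ga qp); rewrite inE mem_rcons inE eqxx orbT.
  rewrite {}ba in qp.
  have : (size (a :: q') <= 2)%N.
    apply: (tree_acyclic tg) => //.
    by apply: (@map_uniq _ _ f); rewrite /= qe.
  by rewrite /= -qe size_map.
- move=> x; have [hx|nx] := pselect (vtx h x); last first.
    rewrite (_ : nbrs h x = set0) //; apply/seteqP; split=> // y xy.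
    by case: nx; have [] := wh.2 _ _ xy.
  have [a ga <-] := hJ _ hx.
  apply: sub_finite_set (finite_image f (tree_locally_finite tg a)) => y.
  by have [_ _] := iso_by_nbrs fgh wg wh ga; apply.
Qed.

Lemma tree_reroot n (V : choiceType) (g : rgraph n V) x :
  is_tree g -> vtx g x -> is_tree (reroot g x).
Proof. by case=> *; split. Qed.

Lemma path_rev_sym (V : eqType) (e : rel V) x p : symmetric e ->
  path e (last x p) (rev (belast x p)) = path e x p.
Proof. by move=> se; rewrite rev_path; apply: eq_path => y z; exact: se. Qed.

Lemma last_rev_belast (V : eqType) (x : V) p : last (last x p) (rev (belast x p)) = x.
Proof. by case: p => //= y p; rewrite rev_cons last_rcons. Qed.

Lemma tree_ball n (V : choiceType) (g : rgraph n V) k :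
  is_tree g -> is_tree (ball k g).
Proof.
move=> tg; have wg := is_tree_wf tg; have wb := wf_ball k wg.
have sb : symmetric (adj (ball k g)).
  by move=> x y /=; rewrite (tree_sym tg) [X in _ && X]andbC.
split; [exact: wb.1|exact: wb.2|by []|..].
- by move=> x /=; rewrite (tree_irr tg).
- have R x : vtx (ball k g) x ->
      exists2 p, path (adj (ball k g)) (root g) p & last (root g) p = x.
    move=> [gx [p [pp pl ps]]]; exists p => //.
    by apply: (@ball_step _ _ _ _ 0%N) => //; exists [::].
  move=> x y /R[p pp <-] /R[q qp <-].
  exists (rev (belast (root g) p) ++ q).
    by rewrite cat_path last_rev_belast qp andbT path_rev_sym.
  by rewrite last_cat last_rev_belast.
- move=> p pc; apply: (tree_acyclic tg).
  by apply: sub_cycle pc => x y /= /and3P[].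
- move=> x; apply: sub_finite_set (tree_locally_finite tg x) => y /=.
  by rewrite /nbrs /= => /and3P[].
Qed.

Lemma finite_ball n (V : choiceType) (g : rgraph n V) k :
  is_tree g -> finite_set (vtx (ball k g)).
Proof.
move=> tg; apply: sub_finite_set (@subIsetr _ _ _) _.
elim: k => [|k IH].
  apply: sub_finite_set (finite_set1 (root g)) => y [p [_ <-]].
  by rewrite leqn0 size_eq0 => /eqP ->.
apply: (@sub_finite_set _ _ ([set root g] `|` \bigcup_(x in [set y | exists p,
   [/\ path (adj g) (root g) p, last (root g) p = y & (size p <= k)%N]])
   nbrs g x)).
  move=> y [p]; case: (lastP p) => [|q z] [pp pl ps]; first by left.
  right; move: pp pl ps; rewrite rcons_path last_rcons size_rcons ltnS.
  by move=> /andP[qp qz] <- qs; exists (last (root g) q) => //; exists q.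
rewrite finite_setU; split; first exact: finite_set1.
by apply: bigcup_finite => // x _; exact: tree_locally_finite.
Qed.

(** Moves a graph on a countable type to [nat], where the representatives of classes live; numbers
    that code no element of [V] get no edges. *)
Definition pickled n (V : countType) (g : rgraph n V) : rgraph n nat :=
  RGraph (choice.pickle @` vtx g)
    (fun a b => if (@pickle_inv V a, @pickle_inv V b) is (Some x, Some y)
      then adj g x y else false)
    (fun a => if @pickle_inv V a is Some x then lab g x else ord0)
    (choice.pickle (root g)).

Lemma pickled_iso_by n (V : countType) (g : rgraph n V) :
  iso_by choice.pickle g (pickled g).
Proof.
split=> [|x y _ _|x _|] //=; rewrite ?pickleK_inv //.
by apply: inj_bij => x y _ _; apply: pcan_inj; exact: pickleK_inv.
Qed.

Lemma pickled_tree n (V : countType) (g : rgraph n V) :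
  is_tree g -> is_tree (pickled g).
Proof.
move=> tg; have wg := is_tree_wf tg.
apply: (iso_by_tree (pickled_iso_by g)) => //; split=> /=.
  by exists (root g) => //; exact: wg.1.
move=> a b; case Ea: (@pickle_inv V a) => [x|//].
case Eb: (@pickle_inv V b) => [y|//] /wg.2[gx gy].
have := @pickle_invK V a; rewrite /ocancel Ea /= => <-.
by have := @pickle_invK V b; rewrite /ocancel Eb /= => <-; split; [exists x|exists y].
Qed.

(** * Isomorphism classes of trees *)

Lemma class_of_pi n (t : rtree n) : iso (rep (\pi_(Tn n) t)) t.
Proof. by rewrite /rep; case: piP => s /eqmodP /asboolP /iso_sym; apply; case: t => ? []. Qed.

Lemma class_ofP n (V : countType) (g : rgraph n V) :
  is_tree g -> exists T : Tn n, class_of T g.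
Proof.
move=> tg; exists (\pi_(Tn n) (exist _ _ (pickled_tree tg))).
apply: iso_trans (class_of_pi _) _; apply: iso_sym; first exact: (tree_root tg).
exact/iso_byW/pickled_iso_by.
Qed.

Lemma class_of_uniq n (V : choiceType) (g : rgraph n V) (T T' : Tn n) :
  class_of T g -> class_of T' g -> T = T'.
Proof.
move=> Tg T'g; rewrite -[T]reprK -[T']reprK; apply/eqmodP/asboolP.
apply: iso_trans Tg _; apply: iso_sym T'g.
exact: (rep_wf T').1.
Qed.

Lemma class_of_iso n (V W : choiceType) (g : rgraph n V) (h : rgraph n W)
    (T : Tn n) : class_of T g -> iso g h -> class_of T h.
Proof. exact: iso_trans. Qed.

Definition tree_class n (V : choiceType) (g : rgraph n V) : Tspace n :=
  xget point [set T : Tspace n | class_of T g].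

Lemma tree_classP n (V : choiceType) (g : rgraph n V) (T : Tn n) :
  class_of T g -> class_of (tree_class g) g.
Proof. by move=> Tg; rewrite /tree_class; case: xgetP => // /(_ T). Qed.

Lemma tree_class_eq n (V : choiceType) (g : rgraph n V) (T : Tn n) :
  class_of T g -> tree_class g = T.
Proof. by move=> Tg; exact: class_of_uniq (tree_classP Tg) Tg. Qed.

Lemma eq_tree_class n (V W : choiceType) (g : rgraph n V) (h : rgraph n W) (T : Tn n) :
  class_of T g -> iso g h -> tree_class g = tree_class h.
Proof. by move=> Tg gh; rewrite (tree_class_eq Tg) (tree_class_eq (class_of_iso Tg gh)). Qed.

Lemma tree_class_tree n (V : countType) (g : rgraph n V) :
  is_tree g -> class_of (tree_class g) g.
Proof. by case/class_ofP => T; exact: tree_classP. Qed.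

(** * Measurability on the space of trees *)

Section measurable_props.
Context d (Om : measurableType d).
Implicit Types P Q : Om -> Prop.

Lemma measurable_cstP (P : Prop) : measurable [set w : Om | P].
Proof.
have [p|np] := pselect P.
  by rewrite (_ : mkset _ = setT) //; apply/seteqP; split.
by rewrite (_ : mkset _ = set0) //; apply/seteqP; split.
Qed.

Lemma measurable_and P Q : measurable [set w | P w] ->
  measurable [set w | Q w] -> measurable [set w | P w /\ Q w].
Proof. exact: measurableI. Qed.

Lemma measurable_not P : measurable [set w | P w] -> measurable [set w | ~ P w].
Proof. exact: measurableC. Qed.

Lemma measurable_imply P Q : measurable [set w | P w] ->
  measurable [set w | Q w] -> measurable [set w | P w -> Q w].
Proof.
move=> mP mQ; rewrite (_ : mkset _ = ~` [set w | P w] `|` [set w | Q w]).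
  by apply: measurableU => //; exact: measurableC.
apply/seteqP; split=> w /=; last by case=> // nP /nP.
by move=> PQ; have [/PQ|] := pselect (P w); [right|left].
Qed.

Lemma measurable_iff P Q : measurable [set w | P w] ->
  measurable [set w | Q w] -> measurable [set w | P w <-> Q w].
Proof. by move=> mP mQ; apply: measurable_and; exact: measurable_imply. Qed.

Lemma measurable_ex (I : countType) (P : I -> Om -> Prop) :
  (forall i, measurable [set w | P i w]) -> measurable [set w | exists i, P i w].
Proof.
move=> mP; rewrite (_ : mkset _ = \bigcup_i [set w | P i w]).
  exact: countable_bigcupT_measurable.
by apply/seteqP; split=> [w [i Pi]|w [i _ Pi]] /=; exists i.
Qed.

Lemma measurable_all (I : countType) (P : I -> Om -> Prop) :
  (forall i, measurable [set w | P i w]) -> measurable [set w | forall i, P i w].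
Proof.
move=> mP.
rewrite (_ : mkset _ = ~` [set w | exists i, ~ P i w]).
  by apply/measurableC/measurable_ex => i; exact: measurable_not.
by apply/seteqP; split=> w /=; rewrite -forallNE => H i; [move=> /(_ (H i))|exact: contrapT (H i)].
Qed.

End measurable_props.

Section vertex_sets.
Variables (n : nat) (V : countType) (e : rel V) (l : V -> 'I_n.+1) (r : V).

(** The random trees share the ambient relation [e], the labels and the root; only the vertex set
    [S] is random. Measurability of the class thus reduces to that of the events [S w v]. *)
Definition vgraph (S : set V) : rgraph n V :=
  RGraph S (fun u v => [&& e u v, `[< S u >] & `[< S v >]]) l r.

Lemma vgraph_wf (S : set V) : S r -> wf_graph (vgraph S).
Proof. by move=> Sr; split=> //= x y /and3P[_ /asboolP ? /asboolP]. Qed.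

(** A ball of [vgraph S] in which [S] enters only through membership of single vertices, with the
    path ranging over a countable type. *)
Definition vball k (S : set V) : set V :=
  [set v | S v /\ exists p, [/\ path e r p, last r p = v, (size p <= k)%N &
     forall u, u \in p -> S u]].

Lemma iso_by_vball k (S : set V) : S r ->
  iso_by id (ball k (vgraph S)) (vgraph (vball k S)).
Proof.
move=> Sr; have P p x : S x -> path (adj (vgraph S)) x p <->
    path e x p /\ forall u, u \in p -> S u.
  elim: p x => [|y p IH] x Sx //=.
  rewrite (asboolT Sx) /=; split.
    move=> /andP[/andP[-> /asboolP Sy]] /IH[] // -> Sp; split=> // u.
    by rewrite inE => /orP[/eqP ->|/Sp].
  move=> [/andP[-> yp] Sp].
  have Sy : S y by apply: Sp; rewrite inE eqxx.
  by rewrite asboolT //=; apply/IH => //; split=> // u up; apply: Sp; rewrite inE up orbT.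
have E v : S v -> (exists p, [/\ path (adj (vgraph S)) r p, last r p = v & (size p <= k)%N])
    <-> vball k S v.
  move=> Sv; split.
    by move=> [p [/P[] // pp Sp pl ps]]; split=> //; exists p; split.
  by move=> [_ [p [pp pl ps Sp]]]; exists p; split=> //; apply/P.
split=> //=.
- split=> [v [Sv]|//|v Bv] /=; first by move/E; exact.
  by case: (Bv) => Sv _; exists v => //; split=> //; apply/E.
- move=> u v [Su Bu] [Sv Bv].
  rewrite (asboolT Su) (asboolT Sv) (asboolT Bu) (asboolT Bv) /=.
  by rewrite (asboolT ((E _ Su).1 Bu)) (asboolT ((E _ Sv).1 Bv)) /= !andbT.
Qed.

Context d (Om : measurableType d).

(* A ball has finitely many vertices, and there are countably many finite sets
   of vertices. *)
Lemma measurable_vgraph (S : Om -> set V) (X : Om -> Tspace n) :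
  (forall v, measurable [set w | S w v]) ->
  (forall w, class_of (X w) (vgraph (S w))) ->
  measurable_fun setT X.
Proof.
move=> mS cX.
have Sr w : S w r.
  by have [f fX] := cX w; have := iso_by_vtx fX (rep_wf _).1; rewrite (iso_by_root fX).
have wS w := vgraph_wf (Sr w).
apply: (@measurability _ _ _ _ setT X (@ball_events n)) => // _ [_ [k [t ->]] <-].
rewrite setTI.
have -> : X @^-1` [set T | iso (ball k (rep T)) t] =
    [set w | exists F : {fset V}, (forall v, vball k (S w) v <-> v \in F) /\
       iso (vgraph [set` F]) t].
  apply/seteqP; split=> w /=; have [f fX] := cX w.
    have fB := iso_by_comp (iso_by_ball fX (rep_wf _) (wS w) k) (iso_by_vball k (Sr w)).
    move=> it; exists (fset_set (vball k (S w))).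
    have fin : finite_set (vball k (S w)).
      have -> : vball k (S w) = (id \o f) @` vtx (ball k (rep (X w))).
        case: fB => -[fS _ fJ] _ _ _; apply/seteqP; split=> v; first by move/fJ.
        by move=> [u /fS + <-].
      exact/finite_image/finite_ball/rep_tree.
    split=> [v|]; first by rewrite in_fset_set //; split; rewrite inE.
    rewrite fset_setK //; apply: iso_trans it.
    apply: iso_sym (iso_byW fB); exact: (wf_ball k (rep_wf _)).1.
  move=> [F [FE it]].
  have fB := iso_by_comp (iso_by_ball fX (rep_wf _) (wS w) k) (iso_by_vball k (Sr w)).
  apply: iso_trans (iso_byW fB) _.
  by rewrite (_ : vball k (S w) = [set` F]) //; apply/seteqP; split=> v /FE.
apply: measurable_ex => F; apply: measurable_and; last exact: measurable_cstP.
apply: measurable_all => v; apply: measurable_iff; last exact: measurable_cstP.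
apply: measurable_and; first exact: mS.
apply: measurable_ex => p.
rewrite (_ : mkset _ = [set w | [/\ path e r p, last r p = v & (size p <= k)%N] /\
   forall u, u \in p -> S w u]); last first.
  by apply/seteqP; split=> w /= []; [split|case].
apply: measurable_and; first exact: measurable_cstP.
apply: measurable_all => u; apply: measurable_imply; last exact: mS.
exact: measurable_cstP.
Qed.

End vertex_sets.

(* Up to isomorphism there are countably many finite graphs: [c] lists the
   vertices, the edges, the labels and the root. *)
Definition decode n (c : {fset nat} * seq (nat * nat) * seq 'I_n.+1 * nat) :
    rgraph n nat :=
  let: (F, E, L, r) := c in
  RGraph [set` F] (fun u v => (u, v) \in E) (nth ord0 L) r.

Lemma decodeP n (g : rgraph n nat) : finite_set (vtx g) ->
  exists c, iso_by id g (decode c).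
Proof.
move=> gf; pose F := fset_set (vtx g).
have FE x : vtx g x <-> x \in F by rewrite in_fset_set // inE.
pose N := (\max_(x <- F) x).+1.
exists (F, [seq p <- [seq (x, y) | x <- F, y <- F] | adj g p.1 p.2],
  map (lab g) (iota 0 N), root g); split=> //=.
- split=> [x /FE //|//|x /= /FE gx]; by exists x.
- move=> x y /FE gx /FE gy; rewrite mem_filter /=.
  by rewrite (_ : (x, y) \in _ = true) ?andbT //; apply/allpairsP; exists (x, y).
- move=> x /FE gx; have xN : (x < N)%N by rewrite ltnS; apply: leq_bigmax_seq.
  have -> : nth ord0 (map (lab g) (iota 0 N)) x = lab g x.
    by rewrite (nth_map 0%N) ?size_iota // nth_iota.
  by [].
Qed.

(** Balls are finite, so there are countably many of them up to isomorphism, and [P] is a countable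
    union of ball events of radius [k]. *)
Lemma measurable_local n (P : set (Tspace n)) k :
  (forall T T' : Tspace n,
     iso (ball k (rep T)) (ball k (rep T')) -> P T -> P T') ->
  measurable P.
Proof.
move=> PP.
have -> : P = [set T | exists c,
    iso (ball k (rep T)) (decode c) /\
    exists T' : Tspace n, iso (ball k (rep T')) (decode c) /\ P T'].
  have bs (T : Tspace n) : vtx (ball k (rep T)) (root (ball k (rep T))).
    exact: (wf_ball k (rep_wf T)).1.
  apply/seteqP; split=> [T PT|T [c [Tc [T' [T'c PT']]]]] /=; last first.
    by apply: (PP T') => //; apply: iso_trans T'c _; exact: iso_sym.
  have [c cT] := decodeP (finite_ball k (rep_tree T)).
  by exists c; split; [exists id | exists T; split=> //; exists id].
apply: measurable_ex => c.
have [[T' [T'c PT']]|nT'] := pselect (exists T' : Tspace n,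
    iso (ball k (rep T')) (decode c) /\ P T'); last first.
  by rewrite (_ : mkset _ = set0) //; apply/seteqP; split=> // T [].
apply: sub_sigma_algebra; exists k, (exist _ _ (tree_ball k (rep_tree T'))).
apply/seteqP; split=> T /= => [[Tc _]|TT'].
  apply: iso_trans Tc _; apply: iso_sym => //; exact: (wf_ball k (rep_wf T')).1.
split; last by exists T'.
exact: iso_trans TT' T'c.
Qed.

(** * Galton-Watson trees *)

Notation field n := (word n * ('I_n.+1 * 'I_n.+1) -> Sn n) (only parsing).

Lemma is_childP n (u v : word n) :
  reflect (exists x, v = rcons u x) (is_child u v).
Proof.
apply: (iffP andP) => [[/eqP sv /prefixP[s' vs]]|[x ->]].
  move: sv; rewrite vs size_cat; case: s' vs => [|x [|y s']] vs /= H.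
  - by move: H; rewrite addn0 => /n_Sn.
  - by exists x; rewrite cats1.
  - by move/eqP: H; rewrite -[X in _ == X]addn1 eqn_add2l.
by rewrite size_rcons -cats1 prefix_prefix.
Qed.

Lemma word_type_rcons n (s : 'I_n.+1 * 'I_n.+1) v x :
  word_type s (rcons v x) = ((word_type s v).2, x.1).
Proof. by elim: v s => //= y v IH s; rewrite IH. Qed.

Lemma gw_vertex_rcons n (xi : field n) s v x :
  gw_vertex xi s (rcons v x) =
  gw_vertex xi s v && (x.2 < xi (v, word_type s v) x.1)%N.
Proof. by elim: v xi s => [|y v IH] xi s /=; rewrite ?andbT // IH andbA. Qed.

Definition gw_adj n : rel (word n) := fun u v => is_child u v || is_child v u.

Lemma gw_graph_adj n (xi : field n) s u v :
  adj (gw_graph xi s) u v = [&& gw_vertex xi s u, gw_vertex xi s v & gw_adj u v].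
Proof. by []. Qed.

Lemma gw_adj_nil n (v : word n) : gw_adj [::] v = (size v == 1)%N.
Proof. by rewrite /gw_adj /is_child /= prefix0s andbT orbF. Qed.

Lemma max_size (T : eqType) (p : seq (seq T)) : p != [::] ->
  exists2 x, x \in p & forall y, y \in p -> (size y <= size x)%N.
Proof.
elim: p => // x [|x' p] IH _; first by exists x => [|y]; rewrite !inE // => /eqP ->.
have [//|z zp zmax] := IH.
have [xz|/ltnW zx] := leqP (size x) (size z).
  exists z => [|y]; first by rewrite inE zp orbT.
  by rewrite inE => /orP[/eqP -> //|/zmax].
exists x => [|y]; first by rewrite inE eqxx.
by rewrite inE => /orP[/eqP -> //|/zmax yz]; exact: leq_trans zx.
Qed.

(* In a cycle, a word of maximal length would have two distinct parents. *)
Lemma gw_graph_tree n (xi : field n) s : is_tree (gw_graph xi s).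
Proof.
have symg : symmetric (adj (gw_graph xi s)).
  by move=> u v; rewrite !gw_graph_adj andbCA /gw_adj orbC.
have R v : vtx (gw_graph xi s) v ->
    exists2 p, path (adj (gw_graph xi s)) [::] p & last [::] p = v.
  elim/last_ind: v => [|v x IH]; first by exists [::].
  move=> vx; have gx : gw_vertex xi s (rcons v x) by exact: vx.
  have /andP[gv _] := etrans (esym (gw_vertex_rcons _ _ _ _)) gx.
  have [p pp pl] := IH gv; exists (rcons p (rcons v x)); last by rewrite last_rcons.
  rewrite rcons_path pp pl gw_graph_adj vx gv /gw_adj.
  by apply/orP; left; apply/is_childP; exists x.
split=> //.
- by move=> x y /and3P[].
- move=> x; rewrite gw_graph_adj /gw_adj /is_child orbb.
  by rewrite (ltn_eqF (ltnSn _)) !andbF.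
- move=> x y /R[p pp <-] /R[q qp <-].
  exists (rev (belast [::] p) ++ q); last by rewrite last_cat last_rev_belast.
  by rewrite cat_path last_rev_belast qp andbT path_rev_sym.
- move=> p pc pu; rewrite leqNgt; apply/negP => p3.
  have pn : p != [::] by case: p p3 {pc pu}.
  have [x xp xmax] := max_size pn.
  have [i q pq] := rot_to xp.
  have xmax' y : y \in x :: q -> (size y <= size x)%N.
    by rewrite -pq mem_rot; exact: xmax.
  move: pc pu p3; rewrite -(rot_cycle i) -(rot_uniq i) -(size_rot i) {}pq.
  have par y : y \in x :: q -> gw_adj x y -> y = take (size x).-1 x.
    move=> /xmax' yx /orP[/is_childP[a ya]|/is_childP[a ->]].
      by move: yx; rewrite ya size_rcons ltnn.
    by rewrite size_rcons /= -cats1 take_size_cat.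
  case: q xmax' par => //= y q; case: (lastP q) => //= {}q z _ par.
  rewrite !rcons_path last_rcons => /and3P[/and3P[_ _ xy] _ /and3P[_ _ zx]].
  move=> /and3P[_ + _] _; rewrite mem_rcons inE => /negP; apply.
  apply/orP; left; apply/eqP; apply: (@etrans _ _ (take (size x).-1 x)).
    by apply: par => //; rewrite !inE eqxx orbT.
  apply/esym/par; first by rewrite !inE mem_rcons inE eqxx !orbT.
  by rewrite /gw_adj orbC.
- move=> v.
  apply: (@sub_finite_set _ _ ([set take (size v).-1 v] `|`
     (fun p : {k : 'I_n.+1 & 'I_(xi (v, word_type s v) k)} =>
        rcons v (tag p, val (tagged p))) @` setT)).
    move=> u /and3P[_ gu /orP[/is_childP[[k m] uv]|/is_childP[x ->]]]; last first.
      by left; rewrite size_rcons /= -cats1 take_size_cat.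
    right; move: gu; rewrite uv gw_vertex_rcons => /andP[_ /= mv].
    by exists (Tagged (fun k => 'I_(xi (v, word_type s v) k)) (Ordinal mv)).
  rewrite finite_setU; split; first exact: finite_set1.
  by apply: finite_image; exact: finite_finset.
Qed.

Lemma gw_graph_vgraph n (xi : field n) s :
  iso_by id (gw_graph xi s)
    (vgraph (@gw_adj n) (fun v => (word_type s v).2) [::] [set v | gw_vertex xi s v]).
Proof.
split=> //; first by split=> // x gx; exists x.
by move=> u v /= gu gv; rewrite !asboolT // gu gv /= andbT.
Qed.

Lemma gw_nbrs_nil n (xi : field n) s :
  nbrs (gw_graph xi s) [::] = [set [:: x] | x in [set x | (x.2 < xi ([::], s) x.1)%N]].
Proof.
apply/seteqP; split=> [v /and3P[_ gv]|_ [x /= xs <-]].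
  rewrite -/(gw_adj _ _) gw_adj_nil; case: v gv => // x [|//] /= /andP[xs _] _; by exists x.
by apply/and3P; split=> //=; rewrite ?xs // -/(gw_adj _ _) gw_adj_nil.
Qed.

Lemma gw_nb_nil n (xi : field n) s j : nb (gw_graph xi s) [::] j = xi ([::], s) j.
Proof.
rewrite /nb gw_nbrs_nil.
set c := xi _; rewrite (_ : _ `&` _ = (fun m => [:: (j, m)]) @` `I_(c j)).
  rewrite fset_set_image ?fset_set_II //.
  rewrite card_imfset /=; last by move=> a b [].
  by rewrite card_imfset /= ?size_enum_ord //; exact: val_inj.
apply/seteqP; split=> [v [[x /= xc <-] /= xj]|v [m /= mc <-]] /=.
  by exists x.2; rewrite -xj //; case: (x).
by split=> //; exists (j, m).
Qed.

Lemma measurable_gw_vertex n d (Om : measurableType d)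
    (xi : word n * ('I_n.+1 * 'I_n.+1) -> Om -> Sn n) s v :
  (forall a c, measurable [set w | xi a w = c]) ->
  measurable [set w | gw_vertex (xi^~ w) s v].
Proof.
move=> mxi; elim/last_ind: v => [|v x IH]; first exact: (measurable_cstP _ (is_true true)).
under eq_set do rewrite gw_vertex_rcons.
rewrite (_ : mkset _ = [set w | gw_vertex (xi^~ w) s v /\
   exists c, xi (v, word_type s v) w = c /\ (x.2 < c x.1)%N]).
  apply: measurable_and => //; apply: measurable_ex => c.
  by apply: measurable_and => //; exact: measurable_cstP.
apply/seteqP; split=> w /=; first by move=> /andP[-> ?]; split=> //; eexists; split.
by move=> [-> [c [-> ->]]].
Qed.

Lemma measurable_gw_class n d (Om : measurableType d)
    (xi : word n * ('I_n.+1 * 'I_n.+1) -> Om -> Sn n) s :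
  (forall a c, measurable [set w | xi a w = c]) ->
  measurable_fun setT (fun w => tree_class (gw_graph (xi^~ w) s)).
Proof.
move=> mxi.
apply: (@measurable_vgraph _ _ (@gw_adj n) (fun v => (word_type s v).2) [::]
  _ _ (fun w => [set v | gw_vertex (xi^~ w) s v])) => [v|w].
  exact: measurable_gw_vertex.
by apply: class_of_iso (tree_class_tree (gw_graph_tree _ _)) _; exact/iso_byW/gw_graph_vgraph.
Qed.

(** * One step of simple random walk *)

Lemma card_set_bij (T U : choiceType) (A : set T) (B : set U) (f : T -> U) :
  finite_set A -> set_bij A B f -> #|` fset_set B| = #|` fset_set A|.
Proof.
move=> fA [fS fI fJ].
rewrite (_ : B = f @` A); last first.
  by apply/seteqP; split=> [y /fJ[x Ax <-]|_ [x Ax <-]]; [exists x|exact: fS].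
by rewrite fset_set_image // card_in_imfset //= => y z; rewrite !in_fset_set // => Ay Az; apply: fI.
Qed.

Definition rnbrs n (T : Tspace n) : set nat := nbrs (rep T) (root (rep T)).

Lemma rnbrs_finite n (T : Tspace n) : finite_set (rnbrs T).
Proof. exact: tree_locally_finite (rep_tree T) _. Qed.

Definition moved n (T : Tspace n) (x : nat) : Tspace n := tree_class (reroot (rep T) x).

Lemma rnbrs_vtx n (T : Tspace n) x : rnbrs T x -> vtx (rep T) x.
Proof. exact: wf_vtx_nbrs (rep_wf T). Qed.

Lemma movedP n (T : Tspace n) x : rnbrs T x -> class_of (moved T x) (reroot (rep T) x).
Proof. by move/rnbrs_vtx/(tree_reroot (rep_tree T))/tree_class_tree. Qed.

Lemma moved_in n (T : Tspace n) x (B : set (Tspace n)) : rnbrs T x ->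
  (exists2 T', B T' & class_of T' (reroot (rep T) x)) <-> B (moved T x).
Proof.
move=> Tx; split=> [[T' BT' cT']|BT]; last by exists (moved T x) => //; exact: movedP.
by rewrite /moved (tree_class_eq cT').
Qed.

Definition root_deg n (T : Tspace n) : nat := #|` fset_set (rnbrs T)|.

(** The numerator of [step], kept as a natural number: it takes countably many values and is
    additive in [B], so measurability in [T] can be checked on its level sets. *)
Definition landings n (T : Tspace n) (B : set (Tspace n)) : nat :=
  (\sum_(x <- fset_set (rnbrs T)) `[< B (moved T x) >])%N.

Lemma card_fset_sum (I : choiceType) (F F' : {fset I}) (a : pred I) :
  (forall x, (x \in F') = (x \in F) && a x) ->
  #|` F'| = (\sum_(x <- F) a x)%N.
Proof.
move=> FE; have -> : F' = [fset x in F | a x]%fset by apply/fsetP => x; rewrite !inE.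
rewrite card_fset_sum1 -big_fset_condE big_mkcond /=.
by apply: eq_bigr => x _; case: (a x).
Qed.

Lemma stepE (R : realType) n (T : Tspace n) (B : set (Tspace n)) :
  step R T B = (landings T B)%:R / (root_deg T)%:R.
Proof.
rewrite /step /landings /root_deg -/(rnbrs T); congr (_%:R / _).
apply: card_fset_sum => x.
rewrite in_fset_set; last exact: sub_finite_set (@subIsetl _ _ _) (rnbrs_finite T).
rewrite in_fset_set; last exact: rnbrs_finite.
apply/idP/andP => [|[]]; rewrite !inE.
  by move=> [Tx /(moved_in _ Tx) BT]; split=> //; exact/asboolP.
by move=> Tx BT; split=> //; exact/moved_in.
Qed.

Lemma landings_bij n (T T' : Tspace n) (B : set (Tspace n)) f :
  set_bij (rnbrs T) (rnbrs T') f ->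
  (forall x, rnbrs T x -> B (moved T' (f x)) <-> B (moved T x)) ->
  landings T' B = landings T B.
Proof.
move=> [fS fI fJ] fB; rewrite /landings.
rewrite (_ : rnbrs T' = f @` rnbrs T); last first.
  by apply/seteqP; split=> [y /fJ[x Ax <-]|_ [x Ax <-]]; [exists x|exact: fS].
rewrite fset_set_image; last exact: rnbrs_finite.
have TE x : (x \in fset_set (rnbrs T)) = (x \in rnbrs T).
  by rewrite in_fset_set //; exact: rnbrs_finite.
rewrite big_imfset /=; last by move=> x y; rewrite !TE => Tx Ty; apply: fI.
rewrite !big_seq; apply: eq_bigr => x; rewrite TE inE => Tx.
by rewrite (asbool_equiv_eq (fB x Tx)).
Qed.

Lemma nbrs_ball n (V : choiceType) (g : rgraph n V) k : wf_graph g ->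
  nbrs (ball k.+1 g) (root g) = nbrs g (root g).
Proof.
move=> wg; apply/seteqP; split=> x; first by move=> /and3P[].
move=> gx; have gx' : adj g (root g) x := gx.
apply/and3P; split=> //; apply/asboolP; first by exists [::].
by exists [:: x] => /=; rewrite gx'.
Qed.

Lemma iso_ball_rnbrs n (T T' : Tspace n) f k :
  iso_by f (ball k.+1 (rep T)) (ball k.+1 (rep T')) ->
  set_bij (rnbrs T) (rnbrs T') f.
Proof.
move=> fT; rewrite /rnbrs -(nbrs_ball k (rep_wf T)) -(nbrs_ball k (rep_wf T')).
have := iso_by_nbrs fT (wf_ball _ (rep_wf _)) (wf_ball _ (rep_wf _)).
by rewrite -(iso_by_root fT); apply; exact: (wf_ball k.+1 (rep_wf T)).1.
Qed.

Lemma measurable_root_deg n q : measurable [set T : Tspace n | root_deg T = q].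
Proof.
apply: (@measurable_local _ _ 1) => T T' [f fT] <-.
exact: card_set_bij (rnbrs_finite T) (iso_ball_rnbrs fT).
Qed.

(** One unit of radius pays for the step: [ball_reroot] cuts the [k]-ball around the neighbor out of
    the [k.+1]-ball around the root, on both sides. *)
Lemma iso_ball_moved n (T T' : Tspace n) f k x :
  iso_by f (ball k.+1 (rep T)) (ball k.+1 (rep T')) -> rnbrs T x ->
  iso (ball k (rep (moved T x))) (ball k (rep (moved T' (f x)))).
Proof.
move=> fT Tx; have [fS _ _] := iso_ball_rnbrs fT; have T'x := fS _ Tx.
have BM (U : Tspace n) y : rnbrs U y ->
    iso (ball k (rep (moved U y))) (ball k (reroot (ball k.+1 (rep U)) y)).
  move=> Uy; have [h hU] := movedP Uy.
  apply: iso_trans (iso_byW (ball_reroot _ (rep_wf U) Uy)).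
  apply/iso_byW/iso_by_ball; [exact: hU|exact: rep_wf|].
  by apply: wf_reroot (rep_wf U) _; exact: rnbrs_vtx.
have wR (U : Tspace n) y : rnbrs U y -> wf_graph (reroot (ball k.+1 (rep U)) y).
  move=> Uy; apply: wf_reroot; first exact/wf_ball/rep_wf.
  apply: (@wf_vtx_nbrs _ _ _ (root (rep U))); first exact/wf_ball/rep_wf.
  by rewrite nbrs_ball //; exact: rep_wf.
apply: iso_trans (BM _ _ Tx) _.
apply: (@iso_trans _ _ _ _ _ (ball k (reroot (ball k.+1 (rep T')) (f x)))).
  by apply/iso_byW/iso_by_ball; [exact: iso_by_reroot fT x|exact: wR|exact: wR].
apply: iso_sym; last exact: BM.
exact: (wf_ball k (rep_wf _)).1.
Qed.

Lemma measurable_landings_ball n (B : set (Tspace n)) q :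
  @ball_events n B -> measurable [set T : Tspace n | landings T B = q].
Proof.
move=> [k [t ->]]; apply: (@measurable_local _ _ k.+1) => T T' [f fT] /= <-.
apply: landings_bij (iso_ball_rnbrs fT) _ => x Tx /=.
have M := iso_ball_moved fT Tx; split; first exact: iso_trans.
by apply: iso_trans; apply: iso_sym M; exact: (wf_ball k (rep_wf _)).1.
Qed.

(* Two ball events are disjoint, or that of the larger radius is contained in the
   other. *)
Lemma Tspace_induction n (P : set (set (Tspace n))) :
  P setT -> @ball_events n `<=` P ->
  (forall A, measurable A -> P A -> P (~` A)) ->
  (forall F : (set (Tspace n))^nat, (forall k, measurable (F k)) ->
     trivIset setT F -> (forall k, P (F k)) -> P (\bigcup_k F k)) ->
  forall A, measurable A -> P A.
Proof.
move=> PT PG PC PU A mA; pose G := @ball_events n `|` [set set0].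
have mG : @measurable _ (Tspace n) = <<s G >>.
  apply/seteqP; split; first by apply: sub_sigma_algebra2; left.
  apply: smallest_sub; first exact: smallest_sigma_algebra.
  by move=> B [GB|->]; [exact: sub_sigma_algebra|exact: sigma_algebra0].
apply: (dynkin_induction mG) => //; last by rewrite -mG.
- move=> B C [[h [t ->]]|->]; last by rewrite set0I; right.
  move=> [[k [u ->]]|->]; last by rewrite setI0; right.
  wlog hk : h k t u / (h <= k)%N.
    by move=> H; have [hk|/ltnW kh] := leqP h k; [|rewrite setIC]; exact: H.
  set D := _ `&` _; have [->|/set0P[T0 [/= T0t T0u]]] := eqVneq D set0; first by right.
  left; exists k, u; apply/seteqP; split=> T; first by case.
  move=> /= Tu; split=> //=; apply: iso_trans T0t.
  have Bv (U : Tspace n) j : vtx (ball j (rep U)) (root (ball j (rep U))).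
    exact: (wf_ball j (rep_wf U)).1.
  have [f fT] := iso_trans Tu (iso_sym (Bv _ _) T0u).
  have BB (U : Tspace n) : iso_by id (ball h (rep U)) (ball h (ball k (rep U))).
    have E x p : path (adj (rep U)) (root (rep U)) p -> last (root (rep U)) p = x ->
        (size p <= h)%N -> path (adj (ball k (rep U))) (root (rep U)) p.
      move=> pp _ ps; apply: (@ball_step _ _ _ _ 0%N) => //; first by exists [::].
      exact: leq_trans hk.
    have R1 x : (exists p, [/\ path (adj (rep U)) (root (rep U)) p,
        last (root (rep U)) p = x & (size p <= h)%N]) <->
        (exists p, [/\ path (adj (ball k (rep U))) (root (rep U)) p,
        last (root (rep U)) p = x & (size p <= h)%N]).
      split=> -[p [pp pl ps]]; exists p; split=> //; first exact: E ps.
      exact: sub_path_ball pp.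
    have R2 x : (exists p, [/\ path (adj (rep U)) (root (rep U)) p,
        last (root (rep U)) p = x & (size p <= h)%N]) ->
        (exists p, [/\ path (adj (rep U)) (root (rep U)) p,
        last (root (rep U)) p = x & (size p <= k)%N]).
      by move=> [p [pp pl ps]]; exists p; split=> //; exact: leq_trans hk.
    split=> //=.
    - split=> [x [gx Bx]|//|x [[gx _] Bx]] /=.
        by split; [split=> //; exact: R2|exact/R1].
      by exists x => //; split=> //; exact/R1.
    - move=> x y [gx Bx] [gy By].
      rewrite (asbool_equiv_eq (R1 x)) (asbool_equiv_eq (R1 y)).
      by rewrite (asboolT (R2 _ Bx)) (asboolT (R2 _ By)) /= !andbT.
  apply: (@iso_trans _ _ _ _ _ (ball h (ball k (rep T)))); first exact/iso_byW/BB.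
  apply: (@iso_trans _ _ _ _ _ (ball h (ball k (rep T0)))).
    by apply/iso_byW/iso_by_ball; [exact: fT|exact/wf_ball/rep_wf|exact/wf_ball/rep_wf].
  by apply: iso_sym (iso_byW (BB T0)); exact: Bv.
- by move=> B [/PG//|->]; rewrite -setCT; exact: PC.
Qed.

Lemma landingsT n (T : Tspace n) : landings T setT = root_deg T.
Proof. by rewrite /landings /root_deg card_fset_sum1; apply: eq_bigr => x _; rewrite asboolT. Qed.

Lemma landingsC n (T : Tspace n) B : (landings T B + landings T (~` B))%N = root_deg T.
Proof.
rewrite /landings /root_deg card_fset_sum1 -big_split /=; apply: eq_bigr => x _.
by rewrite asbool_neg; case: asboolP.
Qed.

(** The root has finitely many neighbors and each lands in at most one of the disjoint sets, so the
    partial sums become constant. *)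
Lemma landings_bigcup n (T : Tspace n) (F : (set (Tspace n))^nat) :
  trivIset setT F -> exists m, forall m', (m <= m')%N ->
  (\sum_(k < m') landings T (F k))%N = landings T (\bigcup_k F k).
Proof.
move=> tF; have /boolp.choice[i iP] (x : nat) :
    exists k, (\bigcup_k F k) (moved T x) -> F k (moved T x).
  have [[k _ Fk]|nF] := pselect ((\bigcup_k F k) (moved T x)); first by exists k.
  by exists 0%N => /nF.
exists (\max_(x <- fset_set (rnbrs T)) i x).+1 => m' mm'.
rewrite /landings exchange_big /= !big_seq; apply: eq_bigr => x xN.
have im' : (i x < m')%N by apply: leq_trans mm'; rewrite ltnS; exact: leq_bigmax_seq.
rewrite (bigD1 (Ordinal im')) //= big1 ?addn0 => [|k /eqP ki].
  by congr nat_of_bool; apply: asbool_equiv_eq; split=> [|/iP //]; exists (i x).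
case: asboolP => // Fk; case: ki; apply/val_inj => /=.
apply: (tF k (i x)) => //; exists (moved T x); split=> //.
by apply: iP; exists k.
Qed.

Lemma measurable_landings n (B : set (Tspace n)) q :
  measurable B -> measurable [set T : Tspace n | landings T B = q].
Proof.
move=> mB; move: B mB q.
apply: (@Tspace_induction n [set B | forall q, measurable [set T | landings T B = q]]).
- by move=> q; under eq_set do rewrite landingsT; exact: measurable_root_deg.
- by move=> B GB q; exact: measurable_landings_ball.
- move=> B _ IB q.
  rewrite (_ : mkset _ = [set T | exists a, landings T B = a /\ root_deg T = (a + q)%N]).
    apply: measurable_ex => a; apply: measurable_and; first exact: IB.
    exact: measurable_root_deg.
  apply/seteqP; split=> T /= [].
    by move=> <-; exists (landings T B); rewrite landingsC.
  by move=> a [<-]; rewrite -(landingsC _ B) => /addnI.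
- move=> F _ tF IF q.
  have IS m r : measurable [set T : Tspace n | (\sum_(k < m) landings T (F k))%N = r].
    elim: m r => [|m IH] r.
      by under eq_set do rewrite big_ord0; exact: measurable_cstP.
    rewrite (_ : mkset _ = [set T | exists a b, ((\sum_(k < m) landings T (F k))%N = a
       /\ landings T (F m) = b) /\ (a + b)%N = r]).
      apply: measurable_ex => a; apply: measurable_ex => b.
      apply: measurable_and; last exact: measurable_cstP.
      by apply: measurable_and; [exact: IH|exact: IF].
    apply/seteqP; split=> T /=; rewrite big_ord_recr /=; last by move=> [a [b [[-> ->]]]].
    by move=> <-; do 2 eexists.
  rewrite (_ : mkset _ = [set T | exists m, forall m', (m <= m')%N ->
      (\sum_(k < m') landings T (F k))%N = q]).
    apply: measurable_ex => m; apply: measurable_all => m'.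
    by apply: measurable_imply; [exact: measurable_cstP|exact: IS].
  apply/seteqP; split=> T /=.
    by have [m mP] := landings_bigcup T tF; move=> <-; exists m.
  have [m mP] := landings_bigcup T tF; move=> [m' m'P].
  by rewrite -(mP (maxn m m')) ?leq_maxl // m'P // leq_maxr.
Qed.

Lemma measurable_step (R : realType) n (B : set (Tspace n)) :
  measurable B -> measurable_fun setT (fun T : Tspace n => step R T B).
Proof.
move=> mB _ Y _; rewrite setTI.
rewrite (_ : _ @^-1` _ = [set T | exists a b, (landings T B = a /\ root_deg T = b) /\
    Y (a%:R / b%:R)]).
  apply: measurable_ex => a; apply: measurable_ex => b.
  apply: measurable_and; last exact: measurable_cstP.
  by apply: measurable_and; [exact: measurable_landings|exact: measurable_root_deg].
apply/seteqP; split=> T /=; rewrite stepE; first by move=> YT; do 2 eexists.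
by move=> [a [b [[-> ->]]]].
Qed.

Lemma step_ge0 (R : realType) n (T : Tspace n) B : 0 <= step R T B.
Proof. by rewrite stepE divr_ge0. Qed.

Lemma step_enum (R : realType) n (T : Tspace n) B m (x : 'I_m -> nat) :
  set_bij [set: 'I_m] (rnbrs T) x ->
  step R T B = \sum_(l < m) m%:R^-1 * (`[< B (moved T (x l)) >])%:R.
Proof.
move=> xb; rewrite -big_distrr /= stepE mulrC; have [xS xI xJ] := xb.
have NE : rnbrs T = x @` setT.
  by apply/seteqP; split=> [y /xJ[l _ <-]|_ [l _ <-]]; [exists l|exact: xS].
have TE l : (l \in fset_set [set: 'I_m]) = true.
  by rewrite in_fset_set ?in_setT //; exact: finite_finset.
have P : perm_eq (fset_set [set: 'I_m]) (index_enum 'I_m).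
  by apply: uniq_perm => [||l]; rewrite ?index_enum_uniq ?fset_uniq // TE mem_index_enum.
have -> : root_deg T = m.
  rewrite /root_deg (card_set_bij _ xb); last exact: finite_finset.
  by rewrite card_fset_sum1 (perm_big _ P) sum1_card card_ord.
congr (_ * _); rewrite /landings NE fset_set_image; last exact: finite_finset.
rewrite big_imfset /=; last by move=> k l _ _; apply: xI; rewrite inE.
by rewrite natr_sum (perm_big _ P).
Qed.

(* [Y l] are the events that the walk lands in [B] when it moves to the [l]-th
   neighbor. *)
Lemma integral_step (R : realType) n (mu : probability (Tspace n) R)
    d (Om : measurableType d) (Q : probability Om R) (X : {mfun Om >-> Tspace n})
    m (x : Om -> 'I_m -> nat) (Y : 'I_m -> set Om) (k : {nonneg R})
    (A B : set (Tspace n)) :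
  measurable A -> measurable B ->
  (forall C, measurable C -> C `<=` A -> mu C = (k%:num%:E * Q (X @^-1` C))%E) ->
  (forall w, A (X w) -> set_bij [set: 'I_m] (rnbrs (X w)) (x w)) ->
  (forall l, measurable (Y l)) ->
  (forall w l, A (X w) -> Y l w <-> B (moved (X w) (x w l))) ->
  (\int[mu]_(T in A) (step R T B)%:E =
   k%:num%:E * ((m%:R^-1)%:E * \sum_(l < m) Q (X @^-1` A `&` Y l)))%E.
Proof.
move=> mA mB muA xN mY YB.
have mXA : measurable (X @^-1` A) by rewrite -[X in measurable X]setTI; exact: measurable_funPT.
have mS : measurable_fun A (EFin \o (fun T : Tspace n => step R T B)).
  by apply/measurable_EFinP; apply: measurable_funTS; exact: measurable_step.
(* On [A] the measure [mu] is an image of [Q] up to a constant, so the integral can be computed on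
   [Om], where [x] enumerates the neighbors. *)
rewrite (eq_measure_integral (mscale k (distribution Q X))); last by move=> C; exact: muA.
rewrite ge0_integral_mscale //; last by move=> T _; rewrite lee_fin step_ge0.
congr (_ * _)%E.
rewrite ge0_integral_pushforward //; last by move=> T _; rewrite lee_fin step_ge0.
transitivity (\int[Q]_(w in X @^-1` A)
    \sum_(l < m) ((m%:R^-1)%:E * (\1_(Y l) w)%:E))%E.
  apply: eq_integral => w; rewrite inE => wA.
  rewrite /= (step_enum R B (xN w wA)) -sumEFin; apply: eq_bigr => l _.
  rewrite EFinM -(asbool_equiv_eq (YB w l wA)) indicE.
  by case: asboolP => Yw; [rewrite mem_set|rewrite memNset].
have m0 : 0 <= (m%:R^-1 : R) by rewrite invr_ge0.
have mI l : measurable_fun (X @^-1` A) (fun w => (\1_(Y l) w)%:E : \bar R).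
  by apply/measurable_EFinP; exact: measurable_indic.
rewrite ge0_integral_sum => [|//|l|l w _]; last 2 first.
- by apply: emeasurable_funM => //; exact: mI.
- by rewrite mule_ge0 // lee_fin.
rewrite ge0_sume_distrr; last by move=> l _; exact: measure_ge0.
apply: eq_bigr => l _; rewrite ge0_integralZl //.
by rewrite integral_indic // setIC.
Qed.

(** * Reversible measures satisfy detailed balance *)

Lemma root_nbrs_class n (V : choiceType) (g : rgraph n V) (T : Tspace n) i c :
  wf_graph g -> class_of T g ->
  root_nbrs i c T <-> lab g (root g) = i /\ forall j, nb g (root g) j = c j.
Proof.
move=> wg [f fT]; rewrite /root_nbrs /root_label /=.
have Tr := (rep_wf T).1.
rewrite -(iso_by_root fT) (iso_by_lab fT Tr); split=> -[-> H]; split=> // j.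
  by rewrite (iso_by_nb fT (rep_wf T) wg).
by rewrite -(iso_by_nb fT (rep_wf T) wg).
Qed.

Lemma measurable_root_nbrs n i c : measurable (@root_nbrs n i c).
Proof.
apply: (@measurable_local _ _ 1) => T T' [f fT] [Ti Tc].
have br (U : Tspace n) : wf_graph (ball 1 (rep U)) by exact/wf_ball/rep_wf.
have NB (U : Tspace n) j : nb (ball 1 (rep U)) (root (rep U)) j =
    nb (rep U) (root (rep U)) j.
  by rewrite /nb nbrs_ball //; exact: rep_wf.
have fr : f (root (rep T)) = root (rep T') by exact: (iso_by_root fT).
split=> [|j]; rewrite /root_label /= -?NB -fr.
  have := iso_by_lab fT (br T).1; rewrite /= => ->; exact: Ti.
by rewrite (iso_by_nb fT (br T) (br T')) ?NB //; exact: (br T).1.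
Qed.

Lemma nb_sum n (V : choiceType) (g : rgraph n V) x : finite_set (nbrs g x) ->
  (\sum_j nb g x j)%N = #|` fset_set (nbrs g x)|.
Proof.
move=> fN; rewrite card_fset_sum1 (eq_bigr (fun y => \sum_j (lab g y == j))%N); last first.
  move=> y _; rewrite (bigD1 (lab g y)) //= eqxx big1 ?addn0 // => j.
  by rewrite eq_sym => /negbTE ->.
rewrite exchange_big /=; apply: eq_bigr => j _; apply: card_fset_sum => y.
rewrite in_fset_set; last exact: sub_finite_set (@subIsetl _ _ _) fN.
rewrite in_fset_set //; apply/idP/andP => [|[]]; rewrite !inE.
  by move=> [Ny /= ->]; split.
by move=> Ny /eqP.
Qed.

(** Passing to the descendant subtree removes exactly the edge from [x] to the root. This is the
    source of the shifts by basis vectors in detailed balance. *)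
Lemma nb_descendants n (V : choiceType) (g : rgraph n V) x k :
  is_tree g -> nbrs g (root g) x ->
  nb g x k = (nb (descendants g x) x k + (k == lab g (root g)))%N.
Proof.
move=> tg gx; have xr : adj g x (root g) by rewrite (tree_sym tg).
have nr : x != root g.
  by apply/eqP => E; move: xr; rewrite E (tree_irr tg).
have D y : nbrs (descendants g x) x y <-> nbrs g x y /\ y != root g.
  split.
    move=> /and3P[xy _ /asboolP[p [_ py /negP np]]]; split=> //.
    by apply/eqP => yr; apply: np; rewrite -yr -py mem_last.
  move=> [xy yr]; apply/and3P; split=> //; apply/asboolP.
    by exists [::]; split=> //; rewrite inE eq_sym.
  exists [:: y]; split=> //=; first by rewrite andbT; exact: xy.
  by rewrite !inE negb_or eq_sym nr eq_sym.
rewrite /nb; set A := _ `&` _; set B := _ `&` _.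
have fA : finite_set A.
  exact: sub_finite_set (@subIsetl _ _ _) (tree_locally_finite tg x).
have BA : B = A `\ root g.
  apply/seteqP; split=> y /=.
    by move=> [/D[xy /eqP yr] yk].
  by move=> [[xy yk] yr]; split=> //; apply/D; split=> //; exact/eqP.
rewrite BA fset_setD1 // (cardfsD1 (root g) (fset_set A)) addnC; congr (_ + _)%N.
rewrite in_fset_set //; congr nat_of_bool; apply/idP/eqP => [|kr].
  by rewrite inE => -[_ /= ->].
by rewrite inE; split=> //; exact/esym.
Qed.

Definition add_e n (c : Sn n) (j : 'I_n.+1) : Sn n :=
  [ffun k => (c k + (k == j))%N].

Lemma add_eK n (c : Sn n) j : sub_e (add_e c j) j = c.
Proof. by apply/ffunP => k; rewrite !ffunE addnK. Qed.

Lemma add_e_gt0 n (c : Sn n) j : (0 < add_e c j j)%N.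
Proof. by rewrite ffunE eqxx addn1. Qed.

Lemma add_e_sub n (c : 'I_n.+1 -> nat) (d : Sn n) i : (0 < d i)%N ->
  (forall k, (c k + (k == i))%N = d k) <-> forall k, c k = sub_e d i k.
Proof.
move=> di; split=> H k; first by rewrite ffunE -H addnK.
rewrite H ffunE subnK //; have [->|//] := eqVneq k i; exact: di.
Qed.

Lemma gw_law_root_nbrs (R : realType) n (nu : gw_measure R n) s
    (P : set (Tspace n) -> \bar R) j c :
  gw_law nu s P -> s \in types nu -> s.2 = j ->
  P (root_nbrs j c) = (nu s.1 s.2 c)%:E.
Proof.
move=> [d [Om [Q [xi [X [_ xiQ _ Xc PE]]]]]] st sj.
rewrite PE; last exact: measurable_root_nbrs.
rewrite -(xiQ ([::], s)) //; congr (Q _); apply/seteqP; split=> w.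
  move=> /(root_nbrs_class _ _ (is_tree_wf (gw_graph_tree _ _)) (Xc w))[_ H].
  by apply/ffunP => k; rewrite -H gw_nb_nil.
move=> /= xc; apply/(root_nbrs_class _ _ (is_tree_wf (gw_graph_tree _ _)) (Xc w)).
by split=> [|k]; rewrite ?gw_nb_nil ?xc.
Qed.

Lemma probability_setI1 (R : realType) d (Om : measurableType d)
    (Q : probability Om R) (A B : set Om) :
  measurable A -> measurable B -> Q A = 1%E -> Q (A `&` B) = Q B.
Proof.
move=> mA mB QA; rewrite -[in RHS](setIT B) -(setUv A) setIUr measureU; last first.
- by rewrite setIACA setICr setI0.
- by apply: measurableI => //; exact: measurableC.
- exact: measurableI.
rewrite [X in (_ + X)%E](_ : _ = 0%E) ?adde0 1?setIC //.
apply/eqP; rewrite eq_le measure_ge0 andbT.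
rewrite (@le_trans _ _ (Q (~` A))) //; last by rewrite probability_setC // QA subee.
by apply: le_measure; rewrite ?inE //; [apply: measurableI => //|]; exact: measurableC.
Qed.

(** * The mass that the walk moves between two root events *)

Section flow.
Variables (R : realType) (n : nat) (nu : gw_measure R n).
Variables (mu : probability (Tspace n) R).
Hypothesis mu_nu : sim mu nu.

(** Each of the [c j] neighbors with label [j] is chosen with probability one over the degree, and
    it has [d] neighbors exactly when the root of its Galton-Watson subtree has [sub_e d i]
    children. *)
Lemma sim_flow i j (c d : Sn n) : (0 < c j)%N -> (0 < d i)%N ->
  (\int[mu]_(T in root_nbrs i c) (step R T (root_nbrs j d))%:E =
   mu (root_nbrs i c) *
     ((\sum_k c k)%N%:R^-1 * ((c j)%:R * nu i j (sub_e d i)))%:E)%E.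
Proof.
move=> cj di; have mR := measurable_root_nbrs.
have [m0|] := eqVneq (mu (root_nbrs i c)) 0%E.
  rewrite m0 mul0e; apply: null_set_integral => //.
  apply/measurable_EFinP/measurable_funTS; exact: measurable_step.
move=> m0; have mp : (0 < mu (root_nbrs i c))%E by rewrite lt0e m0 measure_ge0.
have [tc [e [Om [Q [T [m [k [X [muE TX _ XQ]]]]]]]]] := mu_nu mp.
have fm : mu (root_nbrs i c) \is a fin_num by exact: fin_num_measure.
have mTR : measurable (T @^-1` root_nbrs i c).
  by rewrite -[X in measurable X]setTI; apply: measurable_funPT => //; exact: mR.
(* [muE] applied to the conditioning event itself; events may now be intersected with it freely. *)
have Q1 : Q (T @^-1` root_nbrs i c) = 1%E.
  have fQ : Q (T @^-1` root_nbrs i c) \is a fin_num by exact: fin_num_measure.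
  have := muE _ (mR n i c); rewrite setIid -(fineK fm) -(fineK fQ) -EFinM => -[].
  rewrite -[LHS]mulr1 => /mulfI <- //.
  by rewrite fine_eq0.
have /boolp.choice[x xP] w : exists x : 'I_m -> nat,
    [/\ set_bij [set: 'I_m] (rnbrs (T w)) x,
      forall l, lab (rep (T w)) (x l) = k l
    & forall l, class_of (X l w) (descendants (rep (T w)) (x l))] by exact: TX.
have fiber : forall w, root_nbrs i c (T w) -> forall a, #|[pred l | k l == a]| = c a.
  move=> w [_ Tc] a; have [[xS xI xJ] xl _] := xP w; rewrite -Tc /nb.
  rewrite (@card_set_bij 'I_m nat [set l | k l = a] _ (x w)).
  - rewrite cardE; apply: perm_size; apply: uniq_perm => [||l].
    + by rewrite enum_uniq.
    + exact: fset_uniq.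
    + rewrite mem_enum in_fset_set; last exact: finite_finset.
      by rewrite inE; apply/eqP/idP; rewrite inE.
  - exact: finite_finset.
  - split=> [l /= la|l l' _ _|y [/xJ[l _ <-] /= ya]].
    + by split; [exact: xS|rewrite /= xl].
    + by apply: xI; rewrite inE.
    + by exists l => //=; rewrite -xl.
(* The labels [k] do not depend on the outcome, so a single outcome in the conditioning event
   determines how often each label occurs. *)
have [w0 Tw0] : exists w, root_nbrs i c (T w).
  apply/not_existsP => nT; move: Q1; rewrite (_ : T @^-1` _ = set0) ?measure0.
    by move=> /eqP; rewrite eqe eq_sym oner_eq0.
  by apply/seteqP; split=> // w /nT.
have kc l : (0 < c (k l))%N.
  by rewrite -(fiber _ Tw0); apply/card_gt0P; exists l; rewrite inE.
have mE : (\sum_a c a)%N = m.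
  rewrite (eq_bigr (fun a => #|[pred l | k l == a]|)); last first.
    by move=> a _; rewrite (fiber _ Tw0).
  rewrite -[RHS](card_ord m) -sum1_card (partition_big k xpredT) //=.
  by apply: eq_bigr => a _; rewrite -sum1_card; apply: eq_bigl => l; rewrite inE.
pose B := root_nbrs j (sub_e d i).
pose Y l := [set w | k l = j /\ X l w \in B].
have mXB l : measurable (X l @^-1` B).
  by rewrite -[X in measurable X]setTI; apply: measurable_funPT => //; exact: mR.
have YE l : Y l = if k l == j then X l @^-1` B else set0.
  by apply/seteqP; split=> w; case: eqP => //=; rewrite /Y /= ?inE => klj; [case|case|split].
have mY l : measurable (Y l) by rewrite YE; case: ifP.
have YP w l : root_nbrs i c (T w) ->
    Y l w <-> root_nbrs j d (moved (T w) (x w l)).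
  move=> [Ti _]; have [[xS _ _] xl Xc] := xP w; have Nx := xS l I.
  have tT := rep_tree (T w).
  have wD : wf_graph (descendants (rep (T w)) (x w l)).
    apply: wf_induced (rep_wf _) (rnbrs_vtx Nx) _; exists [::]; split=> //.
    rewrite inE; apply/eqP => E; move: Nx; rewrite /rnbrs /nbrs /= -E.
    by rewrite (tree_irr tT).
  rewrite (root_nbrs_class _ _ (wf_reroot (rep_wf _) (rnbrs_vtx Nx)) (movedP Nx)).
  rewrite /Y /= inE /B (root_nbrs_class _ _ wD (Xc l)) /= xl.
  have E a : nb (rep (T w)) (x w l) a =
      (nb (descendants (rep (T w)) (x w l)) (x w l) a + (a == i))%N.
    by rewrite (nb_descendants _ tT Nx); congr (_ + (_ == _))%N.
  have -> : (forall a, nb (reroot (rep (T w)) (x w l)) (x w l) a = d a) <->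
      (forall a, nb (descendants (rep (T w)) (x w l)) (x w l) a = sub_e d i a).
    rewrite -(add_e_sub (nb (descendants (rep (T w)) (x w l)) (x w l)) di).
    by split=> H a; have := H a; rewrite -E.
  by split=> [[klj [_ H]]|[klj H]]; split.
rewrite (@integral_step R n mu _ Om Q T m x Y (NngNum (fine_ge0 (measure_ge0 mu (root_nbrs i c))))
  (root_nbrs i c) (root_nbrs j d)) //; last 2 first.
- move=> C mC /setIidPl CR; rewrite -[in LHS]CR muE //= fineK //.
- by move=> w _; have [] := xP w.
rewrite /= fineK // mE; congr (_ * _)%E; rewrite EFinM; congr (_ * _)%E.
transitivity (\sum_(l < m) (if k l == j then (nu i j (sub_e d i))%:E else 0))%E.
  apply: eq_bigr => l _; rewrite probability_setI1 // YE; case: eqP => [klj|_]; last exact: measure0.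
  have := @gw_law_root_nbrs _ _ _ _ _ j (sub_e d i) (XQ l) (tc _ (kc l)) klj.
  by rewrite /= klj.
rewrite -big_mkcond /= sumEFin; congr EFin.
by rewrite sumr_const -(fiber _ Tw0) mulr_natl.
Qed.

Hypothesis mu_rev : reversible mu.

(** A root event without neighbors gets weight 0, since division by zero gives 0. *)
Definition weight (x : 'I_n.+1 * Sn n) : R :=
  fine (mu (root_nbrs x.1 x.2)) / (\sum_k x.2 k)%N%:R.

Lemma weight_ge0 x : 0 <= weight x.
Proof. by rewrite divr_ge0 // fine_ge0. Qed.

Lemma weight_balance i j (c d : Sn n) : (0 < c j)%N -> (0 < d i)%N ->
  weight (i, c) * ((c j)%:R * nu i j (sub_e d i)) =
  weight (j, d) * ((d i)%:R * nu j i (sub_e c j)).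
Proof.
move=> cj di; have := mu_rev (measurable_root_nbrs i c) (measurable_root_nbrs j d).
rewrite !sim_flow // -[X in (X * _)%E = _]fineK ?fin_num_measure //; last exact: measurable_root_nbrs.
rewrite -[X in _ = (X * _)%E]fineK ?fin_num_measure //; last exact: measurable_root_nbrs.
by rewrite -!EFinM => -[]; rewrite /weight !mulrA.
Qed.

End flow.

(** * Strong connectivity *)

(** The combinatorial content of strong connectivity: chains of types whose successive offspring
    vectors have positive probability. *)
Inductive reach (R : realType) n (nu : gw_measure R n) (s : 'I_n.+1 * 'I_n.+1) :
    'I_n.+1 * 'I_n.+1 -> Prop :=
| reach_refl : reach nu s s
| reach_step t c k : reach nu s t -> 0 < nu t.1 t.2 c -> (0 < c k)%N ->
    reach nu s (t.2, k).

Lemma exists_measure_gt0 (R : realType) d (Om : measurableType d)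
    (Q : probability Om R) (I : countType) (E : I -> set Om) (A : set Om) :
  measurable A -> (forall i, measurable (E i)) ->
  (forall w, A w -> exists i, E i w) -> (0 < Q A)%E ->
  exists i, (0 < Q (E i))%E.
Proof.
move=> mA mE AE; apply: contraPP => /forallNP nE; apply/negP; rewrite -leNgt.
have E0 i : Q (E i) = 0%E.
  by apply/eqP; rewrite eq_le measure_ge0 andbT leNgt; apply/negP/nE.
have N : Q.-negligible (\bigcup_(k : nat)
    (if @choice.unpickle I k is Some i then E i else set0)).
  apply: negligible_bigcup => k; case: choice.unpickle => [i|]; last exact: negligible_set0.
  exact: (negligibleP _ (mE i)).2 (E0 i).
rewrite (measure_negligible mA) //; apply: negligibleS N => w /AE[i Ei].
by exists (choice.pickle i) => //; rewrite choice.pickleK.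
Qed.

(* A simple path of a Galton-Watson tree that leaves a word downwards never
   returns to the root. *)
Lemma gw_parent n (xi : field n) s u v : parent (gw_graph xi s) u v ->
  [/\ gw_vertex xi s v & exists x, v = rcons u x].
Proof.
have down p : forall (y z : word n) (a : 'I_n.+1 * nat), y = rcons z a ->
    path (adj (gw_graph xi s)) y p -> uniq (z :: y :: p) -> last y p <> [::].
  elim: p => [|b p IH] y z a ya /=; first by move=> _ _ y0; move: ya; rewrite y0; case: (z).
  move=> /andP[/and3P[gy gb yb] bp] /and3P[zN yN up].
  have [x bx] : exists x, b = rcons y x.
    move: yb => /orP[/is_childP //|/is_childP[x yx]].
    move: zN; rewrite ya in yx *; have [zb _] := rcons_inj yx.
    by rewrite zb !inE eqxx orbT.
  by apply: (IH b y x) => //; rewrite -[uniq _]/(uniq (y :: b :: p)) /= yN.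
move=> [p [/= /andP[/and3P[gv gu vu] up] un ul]]; split=> //.
move: vu => /orP[/is_childP[x ux]|/is_childP[x vx]]; last by exists x.
by have := down p u v x ux up un.
Qed.

Lemma parent_ball n (V : choiceType) (g : rgraph n V) k (u v : V) p :
  is_tree g -> path (adj g) v (u :: p) -> last u p = root g -> (size p < k)%N ->
  path (adj (ball k g)) v (u :: p) /\ vtx (ball k g) v.
Proof.
move=> tg pp pl pk; have tb := tree_ball k tg.
have P : path (adj (ball k g)) v (u :: p).
  have e : last v (u :: p) = root g by exact: pl.
  rewrite -(path_rev_sym _ _ (tree_sym tb)) e.
  apply: (@ball_step _ _ _ _ 0%N); first by exists [::].
    by rewrite -e path_rev_sym //; exact: tree_sym.
  by rewrite size_rev size_belast.
split=> //; move: P => /= /andP[vu _].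
by have [] := (is_tree_wf tb).2 _ _ vu.
Qed.

Lemma parent_iso n (V W : choiceType) (f : V -> W) (g : rgraph n V)
    (h : rgraph n W) u v : iso_by f g h -> wf_graph g -> parent g u v ->
  parent h (f u) (f v) /\ lab h (f u) = lab g u /\ lab h (f v) = lab g v.
Proof.
move=> fgh wg [p [pp pu pl]].
have [gv gu] : vtx g v /\ vtx g u by apply: wg.2; case/andP: pp.
split; last by rewrite !(iso_by_lab fgh).
exists (map f p); split.
- exact: (iso_by_path fgh wg gv pp).
- rewrite -[[:: f v, f u & _]]/(map f [:: v, u & p]) map_inj_in_uniq // => x y xp yp.
  by apply: (iso_by_inj fgh); exact: (wf_path wg gv pp).
- by rewrite last_map pl (iso_by_root fgh).
Qed.

Lemma measurable_contains_type n s t : measurable (@contains_type n s t).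
Proof.
(* Bounding the depth of [v] by [k] makes the event local; the union over [k] recovers it. *)
pose L k (T : Tspace n) := exists u v p,
  [/\ path (adj (rep T)) v (u :: p), uniq (v :: u :: p),
    last u p = root (rep T), (size p < k)%N &
    lab (rep T) u = t.1 /\ lab (rep T) v = t.2].
rewrite (_ : contains_type s t = [set T | exists k, s = t \/ L k T]).
  apply: measurable_ex => k.
  have [st|nst] := pselect (s = t).
    by rewrite (_ : mkset _ = setT) //; apply/seteqP; split=> // T _; left.
  rewrite (_ : mkset _ = L k); last by apply/seteqP; split=> T; [case|right].
  apply: (@measurable_local _ _ k) => T T' [f fT] [u [v [p [pp pu pl pk [lu lv]]]]].
  have wT : wf_graph (ball k (rep T)) by exact/wf_ball/rep_wf.
  have [bp bv] := parent_ball (rep_tree T) pp pl pk.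
  have bu : vtx (ball k (rep T)) u by case/andP: bp => /wT.2[].
  exists (f u), (f v), (map f p); split.
  - exact: sub_path_ball (iso_by_path fT wT bv bp).
  - rewrite -[[:: f v, f u & _]]/(map f [:: v, u & p]) map_inj_in_uniq // => x y xp yp.
    by apply: (iso_by_inj fT); exact: (wf_path wT bv bp).
  - by rewrite last_map pl (iso_by_root fT).
  - by rewrite size_map.
  - by split; [rewrite -lu; exact: (iso_by_lab fT bu)|rewrite -lv; exact: (iso_by_lab fT bv)].
apply/seteqP; split=> T /=.
  case=> [st|[u [v [[p [pp pu pl]] lu lv]]]]; first by exists 0%N; left.
  by exists (size p).+1; right; exists u, v, p; split.
move=> [k [st|[u [v [p [pp pu pl _ [lu lv]]]]]]]; first by left.
by right; exists u, v; split=> //; exists p.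
Qed.

(** There are countably many words, so some fixed word of type [t] is a vertex with positive
    probability; its prefixes form the chain. *)
Lemma gw_law_reach (R : realType) n (nu : gw_measure R n) s
    (P : set (Tspace n) -> \bar R) t :
  s \in types nu -> gw_law nu s P -> (0 < P (contains_type s t))%E -> reach nu s t.
Proof.
move=> sN [d [Om [Q [xi [X [mxi xiQ _ Xc PE]]]]]].
have [<- _|/eqP nst] := eqVneq s t; first exact: reach_refl.
rewrite PE; last exact: measurable_contains_type.
have mXA : measurable (X @^-1` contains_type s t).
  by rewrite -[X in measurable X]setTI; apply: measurable_funPT => //; exact: measurable_contains_type.
pose E v := [set w | gw_vertex (xi^~ w) s v /\ word_type s v = t].
have mE v : measurable (E v).
  by apply: measurable_and; [exact: measurable_gw_vertex|exact: measurable_cstP].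
move=> /(exists_measure_gt0 mXA mE)[w|v].
  move=> [//|[u [v [uv lu lv]]]]; have [f fX] := Xc w.
  have [/gw_parent[gv [x vx]] [flu flv]] := parent_iso fX (rep_wf _) uv.
  exists (f v); split=> //; rewrite vx word_type_rcons.
  by move: flu flv; rewrite vx /= word_type_rcons lu lv /= => -> ->; case: (t).
have [<-|nvt] := eqVneq (word_type s v) t; last first.
  rewrite (_ : E v = set0) ?measure0 ?ltxx //; apply/seteqP; split=> // w [_ /eqP].
  by rewrite (negbTE nvt).
move=> Ev; have {Ev} : (0 < Q [set w | gw_vertex (xi^~ w) s v])%E.
  apply: lt_le_trans Ev _; apply: le_measure; rewrite ?inE //; last by move=> w [].
  exact: measurable_gw_vertex.
(* Membership in [types nu] is carried through the induction because the law of [xi] is prescribed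
   only at types. *)
suff H : (0 < Q [set w | gw_vertex (xi^~ w) s v])%E ->
  reach nu s (word_type s v) /\ word_type s v \in types nu by case/H.
elim/last_ind: v {mE E nst mXA} => [|v x IH] Qv; first by split=> //; exact: reach_refl.
have mv := measurable_gw_vertex s v mxi.
have Qv' : (0 < Q [set w | gw_vertex (xi^~ w) s v])%E.
  apply: lt_le_trans Qv _; apply: le_measure; rewrite ?inE //.
    exact: measurable_gw_vertex.
  by move=> w; rewrite /= gw_vertex_rcons => /andP[].
have [rv tv] := IH Qv'.
pose F c := [set w | xi (v, word_type s v) w = c /\ (x.2 < c x.1)%N].
have mF c : measurable (F c).
  by apply: measurable_and => //; exact: measurable_cstP.
have [|c Fc] := exists_measure_gt0 (measurable_gw_vertex s (rcons v x) mxi) mF _ Qv.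
  move=> w; rewrite /= gw_vertex_rcons => /andP[_ xc].
  by exists (xi (v, word_type s v) w).
have xc : (x.2 < c x.1)%N.
  apply: contraLR Fc => nc; rewrite -leNgt (_ : F c = set0) ?measure0 //.
  by apply/seteqP; split=> // w [_ xc]; rewrite xc in nc.
have cp : 0 < nu (word_type s v).1 (word_type s v).2 c.
  rewrite -lte_fin; have /= <- := xiQ (v, word_type s v) c tv; apply: lt_le_trans Fc _.
  by apply: le_measure; rewrite ?inE // => w [].
have cx : (0 < c x.1)%N by apply: leq_ltn_trans xc.
rewrite word_type_rcons; split; first exact: reach_step rv cp cx.
exact: offspring_types cp cx.
Qed.

Lemma strongly_connected_reach (R : realType) n (nu : gw_measure R n) :
  strongly_connected nu -> forall s t, s \in types nu -> t \in types nu ->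
  reach nu s t.
Proof.
by move=> sc s t sN tN; have [_ [P Ps Pt]] := sc _ _ sN tN; exact: gw_law_reach Pt.
Qed.

Lemma exists_offspring (R : realType) n (nu : gw_measure R n) s :
  s \in types nu -> exists c, 0 < nu s.1 s.2 c.
Proof.
case: s => i j sN; apply/not_existsP => nc.
have := offspring_sum sN; rewrite esum1 => [/eqP|c _]; first by rewrite eqe eq_sym oner_eq0.
congr EFin; apply/eqP; rewrite eq_le offspring_ge0 andbT leNgt; exact/negP/nc.
Qed.

Lemma measurable_root_label n i : measurable (@root_label n i).
Proof.
rewrite (_ : root_label i = [set T | exists c, root_nbrs i c T]).
  by apply: measurable_ex => c; exact: measurable_root_nbrs.
apply/seteqP; split=> T; last by move=> [c []].
move=> Ti; exists [ffun j => nb (rep T) (root (rep T)) j]; split=> // j.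
by rewrite ffunE.
Qed.

Lemma standing_root_nbrs (R : realType) n (mu : probability (Tspace n) R) i :
  standing mu -> exists (c : Sn n) j, (0 < c j)%N /\ (0 < mu (root_nbrs i c))%E.
Proof.
move=> [/(_ i) mi ae].
have [T Ti|c mc] := exists_measure_gt0 (measurable_root_label i)
  (@measurable_root_nbrs n i) _ mi.
  exists [ffun j => nb (rep T) (root (rep T)) j]; split=> // j.
  by rewrite ffunE.
have [[j cj]|c0] := pselect (exists j, (0 < c j)%N); first by exists c, j.
have N : mu (root_nbrs i c) = 0%E.
  apply: measure_negligible; first exact: measurable_root_nbrs.
  apply: negligibleS ae => T [_ Tc] /= [x Tx].
  have := nb_sum (rnbrs_finite T); rewrite big1 => [|j _]; last first.
    by apply/eqP; rewrite Tc -leqn0 leqNgt; apply/negP => cj; apply: c0; exists j.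
  rewrite (cardfsD1 x) in_fset_set; last exact: rnbrs_finite.
  by rewrite mem_set.
by rewrite N ltxx in mc.
Qed.

(** * From detailed balance to conditions (i) and (ii) *)

Section balance.
Variables (R : realType) (n : nat) (nu : gw_measure R n).
Variable W : 'I_n.+1 * Sn n -> R.
Hypothesis W_ge0 : forall x, 0 <= W x.
Hypothesis W_types : forall i (c : Sn n) j, 0 < W (i, c) -> (0 < c j)%N ->
  (i, j) \in types nu.
Hypothesis W_balance : forall i j (c d : Sn n), (0 < c j)%N -> (0 < d i)%N ->
  W (i, c) * ((c j)%:R * nu i j (sub_e d i)) =
  W (j, d) * ((d i)%:R * nu j i (sub_e c j)).
Hypothesis W_root : exists i (c : Sn n) j, (0 < c j)%N /\ 0 < W (i, c).
Hypothesis nu_reach : forall s t, s \in types nu -> t \in types nu -> reach nu s t.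

(** One side of detailed balance is positive, hence so is every factor of the other side. *)
Lemma W_step i j (c d : Sn n) : (0 < c j)%N -> (0 < d i)%N ->
  0 < W (i, c) -> 0 < nu i j (sub_e d i) ->
  0 < W (j, d) /\ 0 < nu j i (sub_e c j).
Proof.
move=> cj di Wc ncd.
have : 0 < W (i, c) * ((c j)%:R * nu i j (sub_e d i)).
  by rewrite !mulr_gt0 // ltr0n.
rewrite W_balance //; have := W_ge0 (j, d); have := offspring_ge0 nu j i (sub_e c j).
rewrite !le_eqVlt => /orP[/eqP <-|->]; first by rewrite !mulr0 ltxx.
by move=> /orP[/eqP <-|->] //; rewrite mul0r ltxx.
Qed.

(** Positive weight travels from the state given by [W_root] along a chain of types up to [(j, i)];
    a last step with offspring vector [sub_e c j] enters [(i, c)]. A type [(a, b)] is read here as a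
    state of positive weight with label [a] and a neighbor labeled [b]. *)
Lemma W_gt0 i j (c : Sn n) : (0 < c j)%N -> 0 < nu j i (sub_e c j) ->
  0 < W (i, c).
Proof.
move=> cj nc; have jiN : (j, i) \in types nu.
  by apply: contraPT nc => /offspring_notin ->; rewrite ltxx.
have [a [c0 [b [c0b Wc0]]]] := W_root.
suff [d Wd di] : exists2 d, 0 < W (j, d) & (0 < d i)%N.
  by have [] := W_step di cj Wd nc.
have abN := W_types Wc0 c0b.
suff : exists2 d, 0 < W ((j, i).1, d) & (0 < d (j, i).2)%N by [].
elim: (nu_reach abN jiN) => [|t d k _ [e We et] td dk]; first by exists c0.
(* The state entered has the offspring vector [d] together with its parent, which counts as a
   neighbor. *)
exists (add_e d t.1) => /=; last by rewrite ffunE addn_gt0 dk.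
by have [] := @W_step t.1 t.2 e (add_e d t.1) et (add_e_gt0 _ _) We; rewrite ?add_eK.
Qed.

(** The state [(i, c)] has positive weight, so some step to a neighbor labeled [k] has positive
    probability; the wanted probability is a factor of the reverse step. *)
Lemma balance_i i j k (c : Sn n) : (0 < c j)%N -> 0 < nu j i (sub_e c j) ->
  (0 < c k)%N -> 0 < nu k i (sub_e c k).
Proof.
move=> cj nc ck; have Wc := W_gt0 cj nc.
have [d nd] := exists_offspring (W_types Wc ck).
by have [] := @W_step i k c (add_e d i) ck (add_e_gt0 _ _) Wc; rewrite ?add_eK.
Qed.

(** All weights along the cycle are positive, so each factor is a quotient of consecutive weights
    and the product telescopes. *)
Lemma balance_ii (k : nat) (i : nat -> 'I_n.+1) (c : nat -> Sn n) :
  (2 <= k)%N -> i k = i 1%N -> c k = c 1%N ->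
  (forall p, (1 <= p <= k.-1)%N ->
     [/\ (0 < c p (i p.+1))%N, (0 < c p.+1 (i p))%N
       & 0 < nu (i p) (i p.+1) (sub_e (c p.+1) (i p))]) ->
  \prod_(1 <= p < k)
    (nu (i p) (i p.+1) (sub_e (c p.+1) (i p))
       / nu (i p.+1) (i p) (sub_e (c p) (i p.+1))
     * ((c p (i p.+1))%:R / (c p.+1 (i p))%:R)) = 1.
Proof.
case: k => // k k2 ik ck H.
have Wp p : (1 <= p <= k.+1)%N -> 0 < W (i p, c p).
  (* The state of index 1 is not entered by an earlier step, but the last step enters it because the
     cycle closes. *)
  case: p => // p /= pk; have [->|p0] := eqVneq p 0%N.
    have [|h1 h2 h3] := H k; first by rewrite /= -ltnS k2 leqnn.
    by move: h2 h3; rewrite ik ck; exact: W_gt0.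
  have [|h1 h2 h3] := H p; first by rewrite lt0n p0.
  exact: W_gt0 h2 h3.
rewrite (eq_big_nat _ _ (F2 := fun p => W (i p.+1, c p.+1) / W (i p, c p))).
  rewrite (telescope_prodf (f := fun p => W (i p, c p))) //= => [|p /andP[p1 pk]].
    by rewrite ik ck divff // gt_eqF // Wp //= ltnW.
  by rewrite gt_eqF // Wp // (ltnW p1) ltnW.
move=> p /andP[p1 pk]; have [|h1 h2 h3] := H p; first by rewrite p1.
have W1 : 0 < W (i p, c p) by rewrite Wp // p1 ltnW.
have W2 : 0 < W (i p.+1, c p.+1) by rewrite Wp.
have [_ n2] := W_step h1 h2 W1 h3.
have := W_balance h1 h2.
set a := nu _ _ _ in h3 *; set b := nu _ _ _ in n2 *.
set x := W _ in W1 *; set y := W _ in W2 *.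
have cp : ((c p (i p.+1))%:R : R) != 0 by rewrite pnatr_eq0 -lt0n.
have cp1 : ((c p.+1 (i p))%:R : R) != 0 by rewrite pnatr_eq0 -lt0n.
move=> E; apply/eqP; rewrite mulf_div eqr_div ?mulf_neq0 ?(lt0r_neq0 W1) ?(lt0r_neq0 n2) //.
by apply/eqP; rewrite [a * _]mulrC [LHS]mulrC E [b * _]mulrC.
Qed.

End balance.

Lemma reversible_conditions (R : realType) (n : nat) (nu : gw_measure R n)
    (mu : probability (Tspace n) R) :
  strongly_connected nu -> standing mu -> reversible mu -> sim mu nu ->
  let W := weight mu in
  [/\ forall x, 0 <= W x, 
   forall i (c : Sn n) j, 0 < W (i, c) -> (0 < c j)%N -> (i, j) \in types nu,
   forall i j (c d : Sn n), (0 < c j)%N -> (0 < d i)%N ->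
     W (i, c) * ((c j)%:R * nu i j (sub_e d i)) =
     W (j, d) * ((d i)%:R * nu j i (sub_e c j)) &
   exists i (c : Sn n) j, (0 < c j)%N /\ 0 < W (i, c)].
Proof.
move=> sc st rv sm W.
have mp i c : 0 < W (i, c) <->
    (0 < mu (root_nbrs i c))%E /\ exists j, (0 < c j)%N.
  have fm : mu (root_nbrs i c) \is a fin_num.
    by rewrite fin_num_measure //; exact: measurable_root_nbrs.
  rewrite /W /weight /= -[X in (0 < X)%E](fineK fm) lte_fin.
  split=> [|[m0 [j cj]]]; last first.
    by rewrite divr_gt0 // ltr0n (bigD1 j) //= addn_gt0 cj.
  have := fine_ge0 (measure_ge0 mu (root_nbrs i c)); rewrite le_eqVlt => /orP[/eqP <-|m0].
    by rewrite mul0r ltxx.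
  move=> H; split=> //; apply/not_existsP => c0; move: H; rewrite big1 ?invr0 ?mulr0 ?ltxx //.
  by move=> j _; apply/eqP; rewrite -leqn0 leqNgt; exact/negP.
split.
- exact: weight_ge0.
- by move=> i c j /mp[m0 _] cj; have [/(_ _ cj)] := sm _ _ m0.
- by move=> *; exact: (weight_balance sm rv).
- have [c [j [cj m0]]] := standing_root_nbrs ord0 st.
  by exists ord0, c, j; split=> //; apply/mp; split=> //; exists j.
Qed.

(** * Potentials and conductances *)

Section potential.
Variables (R : realType) (T : eqType) (x0 : T) (e : rel T) (r : T -> T -> R).
Implicit Types (x y : T) (p q : seq T).

Fixpoint pathprod x p : R := if p is y :: p' then r x y * pathprod y p' else 1.

Lemma pathprod_cat x p q :
  pathprod x (p ++ q) = pathprod x p * pathprod (last x p) q.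
Proof. by elim: p x => [|y p IH] x /=; rewrite ?mul1r // IH mulrA. Qed.

Lemma pathprod_nth x p :
  pathprod x p = \prod_(0 <= j < size p) r (nth x (x :: p) j) (nth x (x :: p) j.+1).
Proof.
elim: p x => [|y p IH] x; first by rewrite big_nil.
rewrite [size _]/= big_nat_recl //= IH; congr (_ * _).
by apply: eq_big_nat => j /andP[_ jp]; congr r; apply: set_nth_default => //=; exact: ltnW.
Qed.

Hypothesis e_sym : symmetric e.
Hypothesis r_gt0 : forall x y, e x y -> 0 < r x y.
Hypothesis r_cycle : forall x q, path e x (rcons q x) -> uniq (x :: q) ->
  pathprod x (rcons q x) = 1.

Lemma not_uniq_split (s : seq T) : ~~ uniq s ->
  exists a y b c, s = a ++ y :: b ++ y :: c.
Proof.
elim: s => //= x s IH; rewrite negb_and negbK => /orP[xs|/IH[a [y [b [c ->]]]]].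
  by case/splitPr: xs => b c; exists [::], x, b, c.
by exists (x :: a), y, b, c.
Qed.

(** A vertex visited twice cuts a closed walk into shorter closed ones, and a walk without one is a
    simple cycle. Loops and edges run back and forth count as simple cycles. *)
Lemma pathprod_closed x p : path e x p -> last x p = x -> pathprod x p = 1.
Proof.
have [m] := ubnP (size p); elim: m => // m IH in x p *.
case: (lastP p) => // q z; rewrite size_rcons ltnS last_rcons => qm pq zx.
rewrite {z}zx in pq *.
have [uq|/not_uniq_split[a [y [b [c]]]]] := boolP (uniq (x :: q)); first exact: r_cycle.
case: a => [[xy qE]|x' a [_ qE]].
  move: pq qm; rewrite qE -xy -cat_rcons rcons_cat cat_path last_rcons => /andP[p1 p2].
  rewrite size_cat !size_rcons => qm.
  rewrite pathprod_cat last_rcons.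
  by rewrite !IH ?last_rcons ?size_rcons ?mul1r //; lia.
move: pq qm; rewrite qE -cat_rcons rcons_cat -cat_rcons rcons_cat cat_path last_rcons => /andP[p1].
rewrite cat_path last_rcons => /andP[p2 p3]; rewrite !size_cat !size_rcons => qm.
rewrite !pathprod_cat !last_rcons (IH y (rcons b y)) ?last_rcons ?size_rcons //; last lia.
rewrite mul1r; have := IH x (rcons a y ++ rcons c x); rewrite pathprod_cat last_rcons; apply.
- by rewrite size_cat !size_rcons; lia.
- by rewrite cat_path p1 last_rcons p3.
- by rewrite last_cat !last_rcons.
Qed.

Lemma pathprod_gt0 x p : path e x p -> 0 < pathprod x p.
Proof. by elim: p x => //= y p IH x /andP[xy yp]; rewrite mulr_gt0 ?r_gt0 ?IH. Qed.

(** The potential at [x] is the product along a path from a base vertex of its component. The paths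
    chosen for the two ends of an edge are compared by closing both up with the same way back. *)
Lemma potential : exists w : T -> R,
  (forall x, 0 < w x) /\ (forall x y, e x y -> w y = w x * r x y).
Proof.
pose C x := [set y | exists2 p, path e x p & last x p = y].
have Csym x y : C x y -> C y x.
  move=> [p xp <-]; exists (rev (belast x p)); last exact: last_rev_belast.
  by rewrite path_rev_sym.
have Ctrans x y z : C x y -> C y z -> C x z.
  move=> [p xp <-] [q yq <-]; exists (p ++ q); last by rewrite last_cat.
  by rewrite cat_path xp.
have Crefl x : C x x by exists [::].
have [b bP] : exists b : T -> T, forall x, C (b x) x /\ forall y, C x y -> b x = b y.
  (* The base vertex is chosen from the component as a set, so all vertices of a component share
     it. *)
  have /boolp.choice[f fP] (A : set T) : exists x, (exists y, A y) -> A x.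
    by have [[y Ay]|nA] := pselect (exists y, A y); [exists y|exists x0 => /nA].
  exists (fun x => f (C x)) => x; split=> [|y xy].
    by apply: Csym; apply: (fP (C x)); exists x; exact: Crefl.
  congr f; apply/seteqP; split=> z; first by apply: Ctrans; exact: Csym.
  exact: Ctrans.
have /boolp.choice[q qP] x : exists p, path e (b x) p /\ last (b x) p = x.
  by have [[p bp px] _] := bP x; exists p.
exists (fun x => pathprod (b x) (q x)); split=> [x|x y xy].
  by have [bq _] := qP x; exact: pathprod_gt0.
have Cxy : C x y by exists [:: y] => //=; rewrite xy.
have [qx lx] := qP x; have [qy ly] := qP y; have bxy := (bP x).2 _ Cxy.
have [s ys ls] : C y (b y) by apply: Csym; have [] := bP y.
have E1 : pathprod (b y) (q y) * pathprod y s = 1.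
  by rewrite -{3}ly -pathprod_cat pathprod_closed ?cat_path ?qy ?ly // last_cat ly.
have E2 : pathprod (b x) (q x) * (r x y * pathprod y s) = 1.
  rewrite -[r x y * _]/(pathprod x (y :: s)) -{3}lx -pathprod_cat pathprod_closed //.
    by rewrite cat_path qx lx /= xy ys.
  by rewrite last_cat lx /= ls bxy.
apply: (mulIf (lt0r_neq0 (pathprod_gt0 ys))).
by rewrite E1 -mulrA E2.
Qed.

End potential.

(** * Symmetric conductances from (i) and (ii) *)

Section conductances.
Variables (R : realType) (n : nat) (nu : gw_measure R n).
Hypothesis nu_reach : forall s t, s \in types nu -> t \in types nu -> reach nu s t.
Hypothesis cond_i : forall (i j k : 'I_n.+1) (c : Sn n),
  (0 < c j)%N -> 0 < nu j i (sub_e c j) -> (0 < c k)%N -> 0 < nu k i (sub_e c k).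
Hypothesis cond_ii : forall (k : nat) (i : nat -> 'I_n.+1) (c : nat -> Sn n),
  (2 <= k)%N -> i k = i 1%N -> c k = c 1%N ->
  (forall p, (1 <= p <= k.-1)%N ->
     [/\ (0 < c p (i p.+1))%N, (0 < c p.+1 (i p))%N
       & 0 < nu (i p) (i p.+1) (sub_e (c p.+1) (i p))]) ->
  (forall s t, (1 <= s <= k.-1)%N -> (1 <= t <= k.-1)%N -> s != t ->
     i s = i t -> c s <> c t) ->
  \prod_(1 <= p < k)
    (nu (i p) (i p.+1) (sub_e (c p.+1) (i p))
       / nu (i p.+1) (i p) (sub_e (c p) (i p.+1))
     * ((c p (i p.+1))%:R / (c p.+1 (i p))%:R)) = 1.

(** The last step of a chain of types to [(i, j)] shows a vertex labeled [i] with a child labeled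
    [j]. By (i) that child can take the place of the parent. *)
Lemma types_sym i j : (i, j) \in types nu -> (j, i) \in types nu.
Proof.
move=> ijN; have [ij|nij] := eqVneq i j; first by rewrite -ij in ijN *.
have [k kiN] := types_snd nu i.
have := nu_reach kiN ijN; move E : (i, j) => s H.
case: H E => [[_ /eqP]|t c l _ tc cl0 [il jl]]; first by rewrite eq_sym (negbTE nij).
rewrite {}il {}jl in ijN nij *.
have : 0 < nu l t.2 (sub_e (add_e c t.1) l).
  by apply: (@cond_i _ t.1); rewrite ?add_eK ?add_e_gt0 // ffunE addn_gt0 cl0.
by apply: contraPT => /offspring_notin ->; rewrite ltxx.
Qed.

Let St : eqType := ('I_n.+1 * {ffun 'I_n.+1 -> nat})%type.
(** The possible states: a label with a vector of neighbors, one of which can be the parent. By (i)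
    every one of the neighbors then can. *)
Let S (x : St) := exists j, (0 < x.2 j)%N /\ 0 < nu j x.1 (sub_e x.2 j).
Let e : rel St := fun x y =>
  [&& `[< S x >], `[< S y >], (0 < x.2 y.1)%N & (0 < y.2 x.1)%N].
Let r (x y : St) : R := nu x.1 y.1 (sub_e y.2 x.1) / nu y.1 x.1 (sub_e x.2 y.1)
     * ((x.2 y.1)%:R / (y.2 x.1)%:R).

Let S_gt0 x k : S x -> (0 < x.2 k)%N -> 0 < nu k x.1 (sub_e x.2 k).
Proof. by move=> [j [xj nj]]; exact: cond_i nj. Qed.

Let eP x y : e x y -> [/\ 0 < nu x.1 y.1 (sub_e y.2 x.1),
  0 < nu y.1 x.1 (sub_e x.2 y.1), (0 < x.2 y.1)%N & (0 < y.2 x.1)%N].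
Proof. by move=> /and4P[/asboolP Sx /asboolP Sy xy yx]; split=> //; exact: S_gt0. Qed.

Let r_cycle x q : path e x (rcons q x) -> uniq (x :: q) ->
  pathprod r x (rcons q x) = 1.
Proof.
move=> pq uq; rewrite pathprod_nth size_rcons.
(* The cycle is indexed from 1, as in (ii), while [nth] starts at 0; [s] repeats [x] at its end. *)
pose s := x :: rcons q x; pose i p := (nth x s p.-1).1; pose c p := (nth x s p.-1).2.
have sE a : (a <= size q)%N -> nth x s a = nth x (x :: q) a.
  by move=> aq; rewrite /s -rcons_cons nth_rcons /= ltnS aq.
have last_s : nth x s (size q).+1 = x by rewrite /s /= nth_rcons ltnn eqxx.
have ik : i (size q).+2 = i 1%N by rewrite /i [X in nth x s X]/= last_s.
have ck : c (size q).+2 = c 1%N by rewrite /c [X in nth x s X]/= last_s.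
rewrite -[RHS](@cond_ii (size q).+2 i c isT ik ck) => [|[//|p] pq'|[//|a] [//|b] aq bq ab iab cab].
- by rewrite [RHS]big_add1.
- have /eP[? ? ? ?] : e (nth x s p) (nth x s p.+1).
    have /pathP := pq; move=> /(_ x p); rewrite size_rcons ltnS; apply; exact: pq'.
  by split.
- move: ab; rewrite eqSS -(nth_uniq x _ _ uq) //= -?(sE a) -?(sE b) //.
  by rewrite [nth x s a]surjective_pairing -/(i a.+1) -/(c a.+1) iab cab
    -surjective_pairing eqxx.
Qed.

(** Detailed balance separates variables: W(i,c) c_j / nu_{j,i}(c - e_j) equals W(j,d) d_i /
    nu_{i,j}(d - e_i), so neither side depends on its vector, and the common value is K_{i,j}. *)
Lemma conductances : exists (K : 'I_n.+1 -> 'I_n.+1 -> R) (W : 'I_n.+1 -> Sn n -> R),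
  [/\ forall i j, K i j = K j i, forall i j, 0 <= K i j,
    forall i j, (i, j) \in types nu <-> 0 < K i j
  & forall i j (c : Sn n), (0 < c j)%N -> W i c * (c j)%:R = K i j * nu j i (sub_e c j)].
Proof.
have esym : symmetric e by move=> x y; rewrite /e andbCA; congr [&& _, _ & _]; rewrite andbC.
have [|w [w_gt0 wr]] := @potential R St
  (ord0, [ffun=> 0%N] : {ffun 'I_n.+1 -> nat}) e r esym _ r_cycle.
  move=> x y /eP[a b c d]; rewrite mulr_gt0 // divr_gt0 // ltr0n //.
(* Off [S] the weight is 0. Detailed balance survives there because a positive offspring probability
   would put the state into [S]. *)
pose W i c := if `[< S (i, c) >] then w (i, c) else 0.
have bal i j (c d : Sn n) : (0 < c j)%N -> (0 < d i)%N ->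
    W i c * ((c j)%:R * nu i j (sub_e d i)) = W j d * ((d i)%:R * nu j i (sub_e c j)).
  move=> cj di; rewrite /W; case: asboolP => [Sc|nSc]; last first.
    rewrite mul0r (_ : nu j i _ = 0) ?mulr0 //; apply/eqP.
    rewrite eq_le offspring_ge0 andbT leNgt; apply/negP => H; apply: nSc.
    by exists j.
  case: asboolP => [Sd|nSd]; last first.
    rewrite mul0r (_ : nu i j _ = 0) ?mulr0 //; apply/eqP.
    rewrite eq_le offspring_ge0 andbT leNgt; apply/negP => H; apply: nSd.
    by exists i.
  have xy : e (i, c) (j, d) by rewrite /e /= !asboolT //= cj di.
  have [n1 n2 _ _] := eP xy; rewrite (wr _ _ xy) /r /= in n1 n2 *.
  have d0 : ((d i)%:R : R) != 0 by rewrite pnatr_eq0 -lt0n.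
  have n0 := lt0r_neq0 n2.
  rewrite -mulrA; congr (_ * _).
  by rewrite mulf_div [(d i)%:R * _]mulrC divfK ?mulf_neq0 // mulrC.
have /boolp.choice[c0 c0P] (s : 'I_n.+1 * 'I_n.+1) :
    exists c : Sn n, s \in types nu -> 0 < nu s.1 s.2 c.
  have [/exists_offspring[c cp]|sN] := boolP (s \in types nu); first by exists c.
  by exists [ffun=> 0%N].
(* A reference vector at a vertex labeled [j] with a neighbor labeled [i], at which the quotient
   defining [K i j] is evaluated. *)
pose d i j := add_e (c0 (i, j)) i.
have dP (i j : 'I_n.+1) : (i, j) \in types nu -> 0 < nu i j (sub_e (d i j) i).
  by move=> /c0P; rewrite add_eK.
have d0 (i j : 'I_n.+1) : (0 < d i j i)%N by exact: add_e_gt0.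
have Wd i j : (i, j) \in types nu -> 0 < W j (d i j).
  by move=> /dP H; rewrite /W asboolT //; exists i; split=> //; exact: d0.
pose K i j := if (i, j) \in types nu
  then W j (d i j) * (d i j i)%:R / nu i j (sub_e (d i j) i) else 0.
have KW i j (c : Sn n) : (0 < c j)%N -> W i c * (c j)%:R = K i j * nu j i (sub_e c j).
  move=> cj; rewrite /K; case: ifPn => [ijN|ijN].
    apply: (mulIf (lt0r_neq0 (dP _ _ ijN))); rewrite -[LHS]mulrA bal //.
    by rewrite [RHS]mulrAC divfK ?mulrA // lt0r_neq0 // dP.
  have jiN : (j, i) \notin types nu by apply: contra ijN; exact: types_sym.
  rewrite (offspring_notin _ jiN) mulr0 /W; case: asboolP => [Sc|_]; last by rewrite mul0r.
  have := @S_gt0 (i, c) j Sc cj; rewrite /= (offspring_notin _ jiN) ltxx //.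
have K0 i j : (i, j) \in types nu -> 0 < K i j.
  by move=> ijN; rewrite /K ijN divr_gt0 ?mulr_gt0 ?Wd ?dP // ltr0n.
exists K, W; split=> // [i j|i j|i j].
- have [ijN|ijN] := boolP ((i, j) \in types nu); last first.
    rewrite /K (negbTE ijN) (_ : (j, i) \in _ = false) //.
    by apply: contraNF ijN; exact: types_sym.
  have jiN := types_sym ijN.
  rewrite [RHS]/K jiN KW // mulfK //; exact: lt0r_neq0 (dP _ _ jiN).
- by have [/K0/ltW|ijN] := boolP ((i, j) \in types nu); rewrite // /K (negbTE ijN).
- split; first exact: K0.
  by apply: contraPT => ijN; rewrite /K (negbTE ijN) ltxx.
Qed.

End conductances.

(** * Independent fields *)

HB.instance Definition _ n := Choice.on (Sn n).
HB.instance Definition _ n := isPointed.Build (Sn n) [ffun=> 0%N].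

Section cylinders.
Variables (n : nat) (I : choiceType) (Om : pointedType) (xi : I -> Om -> Sn n).
Implicit Types U : set I.

Definition gens U : set (set Om) :=
  [set A | exists a c, U a /\ A = [set w | xi a w = c]].

(** The value [None] stands for an unsatisfiable constraint. It makes the family stable under
    intersection when two cylinders disagree at an index. *)
Definition cyls U : set (set Om) :=
  [set A | exists (J : {fset I}) (B : I -> option (Sn n)),
    (forall a, a \in J -> U a) /\
    A = [set w | forall a, a \in J -> B a = Some (xi a w)]].

Lemma cyls_setI U : setI_closed (cyls U).
Proof.
move=> _ _ [J [B [JU ->]]] [J' [B' [JU' ->]]].
exists (J `|` J')%fset, (fun a => if a \in J then
  (if a \in J' then (if B a == B' a then B a else None) else B a) else B' a).
split=> [a|]; first by rewrite inE => /orP[/JU|/JU'].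
apply/seteqP; split=> w /= => [[H H'] a|H].
  rewrite inE; case: ifPn => [aJ _|_ /= aJ']; last exact: H'.
  by case: ifPn => [aJ'|_]; rewrite H // H' // eqxx.
split=> a aJ; have := H a; rewrite inE aJ ?orbT /= => /(_ isT).
  by case: ifP => // _; case: ifP.
by case: ifP => // _; case: ifP => // /eqP <-.
Qed.

Lemma gens_gen U : <<s gens U >> = <<s cyls U >>.
Proof.
apply/seteqP; split.
  apply: sub_sigma_algebra2 => _ [a [c [Ua ->]]]; exists [fset a]%fset, (fun=> Some c).
  split=> [b|]; first by rewrite inE => /eqP ->.
  apply/seteqP; split=> w /=; first by move=> <- b; rewrite inE => /eqP ->.
  by move=> /(_ a); rewrite inE eqxx => /(_ isT)[].
apply: smallest_sub; first exact: smallest_sigma_algebra.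
move=> _ [J [B [JU ->]]].
rewrite (_ : mkset _ = \bigcap_(a in [set` J]) [set w | B a = Some (xi a w)]); last first.
  by apply/seteqP; split=> w /= H a; exact: H.
apply: (@fin_bigcap_measurable _ (g_sigma_algebraType (gens U)) I [set` J]) => // a /= /JU Ua.
case Ba : (B a) => [c|].
  apply: sub_sigma_algebra; exists a, c; split=> //.
  by apply/seteqP; split=> w /=; [case|move->].
rewrite (_ : mkset _ = set0); first exact: sigma_algebra0.
by apply/seteqP; split.
Qed.

Lemma sub_gens U V : U `<=` V -> <<s gens U >> `<=` <<s gens V >>.
Proof.
move=> UV; apply: sub_sigma_algebra2 => _ [a [c [/UV Va ->]]].
by exists a, c.
Qed.

End cylinders.

Section independence.
Variables (R : realType) (n : nat) (I : choiceType).

Definition indep_field d (Om : measurableType d) (Q : probability Om R)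
    (xi : I -> Om -> Sn n) (p : I -> Sn n -> R) : Prop :=
  [/\ forall a c, measurable [set w | xi a w = c],
    forall a c, Q [set w | xi a w = c] = (p a c)%:E
  & mutually_independent Q setT
      (fun a => [set [set w | B (xi a w)] | B in [set: set (Sn n)]])].

Section one_field.
Context d (Om : measurableType d) (Q : probability Om R).
Variables (xi : I -> Om -> Sn n) (p : I -> Sn n -> R).
Hypothesis xip : indep_field Q xi p.

Lemma gens_measurable U : <<s gens xi U >> `<=` measurable.
Proof.
have [mxi _ _] := xip; apply: smallest_sub; first exact: sigma_algebra_measurable.
by move=> _ [a [c [_ ->]]].
Qed.

Lemma cyl_prob (J : {fset I}) (B : I -> option (Sn n)) :
  Q [set w | forall a, a \in J -> B a = Some (xi a w)] =
  (\prod_(a <- J) (if B a is Some c then p a c else 0)%:E)%E.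
Proof.
have [mxi xiQ ind] := xip.
have := ind J (fun a => [set w | B a = Some (xi a w)]).
rewrite (_ : \bigcap_(_ in _) _ = [set w | forall a, a \in J -> B a = Some (xi a w)]).
  move=> ->; last first.
    by move=> a aJ; split=> //; exists [set c | B a = Some c].
  apply: eq_bigr => a _; case: (B a) => [c|].
    rewrite -xiQ; congr (Q _).
    by apply/seteqP; split=> w /=; [case|move->].
  by rewrite (_ : mkset _ = set0) ?measure0 //; apply/seteqP; split.
by apply/seteqP; split=> w /= H a; exact: H.
Qed.

Lemma measure_unique_sigma (G : set (set Om)) (m1 m2 : {measure set Om -> \bar R}) :
  G `<=` measurable -> setI_closed G -> G setT -> (m1 setT < +oo)%E ->
  (forall A, G A -> m1 A = m2 A) -> forall A, <<s G >> A -> m1 A = m2 A.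
Proof.
move=> mG IG GT fin GE; apply: (@g_sigma_algebra_measure_unique _ _ _ G mG (fun=> setT)) => //.
by apply/seteqP; split=> // w _; exists 0%N.
Qed.

Lemma cyls_setT U : cyls xi U setT.
Proof.
exists fset0, (fun=> None); split=> [a|]; first by rewrite inE.
by apply/seteqP; split=> // w _ a; rewrite inE.
Qed.

Lemma cyls_measurable U : cyls xi U `<=` measurable.
Proof.
move=> A UA; apply: (@gens_measurable U); rewrite gens_gen; exact: sub_sigma_algebra.
Qed.

Lemma indep_cyls U V A B : U `&` V = set0 -> cyls xi U A -> cyls xi V B ->
  Q (A `&` B) = (Q A * Q B)%E.
Proof.
move=> UV [J [b [JU ->]]] [J' [b' [JV ->]]].
have JJ' a : a \in J -> a \in J' -> False.
  by move=> /JU Ua /JV Va; have : (U `&` V) a by []; rewrite UV.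
rewrite (_ : _ `&` _ = [set w | forall a, a \in (J `|` J')%fset ->
    (if a \in J then b a else b' a) = Some (xi a w)]); last first.
  apply/seteqP; split=> w /= => [[H H'] a|H].
    by rewrite inE; case: ifPn => [aJ _|_ /= aJ']; [exact: H|exact: H'].
  split=> a aJ; have := H a; rewrite inE aJ ?orbT /= => /(_ isT) //.
  by case: ifP => // aJ0; case: (JJ' a).
rewrite !cyl_prob (perm_big (J ++ J')) /=; last first.
  apply: uniq_perm => [||a]; rewrite ?fset_uniq ?cat_uniq ?fset_uniq ?andbT //=.
    by apply/hasPn => a aJ'; apply/negP => aJ; exact: (JJ' a).
  by rewrite inE mem_cat.
rewrite big_cat /=; congr (_ * _)%E; rewrite !big_seq; apply: eq_bigr => a aJ.
  by rewrite aJ.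
by case: ifP => // aJ0; case: (JJ' a).
Qed.

(** Both sides are finite measures in [A], the restriction of [Q] to [B] and a multiple of [Q], and
    they agree on a pi-system. *)
Lemma indep_ext (G : set (set Om)) B :
  G `<=` measurable -> setI_closed G -> G setT -> measurable B ->
  (forall A, G A -> Q (A `&` B) = (Q A * Q B)%E) ->
  forall A, <<s G >> A -> Q (A `&` B) = (Q A * Q B)%E.
Proof.
move=> mG IG GT mB GE A GA.
have QB : ((fine (Q B))%:E = Q B)%E by rewrite fineK // fin_num_measure.
pose k := NngNum (fine_ge0 (measure_ge0 Q B)).
have kE C : mscale k Q C = (Q C * Q B)%E by rewrite muleC -[in RHS]QB.
rewrite -kE; apply: (@measure_unique_sigma G (mrestr Q mB) (mscale k Q) mG IG GT) => //.
- rewrite /= /mrestr setTI.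
  by rewrite (le_lt_trans (probability_le1 _ mB)) // ltry.
- by move=> C GC; apply: etrans (esym (kE C)); exact: GE.
Qed.

Lemma indep_sigma U V A B : U `&` V = set0 ->
  <<s gens xi U >> A -> <<s gens xi V >> B -> Q (A `&` B) = (Q A * Q B)%E.
Proof.
move=> UV UA VB; have mB := gens_measurable VB; have mA := gens_measurable UA.
rewrite gens_gen in UA; rewrite gens_gen in VB.
apply: (indep_ext (@cyls_measurable U) (@cyls_setI _ _ _ _ U) (cyls_setT U) mB) => // {}A {}UA {mA}.
have mA := cyls_measurable UA.
rewrite setIC muleC.
apply: (indep_ext (@cyls_measurable V) (@cyls_setI _ _ _ _ V) (cyls_setT V) mA) => // {}B {}VB {mB}.
by rewrite setIC muleC; exact: indep_cyls UA VB.
Qed.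

Lemma indep_blocks (L : choiceType) (S : L -> set I) :
  (forall l l', l != l' -> S l `&` S l' = set0) ->
  mutually_independent Q setT (fun l => <<s gens xi (S l) >>).
Proof.
move=> dS J A JA.
(* The induction also records which coordinates the intersection depends on; [indep_sigma] needs
   this to add a block. *)
suff [_ H] : <<s gens xi (\bigcup_(l in [set` J]) S l) >>
      [set w | forall l, l \in (J : seq L) -> A l w] /\
    Q [set w | forall l, l \in (J : seq L) -> A l w] = (\prod_(l <- J) Q (A l))%E.
  rewrite -H; congr (Q _); apply/seteqP; split=> w /= K l; exact: K.
have {JA} : forall l, l \in (J : seq L) -> <<s gens xi (S l) >> (A l) by move=> l /JA[].
rewrite (_ : [set` J] = [set` (J : seq L)]) //.
elim: (J : seq L) (fset_uniq J) => [_ _|l s IH /= /andP[ls us] sA].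
  have -> : [set w | forall l, l \in [::] -> A l w] = setT.
    by apply/seteqP; split=> // w _ l; rewrite in_nil.
  rewrite big_nil probability_setT; split=> //.
  exact: (@measurableT _ (g_sigma_algebraType (gens xi _))).
have [|sB QB] := IH us; first by move=> l' l's; apply: sA; rewrite inE l's orbT.
have lA : <<s gens xi (S l) >> (A l) by apply: sA; rewrite inE eqxx.
set B := [set w | forall l, l \in s -> A l w] in sB QB.
have -> : [set w | forall l', l' \in l :: s -> A l' w] = A l `&` B.
  apply/seteqP; split=> w /= => [H|[Aw Bw] l'].
    by split; [apply: H; rewrite inE eqxx|move=> l' l's; apply: H; rewrite inE l's orbT].
  by rewrite inE => /orP[/eqP ->|/Bw].
split.
  apply: (@measurableI _ (g_sigma_algebraType (gens xi _))).
    by apply: sub_gens lA => a Sa; exists l => //=; rewrite inE eqxx.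
  by apply: sub_gens sB => a [l' l's Sa]; exists l' => //=; rewrite inE l's orbT.
rewrite big_cons -QB; apply: indep_sigma lA sB.
apply/seteqP; split=> // a [Sa [l' /= l's Sa']].
have ll' : l != l' by apply: contraNneq ls => ->.
by have : (S l `&` S l') a by []; rewrite dS.
Qed.

End one_field.

(** Cylinders have product probabilities, so [p] alone fixes the law of the field. This allows one
    embedding of a join to be exchanged for another. *)
Lemma indep_field_unique d (Om : measurableType d) (Q : probability Om R) xi
    d' (Om' : measurableType d') (Q' : probability Om' R) xi' p
    (D : set (I -> Sn n)) :
  indep_field Q xi p -> indep_field Q' xi' p ->
  <<s gens (fun a (z : I -> Sn n) => z a) setT >> D ->
  Q [set w | D (xi^~ w)] = Q' [set w | D (xi'^~ w)].
Proof.
move=> h h'; set Z := fun a (z : I -> Sn n) => z a.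
have mX d1 (O : measurableType d1) (P : probability O R) (y : I -> O -> Sn n) :
    indep_field P y p ->
    @measurable_fun _ _ O (g_sigma_algebraType (cyls Z setT)) setT (fun w => y^~ w).
  move=> yp; apply: (@measurability _ _ O (g_sigma_algebraType (cyls Z setT)) setT
    (fun w => y^~ w) (cyls Z setT)) => //.
  move=> _ [_ [J [B [_ ->]]] <-]; rewrite setTI.
  by apply: (cyls_measurable yp (U := setT)); exists J, B.
pose X : {mfun Om >-> g_sigma_algebraType (cyls Z setT)} :=
  HB.pack (fun w => xi^~ w) (isMeasurableFun.Build _ _ _ _ _ (mX _ _ _ _ h)).
pose X' : {mfun Om' >-> g_sigma_algebraType (cyls Z setT)} :=
  HB.pack (fun w => xi'^~ w) (isMeasurableFun.Build _ _ _ _ _ (mX _ _ _ _ h')).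
rewrite gens_gen => DZ.
apply: (@measure_unique_sigma _ (g_sigma_algebraType (cyls Z setT)) (cyls Z setT)
  (distribution Q X) (distribution Q' X') _ _ _ _ _ D DZ).
- by move=> A; exact: sub_sigma_algebra.
- exact: cyls_setI.
- exists fset0, (fun=> None); split=> [a|]; first by rewrite inE.
  by apply/seteqP; split=> // w _ a; rewrite inE.
- by rewrite /= /distribution /pushforward preimage_setT probability_setT ltry.
- move=> _ [J [B [_ ->]]].
  by have := cyl_prob h J B; rewrite -(cyl_prob h' J B).
Qed.

Lemma indep_field_reindex d (Om : measurableType d) (Q : probability Om R) xi p
    (I' : choiceType) (f : I' -> I) : injective f ->
  indep_field Q xi p ->
  [/\ forall a c, measurable [set w | xi (f a) w = c],
    forall a c, Q [set w | xi (f a) w = c] = (p (f a) c)%:E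
  & mutually_independent Q setT
      (fun a => [set [set w | B (xi (f a) w)] | B in [set: set (Sn n)]])].
Proof.
move=> fI [mxi xiQ ind]; split=> // J A JA.
(* An element of [J] serves as the default value of the partial inverse [g] of [f]. *)
have [->|/fset0Pn[a0 _]] := eqVneq J fset0.
  by rewrite big_seq_fset0 set_fset0 bigcap_set0 probability_setT.
pose g b := xget a0 [set a | f a = b].
have gK : cancel f g.
  by move=> a; rewrite /g; case: xgetP => [a' _ /fI //|/(_ a)] /(_ erefl).
have := ind (f @` J)%fset (A \o g); rewrite big_imfset /=; last by move=> a b _ _ /fI.
under eq_bigr => a _ do rewrite gK.
move=> <-; last first.
  move=> _ /imfsetP[a /= aJ ->]; rewrite gK; split=> //.
  by have [_] := JA _ aJ.
congr (Q _); apply/seteqP; split=> w /= H a.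
  by move=> /imfsetP[b /= bJ ->]; rewrite gK; exact: H.
by move=> aJ; have := H (f a); rewrite /= gK; apply; exact: in_imfset.
Qed.

End independence.

(** * Two Galton-Watson trees joined by an edge *)

Arguments gw_adj : simpl never.

(** Conditioning on the neighbors of the root becomes substitution: [c] replaces whatever the field
    says there. *)
Definition root_field n (c : Sn n) (y : field n) : field n :=
  fun a => if a.1 is [::] then c else y a.

(* The types of the children depend only on the label of the root, so that the
   first component of its type [(i, i)] is arbitrary. *)
Definition rooted_gw n i (c : Sn n) (y : field n) : rgraph n (word n) :=
  gw_graph (root_field c y) (i, i).

Notation field2 n := (bool * (word n * ('I_n.+1 * 'I_n.+1)) -> Sn n) (only parsing).

Definition side_type n (i j : 'I_n.+1) (b : bool) := if b then (i, j) else (j, i).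

Definition join_vtx n i j (z : field2 n) : set (bool * word n)%type :=
  [set x | gw_vertex (fun a => z (x.1, a)) (side_type i j x.1) x.2].

Definition join_adj n : rel (bool * word n)%type := fun x y =>
  if x.1 == y.1 then gw_adj x.2 y.2 else (x.2 == [::]) && (y.2 == [::]).

(* Two Galton-Watson trees with roots of types [(j, i)] and [(i, j)], joined by
   an edge between their roots; the root is that of the first one. *)
Definition join n i j (z : field2 n) : rgraph n (bool * word n)%type :=
  vgraph (@join_adj n) (fun x => (word_type (side_type i j x.1) x.2).2)
    (false, [::]) (join_vtx i j z).

Definition swap n (z : field2 n) : field2 n := fun a => z (~~ a.1, a.2).

(* The embedding of a join into a tree in which the second root is the child
   [(j, l)] of the root; the other children with label [j] are shifted. *)
Definition emb n (j : 'I_n.+1) (l : nat) (x : (bool * word n)%type) : word n :=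
  match x with
  | (true, v) => (j, l) :: v
  | (false, [::]) => [::]
  | (false, a :: v) => (a.1, if a.1 == j then bump l a.2 else a.2) :: v
  end.

Lemma emb_inj n j l : injective (@emb n j l).
Proof.
move=> [[] u] [[] v] /=.
- by move=> [->].
- case: v => // -[k r] v /= [jk]; rewrite -jk eqxx => lr _.
  by have := neq_bump l r; rewrite -lr eqxx.
- case: u => // -[k r] u /= [jk]; rewrite jk eqxx => lr _.
  by have := neq_bump l r; rewrite lr eqxx.
- case: u => [|[k r] u]; case: v => [|[k' r'] v] //= [<-].
  by case: eqP => _ => [/(can_inj (bumpK l)) -> ->|-> ->].
Qed.

Lemma is_child_cons n (a b : 'I_n.+1 * nat) (u v : word n) :
  is_child (a :: u) (b :: v) = (a == b) && is_child u v.
Proof. by rewrite /is_child prefix_cons /= eqSS andbCA. Qed.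

Lemma gw_adj_sym n : symmetric (@gw_adj n).
Proof. by move=> u v; rewrite /gw_adj orbC. Qed.

Lemma gw_adj_cons n (a b : 'I_n.+1 * nat) (u v : word n) :
  gw_adj (a :: u) (b :: v) = (a == b) && gw_adj u v.
Proof. by rewrite /gw_adj !is_child_cons (eq_sym b) -andb_orr. Qed.

Lemma emb_adj n j l (x y : (bool * word n)%type) :
  gw_adj (emb j l x) (emb j l y) = join_adj x y.
Proof.
have cross u v : gw_adj (emb j l (false, u)) ((j, l) :: v) = (u == [::]) && (v == [::]).
  case: u => [|[k r] u] /=; first by rewrite gw_adj_nil /= eqSS size_eq0.
  rewrite gw_adj_cons; case: eqP => //= -[kj]; rewrite kj eqxx => lr.
  by have := neq_bump l r; rewrite lr eqxx.
case: x y => [[] u] [[] v]; rewrite /join_adj /=.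
- by rewrite gw_adj_cons eqxx.
- by rewrite gw_adj_sym cross andbC.
- exact: cross.
- case: u => [|[k r] u]; case: v => [|[k' r'] v] //.
  rewrite /= !gw_adj_cons; congr (_ && _); rewrite !xpair_eqE /=.
    have [->|//] := eqVneq k k'; case: ifP => // _ /=.
    exact: (can_eq (bumpK l)).
Qed.

(** Without the child [(j, l)] a root with neighbors [c] has [sub_e c j] children, and [bump l]
    renumbers those labeled [j] around the gap. The tree is therefore a join along any of its root
    edges. *)
Lemma join_iso_by n i j l (c : Sn n) (z : field2 n) (y : field n) :
  (l < c j)%N -> z (false, ([::], (j, i))) = sub_e c j ->
  (forall b v t, (b, v) != (false, [::]) -> z (b, (v, t)) = y (emb j l (b, v), t)) ->
  iso_by (emb j l) (join i j z) (rooted_gw i c y).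
Proof.
move=> lc z0 zy.
have vE x : gw_vertex (root_field c y) (i, i) (emb j l x) = `[< join_vtx i j z x >].
  case: x => [[] v] /=; rewrite asboolb /=.
    rewrite lc /=; congr (gw_vertex _ _ _); apply/funext => -[u t] /=.
    by rewrite /root_field /= zy.
  case: v => [//|[k r] v] /=; rewrite z0 [root_field c y _]/=; congr (_ && _).
    rewrite ffunE; case: eqP => [->|_]; last by rewrite subn0.
    by rewrite /root_field /= /bump; case: (leqP l r) => /=; lia.
  congr (gw_vertex _ _ _); apply/funext => -[u t] /=.
  by rewrite /root_field /= zy.
split=> /=.
- split=> [x|x x' _ _|v].
  + by move=> xz; rewrite /= vE asboolT.
  + exact: emb_inj.
  + move=> gv; suff [x xv] : exists x, emb j l x = v.
      by exists x => //; apply/asboolP; rewrite -vE xv.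
    case: v {gv} => [|[k r] v]; first by exists (false, [::]).
    have [[-> ->]|kr] := eqVneq (k, r) (j, l); first by exists (true, v).
    have [kj|kj] := eqVneq k j; last by exists (false, (k, r) :: v); rewrite /= (negbTE kj).
    exists (false, (k, unbump l r) :: v); rewrite /= kj eqxx unbumpKcond.
    by case: eqP => // rl; rewrite kj rl eqxx in kr.
- move=> x x' xz x'z; rewrite -[X in _ && X]/(_ && gw_adj _ _) emb_adj !vE !asboolT //.
  by rewrite !andbT.
- by move=> [[] v] _ //=; case: v => [|[k r] v].
- by [].
Qed.

Lemma join_swap_iso_by n i j (z : field2 n) :
  iso_by (fun x => (~~ x.1, x.2)) (reroot (join i j z) (true, [::])) (join j i (swap z)).
Proof.
have vE x : join_vtx j i (swap z) (~~ x.1, x.2) <-> join_vtx i j z x.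
  case: x => b v; rewrite /join_vtx /=.
  rewrite (_ : side_type j i (~~ b) = side_type i j b); last by case: b.
  by rewrite (_ : (fun a => swap z (~~ b, a)) = (fun a => z (b, a))) //;
    apply/funext => a; rewrite /swap /= negbK.
split=> //=.
- split=> [x /vE //|[b v] [b' v'] _ _ /= [/negb_inj -> -> //]|[b v] bv].
  by exists (~~ b, v); rewrite /= ?negbK //; apply/vE; rewrite /= negbK.
- move=> x y _ _ /=; rewrite !(asbool_equiv_eq (vE _)); congr (_ && _).
  by rewrite /join_adj /= (inj_eq negb_inj).
- by move=> [[] v].
Qed.

Lemma join_exists n i j (z : field2 n) : exists y : field n,
  iso_by (emb j 0) (join i j z) (rooted_gw i (add_e (z (false, ([::], (j, i)))) j) y).
Proof.
(* This inverts [emb j 0]; the value at the root is arbitrary, since [root_field] overrides it. *)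
exists (fun a => match a.1 with
  | [::] => [ffun=> 0%N]
  | (k, r) :: v => if (k, r) == (j, 0%N) then z (true, (v, a.2))
      else z (false, ((k, if k == j then unbump 0 r else r) :: v, a.2)) end).
apply: join_iso_by; [exact: add_e_gt0|by rewrite add_eK|].
move=> [] v t /=; first by rewrite eqxx.
case: v => [|[k r] v] //= _; have [->|kj] := eqVneq k j.
  by rewrite bumpK xpair_eqE eqxx.
by rewrite xpair_eqE (negbTE kj).
Qed.

Lemma join_wf n i j (z : field2 n) : wf_graph (join i j z).
Proof. exact: vgraph_wf. Qed.

Lemma join_tree n i j (z : field2 n) : is_tree (join i j z).
Proof.
have [y jy] := join_exists i j z.
have [f fj] := iso_sym (join_wf i j z).1 (iso_byW jy).
apply: iso_by_tree fj (join_wf i j z) _; exact: gw_graph_tree.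
Qed.

Definition joinT n i j (z : field2 n) : Tspace n := tree_class (join i j z).

Definition rootedT n i c (y : field n) : Tspace n := tree_class (rooted_gw i c y).

(** A step of the walk to the child [(j, l)] amounts to swapping the two sides of the join. *)
Lemma joinT_rooted n i j l (c : Sn n) (z : field2 n) (y : field n) :
  (l < c j)%N -> z (false, ([::], (j, i))) = sub_e c j ->
  (forall b v t, (b, v) != (false, [::]) -> z (b, (v, t)) = y (emb j l (b, v), t)) ->
  joinT i j z = rootedT i c y /\
  joinT j i (swap z) = tree_class (reroot (rooted_gw i c y) [:: (j, l)]).
Proof.
move=> lc z0 zy; have jy := join_iso_by lc z0 zy.
split; first exact: eq_tree_class (tree_class_tree (join_tree i j z)) (iso_byW jy).
have zt : join_vtx i j z (true, [::]) by [].
apply/esym.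
have jr := iso_by_reroot jy (true, [::]).
rewrite -(eq_tree_class (tree_class_tree (tree_reroot (join_tree i j z) zt)) (iso_byW jr)).
apply: (eq_tree_class (tree_class_tree (tree_reroot (join_tree i j z) zt))).
exact/iso_byW/join_swap_iso_by.
Qed.

Lemma root_nbrs_rooted n i i' (c c' : Sn n) (y : field n) :
  root_nbrs i' c' (rootedT i c y) <-> i' = i /\ c' = c.
Proof.
have tG : is_tree (rooted_gw i c y) := gw_graph_tree _ _.
rewrite (root_nbrs_class _ _ (is_tree_wf tG) (tree_class_tree tG)).
split=> [[/= -> H]|[-> ->]]; split=> //.
  by apply/ffunP => k; rewrite -H gw_nb_nil.
by move=> k; rewrite gw_nb_nil.
Qed.

Lemma root_nbrs_join n i j i' (c : Sn n) (z : field2 n) :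
  root_nbrs i' c (joinT i j z) <->
  i' = i /\ c = add_e (z (false, ([::], (j, i)))) j.
Proof.
have [y jy] := join_exists i j z.
rewrite /joinT (eq_tree_class (tree_class_tree (join_tree i j z)) (iso_byW jy)).
exact: root_nbrs_rooted.
Qed.

Lemma measurable_joinT n d (Om : measurableType d) i j
    (z : bool * (word n * ('I_n.+1 * 'I_n.+1)) -> Om -> Sn n) :
  (forall a c, measurable [set w | z a w = c]) ->
  measurable_fun setT (fun w => joinT i j (z^~ w)).
Proof.
move=> mz.
apply: (@measurable_vgraph _ _ (@join_adj n)
  (fun x => (word_type (side_type i j x.1) x.2).2) (false, [::])
  _ _ (fun w => join_vtx i j (z^~ w))) => [x|w]; last exact/tree_class_tree/join_tree.
exact: (measurable_gw_vertex _ _ (fun a => mz (x.1, a))).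
Qed.

(* Pairs of labels that are not types get no children; the offspring vectors are
   then independent over all pairs, not only over the types. *)
Definition law (R : realType) n (nu : gw_measure R n) (s : 'I_n.+1 * 'I_n.+1)
    (c : Sn n) : R :=
  if s \in types nu then nu s.1 s.2 c else (c == [ffun=> 0%N])%:R.

(** The witness of a single [gw_law] carries the offspring vectors for all types; the remaining
    coordinates are set to the constant 0. *)
Lemma exists_field (R : realType) n (nu : gw_measure R n) :
  strongly_connected nu ->
  exists d (Om : measurableType d) (Q : probability Om R)
    (xi : word n * ('I_n.+1 * 'I_n.+1) -> Om -> Sn n),
    indep_field Q xi (fun a => law nu a.2).
Proof.
move=> sc; have [i0 iN] := types_snd nu ord0.
have [_ [P [d [Om [Q [xi [_ [mxi xiQ ind _ _]]]]]] _]] := sc _ _ iN iN.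
exists d, Om, Q, (fun a w => if a.2 \in types nu then xi a w else [ffun=> 0%N]).
split=> [a c|a c|J A JA].
- by case: (a.2 \in types nu) => //; exact: measurable_cstP.
- rewrite /law; case E: (a.2 \in types nu); first exact: xiQ.
  case: eqP => [<-|c0].
    by rewrite (_ : mkset _ = setT) ?probability_setT //; apply/seteqP; split.
  by rewrite (_ : mkset _ = set0) ?measure0 //; apply/seteqP; split=> // w /esym.
have [[a [aJ aN a0]]|n0] := pselect (exists a, [/\ a \in J, a.2 \notin types nu & A a = set0]).
  rewrite (_ : bigcap _ _ = set0); last first.
    by apply/seteqP; split=> // w /(_ a aJ); rewrite a0.
  by rewrite (big_fsetD1 a) //= a0 measure0 mul0e.
have AT a : a \in J -> a.2 \notin types nu -> A a = setT.
  move=> aJ aN; have [_ [B _ AB]] := JA _ aJ; move: AB; rewrite (negbTE aN) => AB.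
  have [B0|nB0] := pselect (B [ffun=> 0%N]).
    by rewrite -AB; apply/seteqP; split.
  by case: n0; exists a; split=> //; rewrite -AB; apply/seteqP; split.
pose J1 := [fset a in J | a.2 \in types nu]%fset.
have -> : \bigcap_(a in [set` J]) A a = \bigcap_(a in [set` J1]) A a.
  apply/seteqP; split=> w H a /= aJ; first by apply: H; move: aJ; rewrite !inE => /andP[].
  have [aN|aN] := boolP (a.2 \in types nu); last by rewrite AT.
  by apply: H; rewrite /= !inE aN andbT.
rewrite ind; last first.
  move=> a; rewrite !inE /= => /andP[aJ aN]; split=> //.
  by have [_ [B _ <-]] := JA _ aJ; rewrite aN; exists B.
rewrite -big_fset_condE big_mkcond /= !big_seq; apply: eq_bigr => a aJ.
by case: ifPn => // aN; rewrite AT // probability_setT.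
Qed.

Definition relocate n (j : 'I_n.+1) l (a : bool * (word n * ('I_n.+1 * 'I_n.+1))) :
    word n * ('I_n.+1 * 'I_n.+1) := (emb j l (a.1, a.2.1), a.2.2).

Lemma relocate_inj n j l : injective (@relocate n j l).
Proof.
move=> [b [v t]] [b' [v' t']] H.
have [-> ->] : (b, v) = (b', v') by apply: (@emb_inj n j l); exact: (congr1 fst H).
by congr (_, (_, _)); exact: (congr1 snd H).
Qed.

(** Only coordinates away from the root are assumed measurable, so that the lemma also applies to
    the sigma-field that they generate, which is independent of the root vector. *)
Lemma measurable_rootedT n d (Om : measurableType d)
    (xi : word n * ('I_n.+1 * 'I_n.+1) -> Om -> Sn n) i (c : Sn n) :
  (forall a c, a.1 != [::] -> measurable [set w | xi a w = c]) ->
  measurable_fun setT (fun w => rootedT i c (xi^~ w)).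
Proof.
move=> mxi; apply: (@measurable_gw_class n _ Om
  (fun a w => if a.1 is [::] then c else xi a w)) => -[[|x v] t] e /=.
  exact: measurable_cstP.
exact: mxi.
Qed.

Lemma measurable_rooted_moved n d (Om : measurableType d)
    (xi : word n * ('I_n.+1 * 'I_n.+1) -> Om -> Sn n) i j r (c : Sn n) :
  (r < c j)%N -> (forall a c, a.1 != [::] -> measurable [set w | xi a w = c]) ->
  measurable_fun setT
    (fun w => tree_class (reroot (rooted_gw i c (xi^~ w)) [:: (j, r)]) : Tspace n).
Proof.
move=> rc mxi.
(* Seen from the child [(j, r)], the tree is the swapped join of [z], and [measurable_joinT]
   applies. *)
pose z (a : bool * (word n * ('I_n.+1 * 'I_n.+1))) w :=
  if (a.1, a.2.1) == (false, [::]) then sub_e c j else xi (relocate j r a) w.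
rewrite (_ : (fun w => _) = fun w => joinT j i (swap (z^~ w))); last first.
  apply/funext => w; apply/esym.
  have [|b v t|_ <- //] := @joinT_rooted n i j r c (z^~ w) (xi^~ w) rc.
    by rewrite /z eqxx.
  by rewrite /z /= => /negbTE ->.
apply: (@measurable_joinT n _ Om j i (fun a => z (~~ a.1, a.2))) => a e.
rewrite /z /=; case: eqP => [_|/eqP n0]; first exact: measurable_cstP.
apply: mxi; apply: contra n0 => /eqP E; apply/eqP.
by apply: (@emb_inj n j r); exact: E.
Qed.

Lemma measurable_preimage d d' (X : measurableType d) (Y : measurableType d')
    (f : X -> Y) (A : set Y) :
  measurable_fun setT f -> measurable A -> measurable [set x | A (f x)].
Proof. by move=> mf mA; rewrite -[mkset _]setTI; exact: mf. Qed.

Section joined.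
Variables (R : realType) (n : nat) (nu : gw_measure R n).
Variables (d : measure_display) (Om : measurableType d) (Q : probability Om R).
Variable xi : word n * ('I_n.+1 * 'I_n.+1) -> Om -> Sn n.
Hypothesis xi_law : indep_field Q xi (fun a => law nu a.2).

(** The field [xi] pulled back along an embedding: the join that it drives is the tree driven by
    [xi] with its second root at [(j, l)], while its law is the same for all [j] and [l]. *)
Definition zeta j l (a : bool * (word n * ('I_n.+1 * 'I_n.+1))) : Om -> Sn n :=
  xi (relocate j l a).

Lemma zeta_law j l : indep_field Q (zeta j l) (fun a => law nu a.2.2).
Proof. exact: (indep_field_reindex (@relocate_inj n j l) xi_law). Qed.

Lemma zeta_swap_law j l :
  indep_field Q (fun a => zeta j l (~~ a.1, a.2)) (fun a => law nu a.2.2).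
Proof.
have fI : injective (fun a : bool * (word n * ('I_n.+1 * 'I_n.+1)) => (~~ a.1, a.2)).
  by move=> [b a] [b' a'] [/negb_inj -> ->].
exact: (indep_field_reindex fI (zeta_law j l)).
Qed.

Let coord (a : bool * (word n * ('I_n.+1 * 'I_n.+1)))
  (z : bool * (word n * ('I_n.+1 * 'I_n.+1)) -> Sn n) := z a.

Let measurable_coord a c : @measurable _ (g_sigma_algebraType (gens coord setT))
  [set z | coord a z = c].
Proof. by apply: sub_sigma_algebra; exists a, c. Qed.

Lemma measurable_joined i j (A B : set (Tspace n)) : measurable A -> measurable B ->
  <<s gens coord setT >> [set z | A (joinT i j z) /\ B (joinT j i (swap z))].
Proof.
move=> mA mB; apply: (@measurable_and _ (g_sigma_algebraType (gens coord setT))).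
  apply: (measurable_preimage _ mA).
  exact: (@measurable_joinT n _ (g_sigma_algebraType (gens coord setT)) i j coord).
apply: (measurable_preimage _ mB).
exact: (@measurable_joinT n _ (g_sigma_algebraType (gens coord setT)) j i
  (fun a => coord (~~ a.1, a.2))).
Qed.

Definition joined i j : Om -> Tspace n := fun w => joinT i j ((zeta ord0 0)^~ w).

Definition coupled i j (A B : set (Tspace n)) : set Om :=
  [set w | A (joined i j w) /\ B (joinT j i (swap ((zeta ord0 0)^~ w)))].

(** Exchanging the two sides is an injective reindexing, which keeps the law of the field and
    exchanges the two ends of the joining edge. *)
Lemma coupled_sym i j (A B : set (Tspace n)) : measurable A -> measurable B ->
  Q (coupled i j A B) = Q (coupled j i B A).
Proof.
move=> mA mB.
have := indep_field_unique (zeta_law ord0 0) (zeta_swap_law ord0 0)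
  (measurable_joined i j mA mB).
rewrite /coupled => ->; congr (Q _).
have E w : swap (fun a => zeta ord0 0 (~~ a.1, a.2) w) = (zeta ord0 0)^~ w.
  by apply/funext => -[b a]; rewrite /swap /= negbK.
apply/seteqP; split=> w /= [Hw Hw']; split=> //.
  by rewrite E in Hw'.
by rewrite E.
Qed.

Definition rooted_pair i (c : Sn n) j r (A B : set (Tspace n)) : set Om :=
  [set w | A (rootedT i c (xi^~ w)) /\
    B (tree_class (reroot (rooted_gw i c (xi^~ w)) [:: (j, r)]))].

(** By equality of laws the second root may be placed at [(j, r)]. The root event then fixes a
    single coordinate of [xi], and the remaining event reads only coordinates independent of it. *)
Lemma coupled_rooted i j (c : Sn n) r (A B : set (Tspace n)) :
  measurable A -> measurable B -> (r < c j)%N ->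
  Q (coupled i j (A `&` root_nbrs i c) B) =
  ((law nu (j, i) (sub_e c j))%:E * Q (rooted_pair i c j r A B))%E.
Proof.
move=> mA mB rc.
have cj : (0 < c j)%N by exact: leq_ltn_trans rc.
have mAR := measurableI _ _ mA (measurable_root_nbrs i c).
have -> : Q (coupled i j (A `&` root_nbrs i c) B) =
    Q [set w | (A (joinT i j ((zeta j r)^~ w)) /\
         root_nbrs i c (joinT i j ((zeta j r)^~ w)))
       /\ B (joinT j i (swap ((zeta j r)^~ w)))].
  exact: (indep_field_unique (zeta_law ord0 0) (zeta_law j r) (measurable_joined i j mAR mB)).
set E := rooted_pair i c j r A B.
(* The coordinates read by [rooted_pair], whose root vector is the constant [c]. *)
pose V := [set a : word n * ('I_n.+1 * 'I_n.+1) | a.1 != [::]].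
have -> : [set w | (A (joinT i j ((zeta j r)^~ w)) /\
         root_nbrs i c (joinT i j ((zeta j r)^~ w)))
       /\ B (joinT j i (swap ((zeta j r)^~ w)))] =
    [set w | xi ([::], (j, i)) w = sub_e c j] `&` E.
  have J w : xi ([::], (j, i)) w = sub_e c j ->
      joinT i j ((zeta j r)^~ w) = rootedT i c (xi^~ w) /\
      joinT j i (swap ((zeta j r)^~ w)) =
        tree_class (reroot (rooted_gw i c (xi^~ w)) [:: (j, r)]).
    by move=> x0; apply: joinT_rooted.
  apply/seteqP; split=> w.
    move=> [[Aw /root_nbrs_join[_ cE]] Bw].
    have x0 : xi ([::], (j, i)) w = sub_e c j by rewrite cE add_eK.
    by split=> //; have [E1 E2] := J w x0; rewrite /E /rooted_pair /= -E1 -E2.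
  move=> [x0 [Aw Bw]]; have [E1 E2] := J w x0; rewrite /= E1 E2; split=> //.
  by split=> //; apply/root_nbrs_rooted.
rewrite (@indep_sigma _ _ _ _ _ Q xi _ xi_law [set ([::], (j, i))] V).
- by have [_ -> _] := xi_law.
- by apply/seteqP; split=> // a [->] /eqP.
- by apply: sub_sigma_algebra; exists ([::], (j, i)), (sub_e c j).
have mxi a e : a.1 != [::] ->
    @measurable _ (g_sigma_algebraType (gens xi V)) [set w | xi a w = e].
  by move=> aV; apply: sub_sigma_algebra; exists a, e.
apply: (@measurable_and _ (g_sigma_algebraType (gens xi V))).
  by apply: (measurable_preimage _ mA); exact: measurable_rootedT.
by apply: (measurable_preimage _ mB); exact: measurable_rooted_moved.
Qed.

Lemma measurable_coupled i j (A B : set (Tspace n)) :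
  measurable A -> measurable B -> measurable (coupled i j A B).
Proof.
move=> mA mB; have [mxi _ _] := xi_law; apply: measurable_and.
  apply: (measurable_preimage _ mA); apply: measurable_joinT => a c; exact: mxi.
apply: (measurable_preimage _ mB).
by apply: (@measurable_joinT n _ Om j i (fun a => zeta ord0 0 (~~ a.1, a.2))) => a c; exact: mxi.
Qed.

End joined.

(** * The reversible measure *)

Definition children n (c : Sn n) : seq ('I_n.+1 * nat) :=
  [seq (j, r) | j <- enum 'I_n.+1, r <- iota 0 (c j)].

Lemma mem_children n (c : Sn n) x : (x \in children c) = (x.2 < c x.1)%N.
Proof.
apply/allpairsPdep/idP => [[j [r [_ rc ->]]]|xc] /=.
  by move: rc; rewrite mem_iota.
by exists x.1, x.2; rewrite mem_enum mem_iota xc; split=> //; case: (x).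
Qed.

Lemma children_uniq n (c : Sn n) : uniq (children c).
Proof.
apply: allpairs_uniq_dep => [|j _|]; rewrite ?enum_uniq ?iota_uniq //.
by move=> [j r] [j' r'] _ _ [-> ->].
Qed.

Lemma size_children n (c : Sn n) : size (children c) = (\sum_j c j)%N.
Proof.
rewrite size_allpairs_dep sumnE big_map big_enum /=.
by apply: eq_bigr => j _; rewrite size_iota.
Qed.

Definition child n (c : Sn n) (l : 'I_(size (children c))) : 'I_n.+1 * nat :=
  nth (ord0, 0%N) (children c) l.

Lemma child_lt n (c : Sn n) l : ((child (c:=c) l).2 < c (child l).1)%N.
Proof. by rewrite -mem_children mem_nth. Qed.

Lemma child_inj n (c : Sn n) : injective (@child n c).
Proof.
move=> l l' /eqP; rewrite /child nth_uniq ?children_uniq // => /eqP.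
exact: val_inj.
Qed.

Lemma child_surj n (c : Sn n) x : (x.2 < c x.1)%N -> exists l, child (c:=c) l = x.
Proof.
rewrite -mem_children => xc; have xs := xc; rewrite -index_mem in xs.
by exists (Ordinal xs); rewrite /child nth_index.
Qed.

Lemma sum_children (R : nmodType) n (c : Sn n) (F : 'I_n.+1 * nat -> R) :
  \sum_(l < size (children c)) F (child l) =
  \sum_j \sum_(r < c j) F (j, val r).
Proof.
rewrite -(big_mkord xpredT (fun l => F (nth (ord0, 0%N) (children c) l))).
rewrite -(big_nth _ xpredT F) big_allpairs_dep big_enum /=; apply: eq_bigr => j _.
by rewrite -[X in iota 0 X]subn0 -/(index_iota 0 (c j)) big_mkord.
Qed.

(** * Trees with prescribed neighbors of the root *)

Section rooted.
Variables (n : nat) (i : 'I_n.+1) (c : Sn n) (y : field n).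
Let G := rooted_gw i c y.

Lemma rooted_tree : is_tree G.
Proof. exact: gw_graph_tree. Qed.

Lemma rooted_vtx_cons x v :
  gw_vertex (root_field c y) (i, i) (x :: v) =
  (x.2 < c x.1)%N && gw_vertex (fun a => y (x :: a.1, a.2)) (i, x.1) v.
Proof. by []. Qed.

Lemma descendants_rooted x : (x.2 < c x.1)%N ->
  iso_by (cons x) (gw_graph (fun a => y (x :: a.1, a.2)) (i, x.1))
    (descendants G [:: x]).
Proof.
move=> xc; set H := gw_graph _ _.
have vE u : vtx G (x :: u) = vtx H u.
  by rewrite -[vtx G _]/(is_true (gw_vertex (root_field c y) (i, i) (x :: u))) rooted_vtx_cons xc.
have aE u v : adj G (x :: u) (x :: v) = adj H u v.
  by rewrite [LHS]gw_graph_adj [RHS]gw_graph_adj !rooted_vtx_cons xc gw_adj_cons eqxx.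
have pE u p : path (adj G) (x :: u) (map (cons x) p) = path (adj H) u p.
  by elim: p u => // v p IH u; exact: (congr2 andb (aE u v) (IH v)).
(* A path that avoids the empty word never changes its first letter. *)
have back u p : path (adj G) (x :: u) p -> [::] \notin p ->
    exists u', last (x :: u) p = x :: u'.
  elim: p u => [|v p IH] u; first by exists u.
  move=> /= /andP[/and3P[_ _ uv] vp]; rewrite inE negb_or eq_sym => /andP[vN pN].
  case: v vN uv vp => // b v _; rewrite -/(gw_adj _ _) gw_adj_cons => /andP[/eqP <- _].
  by move=> vp; exact: IH.
have S u : vtx H u -> exists p, [/\ path (adj G) [:: x] p, last [:: x] p = x :: u
    & root G \notin [:: x] :: p].
  move=> Hu; have tH : is_tree H by exact: gw_graph_tree.
  have [p pp pl] := tree_connected tH (tree_root tH) Hu.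
  exists (map (cons x) p); split; first by rewrite pE.
    by rewrite -[[:: x]]/(x :: root H) last_map pl.
  by rewrite inE negb_or /=; apply/mapP => -[].
split=> /=.
- split=> [u Hu|u v _ _ [] //|v [Gv [p [pp pl]]]] /=.
    split; last exact: S.
    by have := vE u; rewrite /= => ->.
  rewrite inE negb_or => /andP[_ pN]; have [u vu] := back [::] p pp pN.
  have uv : v = x :: u by rewrite -vu -pl.
  have Hu : vtx H u by rewrite -vE -uv.
  by exists u.
- move=> u v Hu Hv; rewrite !asboolT; [|exact: S|exact: S].
  by rewrite !andbT -/(gw_adj _ _); exact: aE.
- by [].
- by [].
Qed.

Lemma rooted_nbrs_bij :
  set_bij [set: 'I_(size (children c))] (nbrs G [::]) (fun l => [:: child l]).
Proof.
rewrite [nbrs G _]gw_nbrs_nil; split=> [l _|l l' _ _ [] /child_inj //|_ [x /= xc <-]].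
  by exists (child l) => //; exact: child_lt.
by have [l <-] := child_surj xc; exists l.
Qed.

End rooted.

(** * Finite mixtures of measures *)

Section mixtures.
Variables (R : realType) (d : measure_display) (T : measurableType d).

Lemma mixture (P : finType) (k : P -> {nonneg R})
    (m : P -> {measure set T -> \bar R}) :
  exists M : {measure set T -> \bar R},
    forall A, M A = (\sum_p (k p)%:num%:E * m p A)%E.
Proof.
have [p0 _|P0] := pickP P; last first.
  exists mzero => A; rewrite big1 // => p; by have := P0 p.
exists (msum (fun t => mscale (k (nth p0 (enum P) t)) (m (nth p0 (enum P) t))) #|P|) => A.
by rewrite /= /msum -[RHS]big_enum /= (big_nth p0) big_mkord -cardE.
Qed.

Section unit_mass.
Variable M : {measure set T -> \bar R}.
Hypothesis MT : M setT = 1%E.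

Definition unit_mass : set T -> \bar R := M.

HB.instance Definition _ := Measure.copy unit_mass M.

HB.instance Definition _ := Measure_isProbability.Build _ _ _ unit_mass MT.

Lemma probability_of_measure : exists mu : probability T R, forall A, mu A = M A.
Proof. by exists unit_mass. Qed.

End unit_mass.

End mixtures.

(** * The mixture of joins and one step of the walk *)

Section backward.
Variables (R : realType) (n : nat) (nu : gw_measure R n).
Variables (d : measure_display) (Om : measurableType d) (Q : probability Om R).
Variable xi : word n * ('I_n.+1 * 'I_n.+1) -> Om -> Sn n.
Hypothesis xi_law : indep_field Q xi (fun a => law nu a.2).
Variables (K : 'I_n.+1 -> 'I_n.+1 -> R) (W : 'I_n.+1 -> Sn n -> R).
Hypothesis K_sym : forall i j, K i j = K j i.
Hypothesis K_ge0 : forall i j, 0 <= K i j.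
Hypothesis K_types : forall i j, (i, j) \in types nu <-> 0 < K i j.
Hypothesis KW : forall i j (c : Sn n), (0 < c j)%N ->
  W i c * (c j)%:R = K i j * nu j i (sub_e c j).

Notation P := ('I_n.+1 * 'I_n.+1)%type.

Let Z : R := \sum_(p : P) K p.1 p.2.

Lemma total_gt0 : 0 < Z.
Proof.
have [i iN] := types_snd nu ord0.
rewrite /Z (bigD1 (i, ord0)) //= ltr_pwDl //; last exact: sumr_ge0.
exact/K_types.
Qed.

Let mxi a c : measurable [set w | xi a w = c].
Proof. by have [] := xi_law. Qed.

(** The padding of [law] is invisible under [K], which vanishes outside the types. *)
Lemma K_law i j c : K i j * law nu (j, i) c = K i j * nu j i c.
Proof.
rewrite /law; case: ifPn => // jiN.
have -> : K i j = 0; last by rewrite !mul0r.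
apply/eqP; rewrite eq_le K_ge0 andbT leNgt K_sym; apply/negP => /K_types.
by rewrite (negbTE jiN).
Qed.

Lemma measurable_joined_fun i j : measurable_fun setT (joined xi i j).
Proof. by apply: measurable_joinT => a c; exact: mxi. Qed.

HB.instance Definition _ i j :=
  isMeasurableFun.Build _ _ _ _ (joined xi i j) (measurable_joined_fun i j).

Let measurable_rooted_fun i (c : Sn n) :
  measurable_fun setT (fun w => rootedT i c (xi^~ w)).
Proof. by apply: measurable_rootedT => a e _; exact: mxi. Qed.

Definition rootedX i (c : Sn n) : Om -> Tspace n := fun w => rootedT i c (xi^~ w).

HB.instance Definition _ i c :=
  isMeasurableFun.Build _ _ _ _ (rootedX i c) (measurable_rooted_fun i c).

Let kappa (p : P) : {nonneg R} := NngNum (divr_ge0 (K_ge0 p.1 p.2) (ltW total_gt0)).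

(** The mass that the normalized mixture of joins carries across the joining edge from [A] to [B].
    Its first marginal is the reversible measure, and [integral_step_flow] identifies it with one
    step of the walk. *)
Definition flow (A B : set (Tspace n)) : \bar R :=
  (\sum_(p : P) (kappa p)%:num%:E * Q (coupled xi p.1 p.2 A B))%E.

Lemma flow_sym A B : measurable A -> measurable B -> flow A B = flow B A.
Proof.
move=> mA mB; rewrite /flow.
rewrite (reindex_inj (h := fun p : P => (p.2, p.1))) /=; last by move=> [a b] [a' b'] [-> ->].
apply: eq_bigr => -[i j] _ /=.
by rewrite (coupled_sym xi_law) //= K_sym.
Qed.

Lemma measurable_rooted_pair i (c : Sn n) j r (A B : set (Tspace n)) :
  measurable A -> measurable B -> (r < c j)%N ->
  measurable (rooted_pair xi i c j r A B).
Proof.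
move=> mA mB rc; apply: measurable_and.
  exact: (measurable_preimage (measurable_rooted_fun i c) mA).
apply: (measurable_preimage _ mB).
by apply: measurable_rooted_moved => // a e _; exact: mxi.
Qed.

(** All [c j] positions of the joined child give the same probability, so the contribution of [j] is
    split evenly among them. By [KW] each share has the weight [W i c / Z], which is free of [j]. *)
Lemma flow_rooted i (c : Sn n) (A B : set (Tspace n)) :
  measurable A -> measurable B ->
  flow (A `&` root_nbrs i c) B =
  (\sum_j \sum_(r < c j) (W i c / Z)%:E * Q (rooted_pair xi i c j r A B))%E.
Proof.
move=> mA mB; have mAR := measurableI _ _ mA (measurable_root_nbrs i c).
have -> : flow (A `&` root_nbrs i c) B = (\sum_i' \sum_j (kappa (i', j))%:num%:E *
    Q (coupled xi i' j (A `&` root_nbrs i c) B))%E.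
  by rewrite pair_bigA; apply: eq_bigr => -[].
rewrite (bigD1 i) //= [X in (_ + X)%E]big1 ?adde0; last first.
  move=> i' ii'; rewrite big1 // => j _.
  rewrite (_ : coupled _ _ _ _ _ = set0) ?measure0 ?mule0 //.
  apply/seteqP; split=> // w [[_ /root_nbrs_join[ii _]] _].
  by rewrite ii eqxx in ii'.
apply: eq_bigr => j _.
have [cj|] := posnP (c j).
  rewrite (_ : coupled _ _ _ _ _ = set0) ?measure0 ?mule0.
    by rewrite big1 // => -[r rc] _; move: (rc); rewrite cj.
  apply/seteqP; split=> // w [[_ /root_nbrs_join[_ cE]] _].
  by have := add_e_gt0 (zeta xi ord0 0 (false, ([::], (j, i))) w) j; rewrite -cE cj.
move=> cj; set C := Q _.
have fC : C \is a fin_num by apply: fin_num_measure; exact: (measurable_coupled xi_law).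
have E (r : 'I_(c j)) : ((W i c / Z)%:E * Q (rooted_pair xi i c j r A B) =
    (K i j / Z * fine C / (c j)%:R)%:E)%E.
  have fq : Q (rooted_pair xi i c j r A B) \is a fin_num.
    by apply: fin_num_measure; exact: measurable_rooted_pair.
  rewrite -(fineK fq) -EFinM; congr EFin.
  have -> : fine C = law nu (j, i) (sub_e c j) * fine (Q (rooted_pair xi i c j r A B)).
    by rewrite /C (coupled_rooted xi_law i mA mB (ltn_ord r)) fineM.
  have c0 : (c j)%:R != 0 :> R by rewrite pnatr_eq0 -lt0n.
  apply: (mulIf c0); rewrite divfK // mulrAC [RHS]mulrA; congr (_ * _).
  by rewrite mulrAC [RHS]mulrAC; congr (_ * _); rewrite K_law -KW.
rewrite (eq_bigr _ (fun r _ => E r)) sumEFin sumr_const card_ord.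
rewrite -(mulr_natr (K i j / Z * fine C / (c j)%:R)) divfK.
  by rewrite -[in LHS](fineK fC) -EFinM.
by rewrite pnatr_eq0 -lt0n.
Qed.

Lemma mu_exists : exists mu : probability (Tspace n) R,
  forall A, mu A = flow A setT.
Proof.
have [M ME] := mixture kappa (fun p => distribution Q (joined xi p.1 p.2)).
have MF A : M A = flow A setT.
  rewrite ME; apply: eq_bigr => p _; congr (_ * Q _)%E.
  by apply/seteqP; split=> w /=; [split|case].
have [|mu muM] := @probability_of_measure _ _ _ M.
  rewrite ME (eq_bigr (fun p : P => (K p.1 p.2 / Z)%:E)) => [|p _]; last first.
    have := probability_setT (distribution Q (joined xi p.1 p.2)) => /= ->.
    by rewrite mule1.
  by rewrite sumEFin -mulr_suml divff // gt_eqF // total_gt0.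
by exists mu => A; rewrite muM MF.
Qed.

Variable mu : probability (Tspace n) R.
Hypothesis muE : forall A, mu A = flow A setT.

Let size_c (c : Sn n) : (\sum_j c j)%N = size (children c).
Proof. by rewrite size_children. Qed.

(** With [B] the whole space, [flow_rooted] has equal terms, one for each neighbor; hence the factor
    [size (children c)]. *)
Lemma mu_rooted i (c : Sn n) (A : set (Tspace n)) : measurable A ->
  mu (A `&` root_nbrs i c) =
  ((W i c / Z * (size (children c))%:R)%:E * Q (rootedX i c @^-1` A))%E.
Proof.
move=> mA; rewrite muE flow_rooted //.
have fq : Q (rootedX i c @^-1` A) \is a fin_num.
  by apply: fin_num_measure; exact: (measurable_preimage (measurable_rooted_fun i c) mA).
transitivity (\sum_j \sum_(r < c j) (W i c / Z * fine (Q (rootedX i c @^-1` A)))%:E)%E.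
  apply: eq_bigr => j _; apply: eq_bigr => r _.
  rewrite [RHS]EFinM fineK //; congr (_ * Q _)%E.
  by apply/seteqP; split=> w /=; [case|split].
rewrite -[in RHS](fineK fq) -EFinM -size_c natr_sum [in RHS]mulrAC mulr_sumr.
rewrite -sumEFin; apply: eq_bigr => j _.
by rewrite sumEFin sumr_const card_ord mulr_natr.
Qed.

Lemma W_ge0 i (c : Sn n) : (0 < size (children c))%N -> 0 <= W i c.
Proof.
rewrite -size_c lt0n sum_nat_eq0 negb_forall => /existsP[j]; rewrite /= -lt0n => cj.
have c0 : 0 < (c j)%:R :> R by rewrite ltr0n.
by rewrite -(pmulr_lge0 _ c0) KW // mulr_ge0 // offspring_ge0.
Qed.

Lemma mass_ge0 i (c : Sn n) : 0 <= W i c / Z * (size (children c))%:R.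
Proof.
have [->|c0] := posnP (size (children c)); first by rewrite mulr0.
by rewrite mulr_ge0 // divr_ge0 ?W_ge0 // ltW // total_gt0.
Qed.

Lemma mu_root_nbrs i (c : Sn n) :
  mu (root_nbrs i c) = (W i c / Z * (size (children c))%:R)%:E.
Proof. by rewrite -[root_nbrs i c]setTI mu_rooted // preimage_setT probability_setT mule1. Qed.

Lemma rooted_iso i (c : Sn n) w : exists f : word n -> nat,
  iso_by f (rooted_gw i c (xi^~ w)) (rep (rootedX i c w)).
Proof.
have tG := rooted_tree i c (xi^~ w).
by have := iso_sym (rep_wf _).1 (tree_class_tree tG).
Qed.

Lemma rooted_nbrs i (c : Sn n) w f :
  iso_by f (rooted_gw i c (xi^~ w)) (rep (rootedX i c w)) ->
  set_bij [set: 'I_(size (children c))] (rnbrs (rootedX i c w))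
    (fun l => f [:: child l]).
Proof.
move=> fG; have tG := rooted_tree i c (xi^~ w).
have := iso_by_nbrs fG (is_tree_wf tG) (rep_wf _) (tree_root tG).
rewrite (iso_by_root fG); exact: (set_bij_comp (rooted_nbrs_bij i c (xi^~ w))).
Qed.

(** The number of neighbors in the mass of the root event cancels against the uniform choice of one
    of them, which leaves the weights of [flow_rooted]. *)
Lemma integral_step_rooted i (c : Sn n) (A B : set (Tspace n)) :
  measurable A -> measurable B ->
  (\int[mu]_(T in A `&` root_nbrs i c) (step R T B)%:E =
   flow (A `&` root_nbrs i c) B)%E.
Proof.
move=> mA mB; have mAR := measurableI _ _ mA (measurable_root_nbrs i c).
have /boolp.choice[f fG] := rooted_iso i c.
pose Y (l : 'I_(size (children c))) :=
  [set w | B (tree_class (reroot (rooted_gw i c (xi^~ w)) [:: child l]))].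
have mY l : measurable (Y l).
  apply: (measurable_preimage _ mB); rewrite [child l]surjective_pairing.
  by apply: measurable_rooted_moved => [|a e _]; [exact: child_lt|exact: mxi].
rewrite (@integral_step R n mu _ Om Q (rootedX i c) (size (children c))
  (fun w l => f w [:: child l]) Y (NngNum (mass_ge0 i c))) //; first last.
- move=> w l _; rewrite /Y /= /moved.
  have tG := rooted_tree i c (xi^~ w).
  have lG : vtx (rooted_gw i c (xi^~ w)) [:: child l].
    by rewrite /= /root_field /= child_lt.
  by rewrite (eq_tree_class (tree_class_tree (tree_reroot tG lG)) (iso_byW (iso_by_reroot (fG w) _))).
- by move=> w _; exact: rooted_nbrs.
- move=> C mC CA; rewrite -mu_rooted //; congr (mu _).
  by apply/esym/setIidPl => T /CA[].
rewrite flow_rooted // /=.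
have q_fin l : Q (rooted_pair xi i c (child (c:=c) l).1 (child l).2 A B) \is a fin_num.
  by apply: fin_num_measure; apply: measurable_rooted_pair => //; exact: child_lt.
rewrite -(sum_children c (fun x => (W i c / Z)%:E * Q (rooted_pair xi i c x.1 x.2 A B))%E).
rewrite muleA -EFinM.
have [m0|m0] := posnP (size (children c)).
  rewrite !big1 ?mule0 // => -[l lm] _; by exfalso; move: (lm); rewrite m0.
rewrite mulfK ?pnatr_eq0 -?lt0n //.
rewrite ge0_sume_distrr; last by move=> l _; exact: measure_ge0.
apply: eq_bigr => l _; congr (_ * Q _)%E.
apply/seteqP; split=> w /=.
  by move=> [[Aw _] Bw]; split=> //; rewrite -surjective_pairing.
move=> [Aw Bw]; split; last by rewrite /Y /= [child l]surjective_pairing.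
by split=> //; exact/root_nbrs_rooted.
Qed.

Lemma integral_step_flow (A B : set (Tspace n)) : measurable A -> measurable B ->
  (\int[mu]_(T in A) (step R T B)%:E = flow A B)%E.
Proof.
move=> mA mB.
(* Both sides are countably additive in [A], so [A] is cut along the label and the neighbors of the
   root; the pairs are coded by numbers to form a sequence. *)
pose F k := if @choice.pickle_inv ('I_n.+1 * Sn n)%type k is Some x
  then A `&` root_nbrs x.1 x.2 else set0.
have mF k : measurable (F k).
  by rewrite /F; case: choice.pickle_inv => // x; apply: measurableI => //; exact: measurable_root_nbrs.
have AF : A = \bigcup_k F k.
  apply/seteqP; split=> [T AT|T [k _]]; last by rewrite /F; case: choice.pickle_inv => // x [].
  pose x : 'I_n.+1 * Sn n := (lab (rep T) (root (rep T)),
    [ffun j => nb (rep T) (root (rep T)) j]).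
  exists (choice.pickle x) => //; rewrite /F choice.pickleK_inv; split=> //.
  by split=> // j; rewrite ffunE.
have tF : trivIset setT F.
  move=> k k' _ _ [T []]; rewrite /F.
  case E : choice.pickle_inv => [x|//]; case E' : choice.pickle_inv => [x'|//].
  move=> [_ [xl xc]] [_ [xl' xc']].
  have xx : x = x'.
    apply: injective_projections; first by rewrite -xl -xl'.
    by apply/ffunP => j; rewrite -xc -xc'.
  have := @choice.pickle_invK ('I_n.+1 * Sn n)%type k.
  have := @choice.pickle_invK ('I_n.+1 * Sn n)%type k'.
  by rewrite E E' /= xx => <- <-.
rewrite [in LHS]AF ge0_integral_bigcup //; first last.
- by move=> T _; rewrite lee_fin step_ge0.
- by apply/measurable_EFinP/measurable_funTS; exact: measurable_step.
have FE k : (\int[mu]_(T in F k) (step R T B)%:E = flow (F k) B)%E.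
  rewrite /F; case: choice.pickle_inv => [x|]; first exact: integral_step_rooted.
  rewrite integral_set0 /flow big1 // => p _.
  by rewrite (_ : coupled _ _ _ _ _ = set0) ?measure0 ?mule0 //; apply/seteqP; split=> // w [].
rewrite (eq_eseriesr (fun k _ => FE k)) /flow nneseries_sum; last first.
  move=> *; apply: mule_ge0; last exact: measure_ge0.
  by rewrite lee_fin divr_ge0 // ltW // total_gt0.
apply: eq_bigr => p _; rewrite nneseriesZl; last by move=> k _; exact: measure_ge0.
congr (_ * _)%E; transitivity (Q (\bigcup_k coupled xi p.1 p.2 (F k) B)).
  rewrite measure_semi_bigcup //.
  - by move=> k; exact: (measurable_coupled xi_law).
  - move=> k k' _ _ [w [[Fw _] [Fw' _]]]; apply: tF => //.
    by exists (joined xi p.1 p.2 w).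
  - by apply: bigcupT_measurable => k; exact: (measurable_coupled xi_law).
congr (Q _); apply/seteqP; split=> w /=.
  by move=> [k _ [Fw Bw]]; split=> //; rewrite AF; exists k.
by rewrite AF => -[[k _ Fw] Bw]; exists k.
Qed.

Lemma mu_reversible : reversible mu.
Proof. by move=> A B mA mB; rewrite !integral_step_flow // flow_sym. Qed.

Lemma mu_standing : standing mu.
Proof.
split=> [i|].
  have [j jiN] := types_snd nu i.
  have [c0 c0p] := exists_offspring jiN.
  pose c := add_e c0 j.
  have cj : (0 < c j)%N := add_e_gt0 _ _.
  have mc : (0 < mu (root_nbrs i c))%E.
    have s0 : (0 < size (children c))%N by rewrite -size_c (bigD1 j) //= addn_gt0 cj.
    rewrite mu_root_nbrs lte_fin mulr_gt0 ?ltr0n // divr_gt0 ?total_gt0 //.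
    have cR : 0 < (c j)%:R :> R by rewrite ltr0n.
    rewrite -(pmulr_lgt0 _ cR) KW // add_eK mulr_gt0 // K_sym; exact/K_types.
  apply: lt_le_trans mc _; apply: le_measure; rewrite ?inE.
  - exact: measurable_root_nbrs.
  - exact: measurable_root_label.
  - by move=> T [].
(* A root without neighbors lies in one of the events with vector 0, whose mass has the factor 0. *)
apply: (@negligibleS _ _ _ _ (\bigcup_k root_nbrs (inord k) [ffun=> 0%N])).
  move=> T nT; exists (val (lab (rep T) (root (rep T)))) => //; split.
    by rewrite inord_val.
  move=> j; rewrite ffunE; apply/eqP; rewrite cardfs_eq0; apply/eqP.
  rewrite (_ : _ `&` _ = set0) ?fset_set0 //.
  by apply/seteqP; split=> // x [Tx _]; apply: nT; exists x.
apply: negligible_bigcup => k; apply/negligibleP; first exact: measurable_root_nbrs.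
rewrite [LHS]mu_root_nbrs -size_c big1 ?mulr0 // => j _; by rewrite ffunE.
Qed.

Lemma mu_sim : sim mu nu.
Proof.
move=> i c mc.
have Wc : 0 < W i c / Z * (size (children c))%:R by rewrite -lte_fin -mu_root_nbrs.
have W0 : 0 < W i c.
  have s0 : 0 < (size (children c))%:R :> R.
    rewrite lt0r ler0n andbT; apply: contraTneq Wc => ->.
    by rewrite mulr0 ltxx.
  by move: Wc; rewrite pmulr_lgt0 // pmulr_lgt0 // invr_gt0 total_gt0.
have ctypes j : (0 < c j)%N -> (i, j) \in types nu.
  move=> cj; apply/K_types; have : 0 < W i c * (c j)%:R by rewrite mulr_gt0 // ltr0n.
  rewrite KW // => H; rewrite lt0r K_ge0 andbT; apply: contraTneq H => ->.
  by rewrite mul0r ltxx.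
split=> //.
(* The coordinates below the [l]-th child. These blocks are disjoint, which makes the subtrees
   independent, and each is a reindexing of [xi], which makes them Galton-Watson trees. *)
pose sub (l : 'I_(size (children c))) (a : word n * ('I_n.+1 * 'I_n.+1)) :=
  (child l :: a.1, a.2).
pose S l := range (sub l).
have dS l l' : l != l' -> S l `&` S l' = set0.
  move=> ll'; apply/seteqP; split=> // a [[b _ <-] [b' _ [/child_inj E _ _]]].
  by rewrite E eqxx in ll'.
have mX l : measurable_fun setT
    (fun w => tree_class (gw_graph (fun a => xi (sub l a) w) (i, (child l).1)) : Tspace n).
  by apply: measurable_gw_class => a e; exact: mxi.
pose X l : {mfun Om >-> Tspace n} := HB.pack
  (fun w => tree_class (gw_graph (fun a => xi (sub l a) w) (i, (child l).1)) : Tspace n)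
  (isMeasurableFun.Build _ _ _ _ _ (mX l)).
have sub_inj l : injective (sub l) by move=> [u t] [u' t'] [-> ->].
exists d, Om, Q, (rootedX i c), (size (children c)), (fun l => (child l).1), X; split.
- by move=> A mA; rewrite mu_rooted // mu_root_nbrs.
- move=> w; have [f fG] := rooted_iso i c w.
  have tG := rooted_tree i c (xi^~ w).
  exists (fun l => f [:: child l]); split; first exact: rooted_nbrs.
    move=> l; rewrite (iso_by_lab fG) //=.
    by rewrite /root_field /= child_lt.
  move=> l; have lG : vtx (rooted_gw i c (xi^~ w)) [:: child l].
    by rewrite /= /root_field /= child_lt.
  apply: class_of_iso (iso_byW (iso_by_descendants fG (is_tree_wf tG) (rep_wf _) lG)).
  apply: class_of_iso (iso_byW (descendants_rooted i (xi^~ w) (child_lt l))).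
  exact: tree_class_tree (gw_graph_tree _ _).
- move=> J A JA; apply: (indep_blocks xi_law dS) => l lJ; split=> //.
  have [_ [B mB <-]] := JA l lJ.
  have mX' : measurable_fun (setT : set (g_sigma_algebraType (gens xi (S l)))) (X l).
    apply: measurable_gw_class => a e; apply: sub_sigma_algebra.
    by exists (sub l a), e; split=> //; exists a.
  by have := mX' measurableT B mB; rewrite setTI.
- move=> l.
  have [m1 m2 m3] := indep_field_reindex (sub_inj l) xi_law.
  exists d, Om, Q, (fun a => xi (sub l a)), (X l); split=> //.
  + by move=> a e aN; rewrite m2 /law aN.
  + by move=> J A JA; apply: m3 => a aJ; have [_ ?] := JA a aJ.
  + by move=> w; exact: tree_class_tree (gw_graph_tree _ _).
Qed.

End backward.

Theorem theorem3p5 (R : realType) (n : nat) (nu : gw_measure R n) :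
  strongly_connected nu ->
  (exists mu : probability (Tspace n) R,
     [/\ standing mu, reversible mu & sim mu nu])
  <->
  ((forall (i j k : 'I_n.+1) (c : Sn n),
      (0 < c j)%N -> 0 < nu j i (sub_e c j) -> (0 < c k)%N ->
      0 < nu k i (sub_e c k))
   /\
   (forall (k : nat) (i : nat -> 'I_n.+1) (c : nat -> Sn n),
      (2 <= k)%N -> i k = i 1%N -> c k = c 1%N ->
      (forall p, (1 <= p <= k.-1)%N ->
         [/\ (0 < c p (i p.+1))%N, (0 < c p.+1 (i p))%N
           & 0 < nu (i p) (i p.+1) (sub_e (c p.+1) (i p))]) ->
      (forall s t, (1 <= s <= k.-1)%N -> (1 <= t <= k.-1)%N -> s != t ->
         i s = i t -> c s <> c t) ->
      \prod_(1 <= p < k)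
        (nu (i p) (i p.+1) (sub_e (c p.+1) (i p))
           / nu (i p.+1) (i p) (sub_e (c p) (i p.+1))
         * ((c p (i p.+1))%:R / (c p.+1 (i p))%:R)) = 1)).
Proof.
move=> sc; have re := strongly_connected_reach sc; split.
  move=> [mu [st rv sm]]; have [W0 Wt Wb Wr] := reversible_conditions sc st rv sm.
  split; first exact: (balance_i W0 Wt Wb Wr re).
  by move=> k i c k2 ik ck H _; exact: (balance_ii W0 Wt Wb Wr re).
move=> [ci cii]; have [K [W [Ks K0 Kt KW]]] := conductances re ci cii.
have [d [Om [Q [xi xil]]]] := exists_field sc.
have [mu muE] := mu_exists xil K0 Kt.
exists mu; split.
- exact: (mu_standing xil Ks KW muE).
- exact: (mu_reversible xil Ks KW muE).
- exact: (mu_sim xil Ks KW muE).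
Qed.
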